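(* Assume $V=L$. Let $X=(X,d)$ be an uncountable ultrametric Polish space. Then there is a map $\psi$ from $\mathscr P(\omega)$ into the $\boldsymbol\Pi^1_1$ (coanalytic) subsets of $X$ such that for all $a,b\subseteq\omega$: (1) if $a\subseteq b$ then $\psi(a)\le_{\mathsf L(d)}\psi(b)$; (2) if $\psi(a)\le_{\mathsf{Bor}(X)}\psi(b)$ then $a\subseteq b$. In particular, $(\mathscr P(\omega),\subseteq)$ embeds into the $\mathcal F$-hierarchy on the $\boldsymbol\Pi^1_1$ subsets of $X$ for every reducibility $\mathcal F$ with $\mathsf L(d)\subseteq\mathcal F\subseteq\mathsf{Bor}(X)$, and hence the $\mathcal F$-hierarchy on $\boldsymbol\Pi^1_1$ subsets of $X$ is very bad.
   Context: An ultrametric Polish space is a separable metric space $(X,d)$ with $d$ a complete ultrametric. $\mathsf L(d)$: maps $f\colon X\to X$ with $d(f(x),f(y))\le d(x,y)$; $\mathsf{Bor}(X)$: Borel measurable maps $X\to X$. A reducibility is a set of self-maps of $X$ closed under composition containing the identity; $A\le_{\mathcal F}B$ iff $A=f^{-1}(B)$ for some $f\in\mathcal F$. The $\mathcal F$-hierarchy on a class $\Gamma$ is the quotient of $(\Gamma,\le_{\mathcal F})$; very bad means it contains both an infinite antichain and an infinite strictly descending chain. *)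

(* Defs.v *)
From HB Require Import structures.
From mathcomp Require Import all_boot all_order all_algebra.
From mathcomp Require Import all_classical all_reals.
From mathcomp Require Import topology measure.

Set Implicit Arguments.
Unset Strict Implicit.
Unset Printing Implicit Defensive.

Import Order.TTheory GRing.Theory Num.Theory.
Local Open Scope classical_set_scope.
Local Open Scope ring_scope.

(** * The axiom of constructibility

    The universe of sets is Aczel's type of well-founded trees: [vset] stands
    for the class V, with bisimulation [veq] as equality and [vin] as
    membership.  With the classical axioms of [boolp] it is a model of ZFC
    whose subsets of omega are exactly the predicates on [nat]. *)

Inductive vset : Type := Vset (A : Type) (f : A -> vset).

Definition carrier (x : vset) : Type := let: Vset A _ := x in A.

Definition elt (x : vset) : carrier x -> vset :=
  match x with Vset _ f => f end.

Fixpoint veq (x y : vset) {struct x} : Prop :=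
  match x, y with
  | Vset A f, Vset B g =>
      (forall a, exists b, veq (f a) (g b)) /\
      (forall b, exists a, veq (f a) (g b))
  end.

Definition vin (x y : vset) : Prop := exists b : carrier y, veq x (elt b).

(** Formulas of the language of set theory with free variables in ['I_n];
    variable [ord0] is the one bound by [Fex]. *)
Inductive formula : nat -> Type :=
  | Fmem n (i j : 'I_n) : formula n
  | Feq n (i j : 'I_n) : formula n
  | Fnot n (p : formula n) : formula n
  | Fand n (p q : formula n) : formula n
  | Fex n (p : formula n.+1) : formula n.

Definition env_cons (T : Type) n (x : T) (e : 'I_n -> T) : 'I_n.+1 -> T :=
  fun i => oapp e x (unlift ord0 i).

(** [sat M p e] is satisfaction of [p] in the structure (M, ∈), so that
    quantifiers range over the elements of [M]. *)
Fixpoint sat (M : vset) n (p : formula n) : ('I_n -> carrier M) -> Prop :=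
  match p in formula n return ('I_n -> carrier M) -> Prop with
  | Fmem _ i j => fun e => vin (elt (e i)) (elt (e j))
  | Feq _ i j => fun e => veq (elt (e i)) (elt (e j))
  | Fnot _ p => fun e => ~ sat p e
  | Fand _ p q => fun e => sat p e /\ sat q e
  | Fex _ p => fun e => exists x : carrier M, sat p (env_cons x e)
  end.

(** {x ∈ M | (M, ∈) ⊨ p(x, e)} *)
Definition definable_subset (M : vset) n (p : formula n.+1)
    (e : 'I_n -> carrier M) : vset :=
  Vset (fun x : {x : carrier M | sat p (env_cons x e)} => elt (sval x)).

(** Def(M): the subsets of M first-order definable over (M, ∈) with finitely
    many parameters from M. *)
Definition Def (M : vset) : vset :=
  Vset (fun s : {n : nat & (formula n.+1 * ('I_n -> carrier M))%type} =>
    definable_subset (projT2 s).1 (projT2 s).2).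

Definition vbigcup (I : Type) (F : I -> vset) : vset :=
  Vset (fun s : {i : I & carrier (F i)} => elt (projT2 s)).

(** L_α = ⋃_{β < α} Def(L_β), which gives L_0 = ∅, L_{β+1} = Def(L_β), and
    unions at limits.  The recursion makes sense for every set; only its values
    at ordinals are used. *)
Fixpoint Lset (x : vset) : vset :=
  match x with Vset A f => vbigcup (fun a : A => Def (Lset (f a))) end.

Definition vtransitive (x : vset) : Prop :=
  forall y z, vin y x -> vin z y -> vin z x.

Definition vordinal (x : vset) : Prop :=
  vtransitive x /\ forall y, vin y x -> vtransitive y.

Definition V_eq_L : Prop :=
  forall x : vset, exists2 alpha, vordinal alpha & vin x (Lset alpha).

(** * Ultrametric Polish spaces and definable sets *)

Section metric.
Context (R : realType) (X : metricType R).

Definition ultrametric : Prop :=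
  forall x y z : X, mdist x z <= Num.max (mdist x y) (mdist y z).

Definition metric_complete : Prop :=
  forall u : nat -> X, cauchy (u @ \oo) -> exists l : X, u @ \oo --> l.

Definition separable : Prop := exists2 D : set X, countable D & dense D.

Definition ultrametric_polish : Prop :=
  [/\ ultrametric, metric_complete & separable].

(** L(d) *)
Definition Lip1 : set (X -> X) :=
  [set f | forall x y, mdist (f x) (f y) <= mdist x y].

End metric.
Arguments Lip1 {R} X.

Section definable.
Context (X : topologicalType).

Definition borel : set (set X) := <<s @open X >>.

Definition Bor : set (X -> X) :=
  [set f | forall B, borel B -> borel (f @^-1` B)].

Definition baire : topologicalType := {ptws nat -> nat}.

Definition analytic : set (set X) :=
  [set A | exists2 C : set (X * baire), closed C & A = fst @` C].

(** The boldface class Π^1_1(X). *)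
Definition coanalytic : set (set X) := [set A | analytic (~` A)].

End definable.
Arguments Bor : clear implicits.
Arguments coanalytic : clear implicits.

(** * Reducibilities and their hierarchies *)

Section reducibility.
Context (X : Type).
Implicit Types (F : set (X -> X)) (A B : set X) (G : set (set X)).

Definition reducibility F : Prop :=
  F id /\ forall f g, F f -> F g -> F (f \o g).

Definition reduces F A B : Prop := exists2 f, F f & A = f @^-1` B.

Definition degree F G A : set (set X) :=
  [set B | [/\ G B, reduces F A B & reduces F B A]].

(** The quotient of (G, reduces F), with the order [degree_le F]. *)
Definition hierarchy F G : set (set (set X)) := [set degree F G A | A in G].

Definition degree_le F (D E : set (set X)) : Prop :=
  exists A B, [/\ D A, E B & reduces F A B].

End reducibility.

Definition embeds_into (T U : Type) (leT : T -> T -> Prop)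
    (H : set U) (leU : U -> U -> Prop) : Prop :=
  exists phi : T -> U,
    [/\ injective phi, forall a, H (phi a) &
        forall a b, leT a b <-> leU (phi a) (phi b)].

Definition very_bad (U : Type) (H : set U) (le : U -> U -> Prop) : Prop :=
  (exists S : set U,
     [/\ S `<=` H, infinite_set S &
         forall x y, S x -> S y -> x <> y -> ~ le x y]) /\
  (exists u : nat -> U,
     forall n, [/\ H (u n), le (u n.+1) (u n) & ~ le (u n) (u n.+1)]).

(* Main.v *)
(** A countable level L_al of the constructible hierarchy is coded by three
    relations on [nat] (order of the names of ordinals, membership in the levels,
    membership).  That the levels are built by first-order definability is a Borel
    condition on the code, so being a code is coanalytic; and the hull of a real
    under Skolem functions for every named level collapses to such a code, so under
    V = L every real belongs to a countable L_al.

    The points of the [n]-th piece are pairs (x, w), where [w] codes a stage [al] of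
    type [n] and [x] is a real of L_al, read as a code of a Borel function f and of
    a set b of natural numbers.  The pair is put in, for all codes [w] of [al] at
    once, unless f sends some (x, w) to an earlier point of the pieces in b.  If
    it is put in and f sends all the (x, w) to later stages, the least stage that is
    hit is blocked, and receives no point.  Hence f does not reduce the [n]-th piece
    to the pieces in b when [n] is not in b.  A pair (x, w) blocks at most one stage,
    so unblocked stages remain cofinal, and counting them modulo limits makes every
    type cofinal.  Only stages are used whose reals witness all the analytic facts
    consulted below them; this makes the recursion visible in any code of the stage,
    and the pieces coanalytic.

    The pieces are finally copied into disjoint balls of the ultrametric space;
    collapsing a ball to one of its points is nonexpansive. *)

Require Import Defs.
From HB Require Import structures.
From mathcomp Require Import all_boot all_order all_algebra.
From mathcomp Require Import all_classical all_reals.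
From mathcomp Require Import topology measure.
Local Open Scope classical_set_scope.

Set Implicit Arguments.
Unset Strict Implicit.
Unset Printing Implicit Defensive.

(** A Borel map enters only through its graph: the diagonal argument sees a functional analytic
    relation, and bi-analytic sets play the role of Borel sets throughout. The main obstacle is that
    hitting a point is an analytic relation, quantifying over all codes of two stages, while the
    recursion has to be read off a single code in a Borel way. Reflection removes these quantifiers
    below a stage. At the stage itself the relation stays analytic, but the conditions for receiving
    a point use it only negatively, as a coanalytic set allows. The values of the recursion on a
    code are determined by the code, so the definition may quantify universally over tables of them.
    Types are numbered after blocking is decided because the counting argument yields only
    cofinality of the unblocked stages: each new one brings pairs that may block later stages, and
    nothing protects a type fixed in advance. *)

Definition bits := nat -> bool.

Definition ctbl (I : Type) : Prop := exists f : I -> nat, injective f.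

Lemma ctbl_count (I : countType) : ctbl I.
Proof. by exists pickle; apply: pcan_inj (@pickleK I). Qed.

Lemma ctbl_inj (I J : Type) (f : I -> J) : injective f -> ctbl J -> ctbl I.
Proof. by move=> fi [g gi]; exists (g \o f); apply: inj_comp. Qed.

(** * Analytic and bi-analytic sets of the Cantor space *)

Definition agree (T : Type) (m : nat) (x y : nat -> T) : Prop :=
  forall i, (i < m)%N -> x i = y i.

Lemma agreeW T m n (x y : nat -> T) : (m <= n)%N -> agree n x y -> agree m x y.
Proof. by move=> mn xy i im; apply: xy; apply: leq_trans mn. Qed.

Lemma agree_comp T (h : nat -> nat) m :
  exists n, forall x y : nat -> T, agree n x y -> agree m (x \o h) (y \o h).
Proof.
exists (\max_(i < m) (h i)).+1 => x y xy i im /=.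
by apply: xy; rewrite ltnS (bigmax_sup (Ordinal im)).
Qed.

Definition closed_matrix (M : bits -> (nat -> nat) -> Prop) : Prop :=
  forall x v, ~ M x v ->
  exists m, forall x' v', agree m x x' -> agree m v v' -> ~ M x' v'.

(* [Sig], [Del] and [Bm] are the analytic sets, the bi-analytic sets and the Borel
   maps of the Cantor space. *)
Definition Sig (S : bits -> Prop) : Prop :=
  exists2 M, closed_matrix M & forall x, S x <-> exists v, M x v.

Definition Del (S : bits -> Prop) : Prop := Sig S /\ Sig (fun x => ~ S x).

Lemma eq_Sig (S S' : bits -> Prop) : (forall x, S x <-> S' x) -> Sig S -> Sig S'.
Proof. by move=> e [M cM SM]; exists M => // x; rewrite -e. Qed.

Lemma eq_Del (S S' : bits -> Prop) : (forall x, S x <-> S' x) -> Del S -> Del S'.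
Proof. by move=> e; suff -> : S = S' by []; apply/funext => x; apply/propext. Qed.

Lemma Sig_cst (P : Prop) : Sig (fun=> P).
Proof.
exists (fun _ _ => P) => [x v nP|x]; first by exists 0%N.
by split=> [p|[]//]; exists (fun=> 0%N).
Qed.

Lemma Sig_exn (S : nat -> bits -> Prop) :
  (forall n, Sig (S n)) -> Sig (fun x => exists n, S n x).
Proof.
move=> h; have /choice[M HM] : forall n, exists M, closed_matrix M /\
    forall x, S n x <-> exists v, M x v by move=> n; have [M] := h n; exists M.
exists (fun x v => M (v 0%N) x (fun i => v i.+1)) => [x v nM|x].
  have [m hm] := (HM _).1 _ _ nM; exists m.+1 => x' v' xx' vv'.
  rewrite -(vv' 0%N)//; apply: hm; first exact: agreeW xx'.
  by move=> i im; apply: vv'.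
split=> [[n /(HM n).2[v Mv]]|[v Mv]]; last by exists (v 0%N); apply/(HM _).2; eexists; exact: Mv.
by exists (fun i => if i is i'.+1 then v i' else n).
Qed.

Lemma Sig_alln (S : nat -> bits -> Prop) :
  (forall n, Sig (S n)) -> Sig (fun x => forall n, S n x).
Proof.
move=> h; have /choice[M HM] : forall n, exists M, closed_matrix M /\
    forall x, S n x <-> exists v, M x v by move=> n; have [M] := h n; exists M.
pose q (n i : nat) := pickle (n, i).
exists (fun x v => forall n, M n x (v \o q n)) => [x v /existsNP[n nM]|x].
  have [m hm] := (HM _).1 _ _ nM.
  have [m' hm'] := @agree_comp nat (q n) m.
  exists (maxn m m') => x' v' xx' vv' /(_ n); apply: hm.
    by apply: agreeW xx'; rewrite leq_maxl.
  by apply: hm'; apply: agreeW vv'; rewrite leq_maxr.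
split=> [Sx|[v Mv] n]; last by apply/(HM n).2; exists (v \o q n).
have /choice[v Mv] : forall n, exists v, M n x v by move=> n; apply/(HM n).2.
exists (fun k => if unpickle k is Some (n, i) then v n i else 0%N) => n.
by rewrite (_ : _ \o _ = v n)//; apply/funext => i; rewrite /q /= pickleK.
Qed.

Section countable_quantifiers.
Context (I : Type) (cI : ctbl I) (S : I -> bits -> Prop).

Lemma Sig_ex : (forall i, Sig (S i)) -> Sig (fun x => exists i, S i x).
Proof.
move=> h; have [f fi] := cI.
apply: (@eq_Sig (fun x => exists n, exists2 i, f i = n & S i x)) => [x|].
  by split=> [[n [i _ Si]]|[i Si]]; [exists i|exists (f i), i].
apply: Sig_exn => n; have [[i fin]|ni] := pselect (exists i, f i = n).
  apply: eq_Sig (h i) => x; split=> [|[j fj Sj]]; first by exists i.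
  by rewrite (fi i j)// fin fj.
apply: eq_Sig (Sig_cst False) => x; split=> // -[i fin]; case: ni; by exists i.
Qed.

Lemma Sig_all : (forall i, Sig (S i)) -> Sig (fun x => forall i, S i x).
Proof.
move=> h; have [f fi] := cI.
apply: (@eq_Sig (fun x => forall n i, f i = n -> S i x)) => [x|].
  by split=> [H i|H n i _]; [apply: H erefl|apply: H].
apply: Sig_alln => n; have [[i fin]|ni] := pselect (exists i, f i = n).
  apply: eq_Sig (h i) => x; split=> [Si j fj|]; last exact.
  by rewrite (fi j i)// fin fj.
apply: eq_Sig (Sig_cst True) => x; split=> // _ i fin; case: ni; by exists i.
Qed.

End countable_quantifiers.

Lemma ctbl_bool : ctbl bool. Proof. exact: ctbl_count. Qed.
Lemma ctbl_nat : ctbl nat. Proof. exact: ctbl_count. Qed.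

Lemma Sig_and S S' : Sig S -> Sig S' -> Sig (fun x => S x /\ S' x).
Proof.
move=> h h'; apply: (@eq_Sig (fun x => forall b : bool, if b then S x else S' x)).
  by move=> x; split=> [H|[? ?] []//]; split; [apply: (H true)|apply: (H false)].
by apply: (Sig_all ctbl_bool) => -[].
Qed.

Lemma Sig_or S S' : Sig S -> Sig S' -> Sig (fun x => S x \/ S' x).
Proof.
move=> h h'; apply: (@eq_Sig (fun x => exists b : bool, if b then S x else S' x)).
  by move=> x; split=> [[[]]|[]]; [left|right|exists true|exists false].
by apply: (Sig_ex ctbl_bool) => -[].
Qed.

Lemma DelN S : Del S -> Del (fun x => ~ S x).
Proof.
by move=> [s ns]; split=> //; apply: eq_Sig s => x; rewrite notK.
Qed.

Lemma Del_Sig S : Del S -> Sig S. Proof. by case. Qed.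
Lemma Del_SigN S : Del S -> Sig (fun x => ~ S x). Proof. by case. Qed.

Lemma Del_cst P : Del (fun=> P).
Proof. by split; apply: Sig_cst. Qed.

Lemma Del_and S S' : Del S -> Del S' -> Del (fun x => S x /\ S' x).
Proof.
move=> [s ns] [s' ns']; split; first exact: Sig_and.
by apply: eq_Sig (Sig_or ns ns') => x; rewrite not_andE.
Qed.

Lemma Del_or S S' : Del S -> Del S' -> Del (fun x => S x \/ S' x).
Proof.
move=> [s ns] [s' ns']; split; first exact: Sig_or.
by apply: eq_Sig (Sig_and ns ns') => x; rewrite not_orE.
Qed.

Lemma Del_imp S S' : Del S -> Del S' -> Del (fun x => S x -> S' x).
Proof.
move=> s s'; apply: eq_Del (Del_or (DelN s) s') => x.
by rewrite implyE.
Qed.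

Lemma Del_iff S S' : Del S -> Del S' -> Del (fun x => S x <-> S' x).
Proof. by move=> s s'; apply: Del_and; apply: Del_imp. Qed.

Lemma Del_all I (cI : ctbl I) (S : I -> bits -> Prop) :
  (forall i, Del (S i)) -> Del (fun x => forall i, S i x).
Proof.
move=> h; split; first by apply: Sig_all => // i; case: (h i).
apply: (@eq_Sig (fun x => exists i, ~ S i x)) => [x|]; first by rewrite existsNE.
by apply: Sig_ex => // i; case: (h i).
Qed.

Lemma Del_ex I (cI : ctbl I) (S : I -> bits -> Prop) :
  (forall i, Del (S i)) -> Del (fun x => exists i, S i x).
Proof.
move=> h; split; first by apply: Sig_ex => // i; case: (h i).
apply: (@eq_Sig (fun x => forall i, ~ S i x)) => [x|]; first by rewrite forallNE.
by apply: Sig_all => // i; case: (h i).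
Qed.

Lemma Sig_sub (h : nat -> nat) S : Sig S -> Sig (fun x => S (x \o h)).
Proof.
move=> [M cM SM]; exists (fun x v => M (x \o h) v) => [x v nM|x]; last exact: SM.
have [m hm] := cM _ _ nM; have [m' hm'] := @agree_comp bool h m.
exists (maxn m m') => x' v' xx' vv'; apply: hm.
  by apply: hm'; apply: agreeW xx'; rewrite leq_maxr.
by apply: agreeW vv'; rewrite leq_maxl.
Qed.

Lemma Del_sub (h : nat -> nat) S : Del S -> Del (fun x => S (x \o h)).
Proof. by move=> [s ns]; split; [exact: Sig_sub s|exact: (Sig_sub h ns)]. Qed.

Definition cpair (x y : bits) : bits := fun n => if odd n then y n./2 else x n./2.
Definition p1 (e : bits) : bits := e \o double.
Definition p2 (e : bits) : bits := e \o (fun n => n.*2.+1).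

Lemma p1E x y : p1 (cpair x y) = x.
Proof. by apply/funext => n; rewrite /p1 /cpair /= odd_double doubleK. Qed.

Lemma p2E x y : p2 (cpair x y) = y.
Proof. by apply/funext => n; rewrite /p2 /cpair /= odd_double /= uphalf_double. Qed.

Lemma cpairK e : cpair (p1 e) (p2 e) = e.
Proof.
apply/funext => n; rewrite /p1 /p2 /cpair /=; case: ifP => on; congr e.
  by rewrite -[RHS]odd_double_half on.
by rewrite -[RHS]odd_double_half on.
Qed.

Lemma agree_half T m (x y : nat -> T) :
  agree m x y -> forall i, (i < m)%N -> x i./2 = y i./2.
Proof.
move=> xy i im; apply: xy; apply: leq_ltn_trans im.
by rewrite -{2}[i]odd_double_half -addnn addnA leq_addl.
Qed.

Lemma Sig_exb (B : bits -> bits -> Prop) :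
  Sig (fun e => B (p1 e) (p2 e)) -> Sig (fun x => exists y, B x y).
Proof.
move=> [M cM SM].
(* The even places of the new witness carry the bits of [y], nonzero meaning true; the odd places
   carry the old witness. *)
pose u (v : nat -> nat) : bits := fun i => v i.*2 != 0%N.
pose t (v : nat -> nat) i := v i.*2.+1.
exists (fun x v => M (cpair x (u v)) (t v)) => [x v nM|x].
  have [m hm] := cM _ _ nM; exists m.*2.+1 => x' v' xx' vv'.
  have mm : (m <= m.*2.+1)%N by rewrite -addnn leqW// leq_addr.
  apply: hm => i im; last first.
    by apply: vv'; rewrite ltnS ltn_double.
  rewrite /cpair; case: ifP => oi; last by apply: (agree_half xx'); apply: leq_trans mm.
  have im' := leq_trans im mm; rewrite /u vv'// ltnS leq_double.
  apply: ltnW; apply: leq_ltn_trans im.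
  by rewrite -{2}[i]odd_double_half -addnn addnA leq_addl.
split=> [[y Bxy]|[v Mv]]; last first.
  by exists (u v); have := (SM (cpair x (u v))).2; rewrite p1E p2E; apply; exists (t v).
have /SM[v Mv] : B (p1 (cpair x y)) (p2 (cpair x y)) by rewrite p1E p2E.
pose f i : nat := if odd i then v i./2 else y i./2.
exists f; have -> : u f = y by apply/funext => i; rewrite /u /f odd_double doubleK; case: (y i).
have -> //: t f = v by apply/funext => i; rewrite /t /f /= odd_double /= uphalf_double.
Qed.

Lemma Del_bit0 k : Del (fun x => x k).
Proof.
have h b : Sig (fun x => x k = b).
  exists (fun x _ => x k = b) => [x v xk|x].
    by exists k.+1 => x' v' xx' _; rewrite -xx'.
  by split=> [->|[]//]; exists (fun=> 0%N).
split; first exact: h.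
by apply: eq_Sig (h false) => x; split=> [->|/negP/negbTE].
Qed.

Definition Bm (g : bits -> bits) : Prop := forall k, Del (fun x => g x k).

Lemma Del_bit g k : Bm g -> Del (fun x => g x k).
Proof. exact. Qed.

Lemma Del_eqb g k b : Bm g -> Del (fun x => g x k = b).
Proof.
move=> h; case: b; first exact: h.
by apply: eq_Del (DelN (h k)) => x; split=> [/negP/negbTE|->].
Qed.

Lemma Bm_id : Bm id. Proof. exact: Del_bit0. Qed.

Lemma Bm_cst c : Bm (fun=> c). Proof. by move=> k; apply: Del_cst. Qed.

Lemma Bm_sub (h : nat -> nat) g : Bm g -> Bm (fun x => g x \o h).
Proof. by move=> bg k; exact: bg. Qed.

Lemma Bm_p1 g : Bm g -> Bm (fun x => p1 (g x)). Proof. exact: Bm_sub. Qed.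
Lemma Bm_p2 g : Bm g -> Bm (fun x => p2 (g x)). Proof. exact: Bm_sub. Qed.

Lemma Bm_pair g h : Bm g -> Bm h -> Bm (fun x => cpair (g x) (h x)).
Proof. by move=> bg bh k; rewrite /cpair; case: (odd k). Qed.

(** The graph of [g] is bi-analytic, so guessing a real [y] equal to [g x] and testing [S y] costs a
    single real quantifier. *)
Lemma Sig_comp S g : Sig S -> Bm g -> Sig (fun x => S (g x)).
Proof.
move=> sS bg.
apply: (@eq_Sig (fun x : bits => exists y : bits, (forall k, y k <-> g x k) /\ S y)) => [x|].
  split=> [[y [yg]]|Sg]; last by exists (g x).
  by have -> // : y = g x by apply/funext => k; apply/idP/idP => /yg.
apply: Sig_exb; apply: Sig_and; last exact: Sig_sub.
apply: Sig_all => [|k]; first exact: ctbl_nat.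
apply: Del_Sig; apply: Del_iff; first exact: (Del_bit k (Bm_p2 Bm_id)).
exact: (Del_sub _ (bg k)).
Qed.

Lemma Del_comp S g : Del S -> Bm g -> Del (fun x => S (g x)).
Proof. by move=> [s ns] bg; split; [apply: Sig_comp|apply: (Sig_comp ns)]. Qed.

Lemma Bm_comp f g : Bm f -> Bm g -> Bm (fun x => f (g x)).
Proof. by move=> bf bg k; apply: (@Del_comp (fun x => f x k)). Qed.

(** The hypothesis is closed under substitution, so that complexity lemmas stated for arbitrary [Bm]
    arguments apply to the two halves of a pair. *)
Lemma Sig_exB (B : bits -> bits -> Prop) :
  (forall g h, Bm g -> Bm h -> Sig (fun e => B (g e) (h e))) ->
  forall g, Bm g -> Sig (fun x => exists y, B (g x) y).
Proof.
move=> HB g bg; apply: (@Sig_exb (fun x y => B (g x) y)).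
apply: HB; last exact: Bm_p2 Bm_id.
exact: Bm_comp bg (Bm_p1 Bm_id).
Qed.

Definition sec (i : nat) (e : bits) : bits := e \o (fun j : nat => pickle (i, j)).

Lemma Bm_sec i g : Bm g -> Bm (fun x => sec i (g x)). Proof. exact: Bm_sub. Qed.

Definition glue (f : nat -> bits) : bits :=
  fun k => if unpickle k is Some (i, j) then f i j else false.

Lemma secE f i : sec i (glue f) = f i.
Proof. by apply/funext => j; rewrite /sec /glue /= pickleK. Qed.

(* A code [c] lists a tree on [bool * nat]; [v] is the graph of a branch over [x]. *)
Definition branch (c x v : bits) : Prop :=
  (forall i j j' : nat, v (pickle (i, j)) -> v (pickle (i, j')) -> j = j') /\
  forall k, exists s : seq bool, exists t : seq nat, [/\ size s = k, size t = k,
    forall i, (i < k)%N -> x i = nth false s i /\ v (pickle (i, nth 0%N t i)) &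
    c (pickle (s, t))].

Lemma Del_branch c x v : Bm c -> Bm x -> Bm v ->
  Del (fun e => branch (c e) (x e) (v e)).
Proof.
move=> bc bx bv; apply: Del_and.
  do 3 (apply: Del_all => [|?]; first exact: ctbl_nat).
  by do 2 (apply: Del_imp; first exact: Del_bit); exact: Del_cst.
apply: Del_all => [|k]; first exact: ctbl_nat.
apply: Del_ex => [|s]; first exact: ctbl_count.
apply: Del_ex => [|t]; first exact: ctbl_count.
apply: (@eq_Del (fun e => size s = k /\ size t = k /\
    (forall i : nat, (i < k)%N -> x e i = nth false s i /\ v e (pickle (i, nth 0%N t i))) /\
    c e (pickle (s, t)))).
  by move=> e; split=> [[? [? []]]|[]].
apply: Del_and; first exact: Del_cst.
apply: Del_and; first exact: Del_cst.
apply: Del_and; last exact: Del_bit.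
apply: Del_all => [|i]; first exact: ctbl_nat.
apply: Del_imp; first exact: Del_cst.
by apply: Del_and; [exact: Del_eqb|exact: Del_bit].
Qed.

(** The code is the tree of finite pieces of pairs in [M]. A branch only provides, for each length,
    some pair of [M] agreeing with it up to there; closedness of [M] puts the branch itself in
    [M]. *)
Lemma Sig_branch S : Sig S -> exists c, forall x, S x <-> exists v, branch c x v.
Proof.
move=> [M cM SM].
pose c : bits := fun k => if unpickle k is Some (s, t) then
  `[< exists x v, [/\ M x v, s = mkseq x (size s) & t = mkseq v (size s)] >] else false.
have cE s t : c (pickle (s, t)) <->
  exists x v, [/\ M x v, s = mkseq x (size s) & t = mkseq v (size s)].
  by rewrite /c pickleK; split=> [/asboolP|?//]; last by apply/asboolP.
exists c => x; rewrite SM; split=> [[v Mv]|[v [vf vb]]].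
  exists (fun k => if unpickle k is Some (i, j) then v i == j else false).
  split=> [i j j'|k]; first by rewrite !pickleK => /eqP <- /eqP.
  exists (mkseq x k), (mkseq v k); rewrite !size_mkseq; split => // [i ik|].
    by rewrite pickleK !nth_mkseq.
  by apply/cE; exists x, v; rewrite size_mkseq.
have /choice[f vf'] : forall i : nat, exists j : nat, v (pickle (i, j)).
  move=> i; have [s [t [_ _ /(_ i (ltnSn i))[_ vi] _]]] := vb i.+1.
  by exists (nth 0%N t i).
exists f; apply: contrapT => nM; have [m hm] := cM _ _ nM.
have [s [t [ss st xv /cE[x' [v' [Mv' es et]]]]]] := vb m.
apply: hm Mv' => i im.
  by have [-> _] := xv i im; rewrite es nth_mkseq// ss.
by have [_ vi] := xv i im; rewrite (vf _ _ _ (vf' i) vi) et nth_mkseq// ss.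
Qed.

(** * Bisimilarity, canonical representatives and ordinals *)

Lemma veq_refl x : veq x x.
Proof. by elim: x => A f IH /=; split=> a; exists a. Qed.

Lemma veq_sym x y : veq x y -> veq y x.
Proof.
elim: x y => A f IH [B g] /= [h1 h2]; split=> [b|a].
  by have [a /IH] := h2 b; exists a.
by have [b /IH] := h1 a; exists b.
Qed.

Lemma veq_trans y x z : veq x y -> veq y z -> veq x z.
Proof.
elim: x y z => A f IH [B g] [D k] /= [h1 h2] [h3 h4]; split=> [a|d].
  have [b ab] := h1 a; have [d bd] := h3 b; exists d; exact: IH bd.
have [b bd] := h4 d; have [a ab] := h2 b; exists a; exact: IH bd.
Qed.

Lemma vin_elt x (c : carrier x) : vin (elt c) x.
Proof. by exists c; apply: veq_refl. Qed.

Lemma vin_congl x y z : veq x y -> vin x z -> vin y z.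
Proof. by move=> xy [c xc]; exists c; apply: veq_trans xc; apply: veq_sym. Qed.

Lemma vin_congr x y z : veq x y -> vin z x -> vin z y.
Proof.
case: x y => A f [B g] /= [h _] [/= a za]; have [b ab] := h a.
by exists b => /=; apply: veq_trans ab.
Qed.

Lemma veqP x y : veq x y <-> forall z, vin z x <-> vin z y.
Proof.
split=> [xy z|]; first by split; apply: vin_congr => //; apply: veq_sym.
case: x y => A f [B g] h /=; split=> [a|b].
  by have /h[b] := @vin_elt (Vset f) a; exists b.
by have /h[a] := @vin_elt (Vset g) b; exists a; apply: veq_sym.
Qed.

Lemma vin_wf : well_founded vin.
Proof.
move=> x; suff: forall y, veq y x -> Acc vin y by apply; apply: veq_refl.
elim: x => A f IH y yx; constructor => z /(vin_congr yx)[/= a za].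
exact: IH za.
Qed.

Lemma vin_irr x : ~ vin x x.
Proof. by elim: (vin_wf x) => y _ IH yy; apply: IH (yy) (yy). Qed.

Definition rep_pred (P : vset -> Prop) (h : exists x, P x) : vset := projT1 (cid h).

Lemma eq_rep_pred P Q (h : exists x, P x) (h' : exists x, Q x) :
  P = Q -> rep_pred h = rep_pred h'.
Proof. by move=> e; case: _ / e h' => h'; congr rep_pred; apply: Prop_irrelevance. Qed.

(* The choice depends only on the predicate [veq x], so [rep] turns bisimilarity
   into Leibniz equality. *)
Definition rep (x : vset) : vset :=
  rep_pred (ex_intro (fun y => veq x y) x (veq_refl x)).

Lemma rep_veq x : veq x (rep x).
Proof. exact: (projT2 (cid _)). Qed.

Lemma eq_rep x y : veq x y -> rep x = rep y.
Proof.
move=> xy; apply: eq_rep_pred; apply/funext => z; apply/propext.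
by split; apply: veq_trans => //; apply: veq_sym.
Qed.

Lemma rep_id x : rep (rep x) = rep x.
Proof. by apply: eq_rep; apply: veq_sym; apply: rep_veq. Qed.

Lemma rep_inj x y : rep x = rep y -> veq x y.
Proof.
move=> e; apply: veq_trans (rep_veq x) _; rewrite e.
by apply: veq_sym; apply: rep_veq.
Qed.

(** Requiring a canonical representative on the left makes stages that are equal as sets equal as
    terms. *)
Definition olt (x y : vset) : Prop := vin x y /\ rep x = x.

Lemma olt_wf : well_founded olt.
Proof. by move=> x; elim: (vin_wf x) => y _ IH; constructor => z [zy _]; apply: IH. Qed.

Lemma vordinal_in a b : vordinal a -> vin b a -> vordinal b.
Proof.
move=> [ta h] ba; split; first exact: h.
by move=> y yb; apply: h; apply: ta ba yb.
Qed.

Lemma vordinal_veq a b : veq a b -> vordinal a -> vordinal b.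
Proof.
move=> ab [ta h]; have e z := (veqP a b).1 ab z; split.
  by move=> y z /e ya zy; apply/e; apply: ta ya zy.
by move=> y /e; apply: h.
Qed.

Lemma vordinal_trich a b : vordinal a -> vordinal b ->
  [\/ vin a b, veq a b | vin b a].
Proof.
elim: (vin_wf a) b => {}a _ IHa b oa; elim: (vin_wf b) => {}b _ IHb ob.
have [[d db ad]|nd] := pselect (exists2 d, vin d b & veq a d \/ vin a d).
  apply: Or31; case: ad => [ad|ad]; last exact: ob.1 db ad.
  by apply: vin_congl db; apply: veq_sym.
have [[c ca bc]|nc] := pselect (exists2 c, vin c a & veq b c \/ vin b c).
  apply: Or33; case: bc => [bc|bc]; last exact: oa.1 ca bc.
  by apply: vin_congl ca; apply: veq_sym.
apply: Or32; apply/veqP => z; split=> [za|zb].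
  have [//|zb|bz] := IHa z za b (vordinal_in oa za) ob.
    by case: nc; exists z => //; left; apply: veq_sym.
  by case: nc; exists z => //; right.
have [az|az|//] := IHb z zb (vordinal_in ob zb).
  by case: nd; exists z => //; right.
by case: nd; exists z => //; left.
Qed.

(** * Definability *)

(** Universe, membership and equality are parameters, so that one formula can be read both in sets
    and in natural numbers naming sets, where equality is only coextensiveness. *)
Fixpoint rsat (D : Type) (U : D -> Prop) (m q : D -> D -> Prop) n (p : formula n) :
    ('I_n -> D) -> Prop :=
  match p in formula n return ('I_n -> D) -> Prop with
  | Fmem _ i j => fun e => m (e i) (e j)
  | Feq _ i j => fun e => q (e i) (e j)
  | Fnot _ p => fun e => ~ rsat U m q p e
  | Fand _ p p' => fun e => rsat U m q p e /\ rsat U m q p' e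
  | Fex _ p => fun e => exists2 x, U x & rsat U m q p (env_cons x e)
  end.

Lemma env_rel (D D' : Type) (r : D -> D' -> Prop) n x x' (e : 'I_n -> D) e' :
  r x x' -> (forall i, r (e i) (e' i)) ->
  forall i, r (env_cons x e i) (env_cons x' e' i).
Proof. by move=> xx ee i; rewrite /env_cons; case: unlift. Qed.

Lemma env_comp (D D' : Type) (h : D -> D') n x (e : 'I_n -> D) :
  env_cons (h x) (h \o e) = h \o env_cons x e.
Proof. by apply/funext => i; rewrite /env_cons /=; case: unlift. Qed.

Lemma rsat_transfer (D D' : Type) (U : D -> Prop) (U' : D' -> Prop)
    (m q : D -> D -> Prop) (m' q' : D' -> D' -> Prop) (r : D -> D' -> Prop) :
  (forall x, U x -> exists2 x', U' x' & r x x') ->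
  (forall x', U' x' -> exists2 x, U x & r x x') ->
  (forall x x' y y', r x x' -> r y y' ->
     (m x y <-> m' x' y') /\ (q x y <-> q' x' y')) ->
  forall n (p : formula n) e e', (forall i, r (e i) (e' i)) ->
    rsat U m q p e <-> rsat U' m' q' p e'.
Proof.
move=> tot sur at_; move=> n p.
elim: p => {n} [n i j|n i j|n p IH|n p IHp p' IHp'|n p IH] e e' ee /=.
- exact: (at_ _ _ _ _ (ee i) (ee j)).1.
- exact: (at_ _ _ _ _ (ee i) (ee j)).2.
- by rewrite (IH _ _ ee).
- by rewrite (IHp _ _ ee) (IHp' _ _ ee).
- split=> -[x Ux px].
    have [x' Ux' xx] := tot x Ux; exists x' => //.
    exact: (IH _ _ (env_rel xx ee)).1 px.
  have [x' Ux' xx] := sur x Ux; exists x' => //.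
  exact: (IH _ _ (env_rel xx ee)).2 px.
Qed.

Definition vsat (M : vset) := rsat (fun y => vin y M) vin veq.

Lemma vin_veq2 x x' y y' : veq x x' -> veq y y' -> vin x y <-> vin x' y'.
Proof.
by move=> xx yy; split=> [/(vin_congl xx)/(vin_congr yy)|
  /(vin_congl (veq_sym xx))/(vin_congr (veq_sym yy))].
Qed.

Lemma veq_veq2 x x' y y' : veq x x' -> veq y y' -> veq x y <-> veq x' y'.
Proof.
move=> xx yy; split=> h.
  exact: veq_trans (veq_sym xx) (veq_trans h yy).
exact: veq_trans xx (veq_trans h (veq_sym yy)).
Qed.

Lemma vsat_congr M N n (p : formula n) e e' : veq M N ->
  (forall i, veq (e i) (e' i)) -> vsat M p e <-> vsat N p e'.
Proof.
move=> MN; apply: rsat_transfer => [x xM|x xN|x x' y y' xx yy].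
- by exists x; [apply: vin_congr xM|apply: veq_refl].
- by exists x; [apply: vin_congr xN; apply: veq_sym|apply: veq_refl].
- by split; [apply: vin_veq2|apply: veq_veq2].
Qed.

Lemma vsat_veq M n (p : formula n) e e' :
  (forall i, veq (e i) (e' i)) -> vsat M p e -> vsat M p e'.
Proof. by move=> ee; apply: (vsat_congr _ (veq_refl M) ee).1. Qed.

Lemma sat_vsat M n (p : formula n) (e : 'I_n -> carrier M) e' :
  (forall i, veq (elt (e i)) (e' i)) -> sat p e <-> vsat M p e'.
Proof.
have -> : sat p e <-> rsat (fun=> True) (fun c d => vin (elt c) (elt d))
   (fun c d : carrier M => veq (elt c) (elt d)) p e.
  elim: p e {e'} => {n} [n i j|n i j|n p IH|n p IHp p' IHp'|n p IH] e //=.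
  - by rewrite IH.
  - by rewrite IHp IHp'.
  - by split=> [[x /IH]|[x _ /IH]]; exists x.
apply: (rsat_transfer (r := fun (c : carrier M) y => veq (elt c) y)) => [c _|x [c xc]|c c' d d' cc dd].
- by exists (elt c); [apply: vin_elt|apply: veq_refl].
- by exists c => //; apply: veq_sym.
- by split; [apply: vin_veq2|apply: veq_veq2].
Qed.

Definition defines (M : vset) n (p : formula n.+1) (e : 'I_n -> vset) (v : vset) :=
  forall y, vin y v <-> vin y M /\ vsat M p (env_cons y e).

Lemma DefP M v : vin v (Def M) <->
  exists n (p : formula n.+1) e, (forall i, vin (e i) M) /\ defines M p e v.
Proof.
have main n (p : formula n.+1) (e : 'I_n -> carrier M) e' :
    (forall i, veq (elt (e i)) (e' i)) -> defines M p e' (definable_subset p e).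
  move=> ee y; split=> [[/= [c pc] /= yc]|[[c yc] py]].
    split; first by exists c.
    apply/sat_vsat; last exact: pc.
    by apply: (env_rel (r := fun d z => veq (elt d) z)) => //; apply: veq_sym.
  have pc : sat p (env_cons c e).
    apply/sat_vsat; last exact: py.
    by apply: (env_rel (r := fun d z => veq (elt d) z)) => //; apply: veq_sym.
  by exists (exist _ c pc).
split=> [[[n [p e]] /= vs]|[n [p [e [eM dv]]]]].
  exists n, p, (fun i => elt (e i)); split=> [i|y]; first exact: vin_elt.
  have <- := main n p e (fun i => elt (e i)) (fun i => veq_refl _) y.
  exact: (veqP _ _).1 vs y.
have /choice[c ec] : forall i, exists c : carrier M, veq (e i) (elt c).
  by move=> i; have [c] := eM i; exists c.
exists (existT _ n (p, c)) => /=; apply/veqP => y.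
by rewrite dv; have h := main n p c e (fun i => veq_sym (ec i)) y; rewrite h.
Qed.

Lemma defines_veq M N n (p : formula n.+1) e e' v : veq M N ->
  (forall i, veq (e i) (e' i)) -> defines M p e v -> defines N p e' v.
Proof.
move=> MN ee dv y; rewrite dv (_ : vin y M <-> vin y N); last first.
  exact: vin_veq2 (veq_refl y) MN.
rewrite (_ : vsat M p _ <-> vsat N p (env_cons y e'))//.
by apply: vsat_congr => //; apply: env_rel => //; apply: veq_refl.
Qed.

Lemma Def_veq M N : veq M N -> veq (Def M) (Def N).
Proof.
move=> MN; have h A B v : veq A B -> vin v (Def A) -> vin v (Def B).
  move=> AB /DefP[n [p [e [eA dv]]]]; apply/DefP; exists n, p, e; split=> [i|].
    exact: vin_congr (eA i).
  by apply: defines_veq dv => // i; apply: veq_refl.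
by apply/veqP => v; split; apply: h => //; apply: veq_sym.
Qed.

Lemma Lset_veq x y : veq x y -> veq (Lset x) (Lset y).
Proof.
elim: x y => A f IH [B g] [h1 h2]; apply/veqP => v.
split=> [[[a c] /= vc]|[[b c] /= vc]].
  have [b /IH/Def_veq fg] := h1 a.
  have [d vd] := vin_congr fg (ex_intro _ c vc : vin v (Def (Lset (f a)))).
  by exists (existT _ b d).
have [a /IH/Def_veq/veq_sym fg] := h2 b.
have [d vd] := vin_congr fg (ex_intro _ c vc : vin v (Def (Lset (g b)))).
by exists (existT _ a d).
Qed.

Lemma LsetP v x : vin v (Lset x) <-> exists2 b, vin b x & vin v (Def (Lset b)).
Proof.
split.
  case: x => A f [[a c] /= vc]; exists (f a); first exact: (@vin_elt (Vset f)).
  by exists c.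
case: x => A f [b [/= a ba]] /(vin_congr (Def_veq (Lset_veq ba)))[c vc].
by exists (existT _ a c).
Qed.

Lemma Lset_mono x y : (forall b, vin b x -> vin b y) ->
  forall v, vin v (Lset x) -> vin v (Lset y).
Proof. by move=> xy v /LsetP[b bx vb]; apply/LsetP; exists b => //; apply: xy. Qed.

Lemma Lset_trans a : vordinal a -> vtransitive (Lset a).
Proof.
move=> oa y z /LsetP[b ba /DefP[n [p [e [_ dy]]]]] /dy[zb _].
by apply: Lset_mono zb => c cb; apply: oa.1 ba cb.
Qed.

(** The Tarski-Vaught test: the last hypothesis provides named witnesses, which is all that the
    existential case requires. *)
Lemma nsat (D : Type) (U : D -> Prop) (E q : D -> D -> Prop) (h : D -> vset) M :
  (forall x y, E x y <-> vin (h x) (h y)) ->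
  (forall x y, q x y <-> veq (h x) (h y)) ->
  (forall x, U x -> vin (h x) M) ->
  (forall n (p : formula n.+1) (e : 'I_n -> D), (forall i, U (e i)) ->
     (exists2 y, vin y M & vsat M p (env_cons y (h \o e))) ->
     exists2 x, U x & vsat M p (env_cons (h x) (h \o e))) ->
  forall n (p : formula n) e, (forall i, U (e i)) ->
    rsat U E q p e <-> vsat M p (h \o e).
Proof.
move=> hE hq hU tv n p.
elim: p => {n} [n i j|n i j|n p IH|n p IHp p' IHp'|n p IH] e Ue /=.
- exact: hE.
- exact: hq.
- by rewrite (IH _ Ue).
- by rewrite (IHp _ Ue) (IHp' _ Ue).
- have Ue' x : U x -> forall i, U (env_cons x e i).
    by move=> Ux i; rewrite /env_cons; case: unlift.
  split=> [[x Ux px]|ex].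
    exists (h x); first exact: hU.
    by rewrite env_comp; apply/(IH _ (Ue' _ Ux)).
  have [x Ux px] := tv n p e Ue ex; exists x => //.
  by apply/(IH _ (Ue' _ Ux)); rewrite -env_comp.
Qed.

(** * Codes of countable levels of the constructible hierarchy *)

Definition collapses (r : nat -> nat -> Prop) (f : nat -> vset) : Prop :=
  forall a y, vin y (f a) <-> exists2 b, r b a & veq y (f b).

Lemma collapse_ex r : well_founded r -> exists f, collapses r f.
Proof.
move=> wr; pose F a (k : forall b, r b a -> vset) :=
  Vset (fun b : {b | r b a} => k (sval b) (svalP b)).
exists (Fix wr (fun=> vset) F) => a y; rewrite Fix_eq; last first.
  by move=> x f g fg; rewrite /F; congr Vset; apply/funext => -[].
split=> [[/= [b rb] /= yb]|[b rb yb]]; first by exists b.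
by exists (exist _ b rb).
Qed.

(** The Mostowski collapse, extended by a constant to ill-founded relations so that [ph w] and
    [ot w] make sense for every real [w]. *)
Definition col (r : nat -> nat -> Prop) : nat -> vset :=
  match pselect (exists f, collapses r f) with
  | left h => projT1 (cid h)
  | right _ => fun=> Vset (fun v : void => match v with end)
  end.

Lemma colP r : well_founded r -> collapses r (col r).
Proof.
by move=> /collapse_ex h; rewrite /col; case: pselect => // h'; case: cid.
Qed.

(** Names are not unique: several numbers may denote the same set, and extensionality fails. It is
    replaced by the demand that numbers with the same predecessors be interchangeable on the
    left. *)
Definition congruent (r : nat -> nat -> Prop) : Prop :=
  forall x y u, (forall z, r z x <-> r z y) -> r x u -> r y u.

Section extensional_collapse.
Context (r : nat -> nat -> Prop) (wr : well_founded r) (cr : congruent r).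

Lemma col_ext x y : (forall z, r z x <-> r z y) <-> veq (col r x) (col r y).
Proof.
have cP := colP wr.
split=> [h|].
  by apply/veqP => v; rewrite !cP; split=> -[z /h zy vz]; exists z.
elim: (wr x) y => {}x _ IH y xy z; split=> [zx|zy].
  have /(vin_congr xy)/cP[z' zy' /(IH z zx)zz] : vin (col r z) (col r x).
    by apply/cP; exists z => //; apply: veq_refl.
  by apply: cr zy' => u; rewrite zz.
have /(vin_congr (veq_sym xy))/cP[z' zx' /veq_sym/(IH z' zx')zz] :
  vin (col r z) (col r y) by apply/cP; exists z => //; apply: veq_refl.
exact: cr zx'.
Qed.

Lemma col_vin x y : r x y <-> vin (col r x) (col r y).
Proof.
split=> [xy|]; first by apply/colP => //; exists x => //; apply: veq_refl.
move=> /(colP wr)[z zy /veq_sym/col_ext xz]; exact: cr zy.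
Qed.

End extensional_collapse.

Definition rel (i : nat) (w : bits) (a b : nat) : Prop := sec i w (pickle (a, b)).

Lemma rel_ones i a b : rel i (fun=> true) a b. Proof. by []. Qed.

(* [cLt w], [cU w] and [cE w]: the names of ordinals are ordered by [cLt w], the
   set named [x] belongs to L_a when [cU w a x], and [cE w] is membership. *)
Definition cLt := rel 0.
Definition cU := rel 1.
Definition cE := rel 2.

Definition cext w x y := forall z, cE w z x <-> cE w z y.

Definition cdefines w b n (p : formula n.+1) (e : 'I_n -> nat) (x : nat) :=
  forall y, cE w y x <->
    cU w b y /\ rsat (cU w b) (cE w) (cext w) p (env_cons y e).

Definition cdef w b x :=
  exists n (p : formula n.+1) (e : 'I_n -> nat),
    (forall i, cU w b (e i)) /\ cdefines w b p e x.

(** All quantifiers range over numbers, formulas and finite environments, hence over countable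
    types, and the condition is Borel. Well-foundedness, the only coanalytic clause, is added
    separately in [code]. *)
Definition Lcode (w : bits) : Prop :=
  (forall a b c, cLt w a b -> cLt w b c -> cLt w a c) /\
  congruent (cLt w) /\ congruent (cE w) /\
  (forall a x, cU w a x <-> exists b, cLt w b a /\ cdef w b x) /\
  (forall x, exists b, cdef w b x) /\
  (forall b n (p : formula n.+1) (e : 'I_n -> nat), (forall i, cU w b (e i)) ->
     exists x, cdefines w b p e x).

Definition code w := Lcode w /\ well_founded (cLt w).

Lemma codeI w : Lcode w -> well_founded (cLt w) -> code w. Proof. by []. Qed.
Lemma code_Lcode w : code w -> Lcode w. Proof. by case. Qed.
Lemma code_wf w : code w -> well_founded (cLt w). Proof. by case. Qed.

Definition ph w a := rep (col (cLt w) a).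
Definition ot w := rep (Vset (col (cLt w))).

Section code.
Context (w : bits) (cw : code w).

Let tLt : forall a b c, cLt w a b -> cLt w b c -> cLt w a c := cw.1.1.
Let wLt : well_founded (cLt w) := cw.2.
Let gLt : congruent (cLt w) := cw.1.2.1.
Let gE : congruent (cE w) := cw.1.2.2.1.
Let hU : forall a x, cU w a x <-> exists b, cLt w b a /\ cdef w b x :=
  cw.1.2.2.2.1.
Let hD : forall x, exists b, cdef w b x := cw.1.2.2.2.2.1.
Let hC := cw.1.2.2.2.2.2.

Let phi := col (cLt w).
Let pi_ := col (cE w).

(** The members of a name definable over level [b] belong to that level, so they are definable over
    an earlier one; induction along [cLt] applies. *)
Lemma cE_wf : well_founded (cE w).
Proof.
have main b : forall x, cdef w b x -> Acc (cE w) x.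
  elim: (wLt b) => {}b _ IH x [n [p [e [_ dx]]]]; constructor => y /dx[/hU[c [cb yc]] _].
  exact: IH cb y yc.
by move=> x; have [b] := hD x; apply: main.
Qed.

Let cpi := colP cE_wf.
Let cphi := colP wLt.

(** The successor step shared by [Lset_phi] and [Lset_ot]. The names exhaust the level by
    hypothesis, so every witness is named and [nsat] applies. *)
Lemma cdefP b :
  (forall y, vin y (Lset (phi b)) <-> exists2 x, cU w b x & veq y (pi_ x)) ->
  forall v, vin v (Def (Lset (phi b))) <-> exists2 x, cdef w b x & veq v (pi_ x).
Proof.
move=> Lb; set M := Lset (phi b).
have names n (p : formula n) e : (forall i, cU w b (e i)) ->
    rsat (cU w b) (cE w) (cext w) p e <-> vsat M p (pi_ \o e).
  apply: nsat => [x y|x y|x Ux|{}n {}p {}e Ue [y /Lb[x Ux yx] py]].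
  - exact: col_vin cE_wf gE x y.
  - exact: col_ext cE_wf gE x y.
  - by apply/Lb; exists x => //; apply: veq_refl.
  - exists x => //; apply: vsat_veq py.
    by apply: env_rel => // j; apply: veq_refl.
have key n (p : formula n.+1) e x : (forall i, cU w b (e i)) ->
    cdefines w b p e x -> defines M p (pi_ \o e) (pi_ x).
  move=> Ue dx y; rewrite cpi; split=> [[z zx yz]|[/Lb[z Uz yz] py]].
    have /dx[Uz pz] := zx; split; first by apply/Lb; exists z.
    move: pz; rewrite names => [|i]; last by rewrite /env_cons; case: unlift.
    rewrite -env_comp; apply: vsat_veq.
    by apply: env_rel => [|i]; [apply: veq_sym|apply: veq_refl].
  exists z => //; apply/dx; split=> //; rewrite names => [|i]; last first.
    by rewrite /env_cons; case: unlift.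
  rewrite -env_comp; apply: vsat_veq py.
  by apply: env_rel => // i; apply: veq_refl.
move=> v; split=> [/DefP[n [p [e [eM dv]]]]|[x [n [p [e [Ue dx]]]] vx]].
  have /choice[f ef] : forall i, exists x, cU w b x /\ veq (e i) (pi_ x).
    by move=> i; have /Lb[x] := eM i; exists x.
  have [x dx] := hC p (fun i => (ef i).1); exists x.
    by exists n, p, f; split=> // i; have [] := ef i.
  apply/veqP => y; rewrite (key _ _ _ _ (fun i => (ef i).1) dx).
  by apply: (defines_veq (veq_refl M) _ dv) => i; have [] := ef i.
apply/DefP; exists n, p, (pi_ \o e); split=> [i|].
  by apply/Lb; exists (e i) => //; apply: veq_refl.
move=> y; rewrite -(key _ _ _ _ Ue dx); exact: (veqP _ _).1 vx y.
Qed.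

Lemma Lset_phi a y : vin y (Lset (phi a)) <-> exists2 x, cU w a x & veq y (pi_ x).
Proof.
elim: (wLt a) y => {}a _ IH y; rewrite LsetP.
split=> [[d /cphi[b ba db]]|[x /hU[b [ba bx]] yx]].
  move=> /(vin_congr (Def_veq (Lset_veq db)))/(cdefP (IH b ba))[x bx yx].
  by exists x => //; apply/hU; exists b.
exists (phi b); first by apply/cphi; exists b => //; apply: veq_refl.
by apply/(cdefP (IH b ba)); exists x.
Qed.

Lemma Lset_ot y : vin y (Lset (ot w)) <-> exists x, veq y (pi_ x).
Proof.
have -> : vin y (Lset (ot w)) <-> vin y (Lset (Vset phi)).
  by apply: vin_veq2 (veq_refl y) (Lset_veq (veq_sym (rep_veq _))).
rewrite LsetP; split=> [[d [/= b db]]|[x yx]].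
  move=> /(vin_congr (Def_veq (Lset_veq db)))/(cdefP (Lset_phi b))[x _ yx].
  by exists x.
have [b bx] := hD x; exists (phi b); first exact: (@vin_elt (Vset phi)).
by apply/(cdefP (Lset_phi b)); exists x.
Qed.

Lemma ot_ord : vordinal (ot w).
Proof.
apply: vordinal_veq (rep_veq _) _; split=> [y z [/= a ya]|y [/= a ya]].
  by move=> /(vin_congr ya)/cphi[b _ zb]; exists b.
move=> z u /(vin_congr ya)/cphi[b ba zb] /(vin_congr zb)/cphi[c cb uc].
apply: vin_congr (veq_sym ya) _; apply/cphi; exists c => //.
exact: tLt cb ba.
Qed.

Lemma otP b : olt b (ot w) <-> exists a, b = ph w a.
Proof.
split=> [[/(vin_congr (veq_sym (rep_veq _)))[/= a ba] rb]|[a ->]].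
  by exists a; rewrite -rb; apply: eq_rep.
split; last exact: rep_id.
apply: vin_congr (rep_veq _) _; exists a => /=.
by apply: veq_sym; apply: rep_veq.
Qed.

Lemma ph_ot a : olt (ph w a) (ot w). Proof. by apply/otP; exists a. Qed.

Lemma cLtP a b : cLt w a b <-> olt (ph w a) (ph w b).
Proof.
rewrite (col_vin wLt gLt); split=> [ab|[]].
  split; last exact: rep_id.
  exact: (vin_veq2 (rep_veq _) (rep_veq _)).1 ab.
by move=> h _; apply: (vin_veq2 (rep_veq _) (rep_veq _)).2 h.
Qed.

End code.

Definition vempty : vset := Vset (fun v : void => match v with end).

(** Zermelo numerals, iterated singletons of the empty set: recognising the next numeral only takes
    a look at its elements, which keeps [isnum] a simple recursion on names. *)
Fixpoint znum (j : nat) : vset :=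
  if j is i.+1 then Vset (fun _ : unit => znum i) else vempty.

Lemma vin_znumS y j : vin y (znum j.+1) <-> veq y (znum j).
Proof. by split=> [[[]]|yj] //; exists tt. Qed.

Lemma vin_vempty y : ~ vin y vempty. Proof. by case. Qed.

Definition Rl (a : vset) (r : bits) : Prop :=
  exists2 v, vin v (Lset a) & forall j, r j <-> vin (znum j) v.

Fixpoint isnum w (j y : nat) : Prop :=
  if j is i.+1 then (exists z, cE w z y) /\ forall z, cE w z y -> isnum w i z
  else forall z, ~ cE w z y.

Definition rl w (k : nat) : bits := fun j => `[< exists y, isnum w j y /\ cE w y k >].

Lemma rlE w k j : rl w k j <-> exists y, isnum w j y /\ cE w y k.
Proof. by split=> /asboolP. Qed.

Section code_reals.
Context (w : bits) (cw : code w).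
Let cpi := colP (cE_wf cw).

Lemma isnumP j y : isnum w j y <-> veq (col (cE w) y) (znum j).
Proof.
elim: j y => [|j IH] y /=.
  split=> [h|h z zy].
    apply/veqP => v; split=> [/cpi[z /h]//|/vin_vempty//].
  have /(vin_congr h)/vin_vempty// : vin (col (cE w) z) (col (cE w) y).
  by apply/cpi; exists z => //; apply: veq_refl.
rewrite veqP; split=> [[[z zy] h] v|h].
  rewrite vin_znumS cpi; split=> [[u /h/IH uj vu]|vj].
    exact: veq_trans uj.
  by exists z => //; apply: veq_trans vj _; apply: veq_sym; apply/IH/h.
split=> [|z zy].
  have /h/cpi[z zy _] := (vin_znumS (znum j) j).2 (veq_refl _).
  by exists z.
apply/IH/vin_znumS/h; apply/cpi; exists z => //; exact: veq_refl.
Qed.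

Lemma rlP k j : rl w k j <-> vin (znum j) (col (cE w) k).
Proof.
rewrite rlE cpi; split=> [[y [/isnumP yj yk]]|[y yk jy]].
  by exists y => //; apply: veq_sym.
by exists y; split=> //; apply/isnumP; apply: veq_sym.
Qed.

Lemma rl_eq k v (r : bits) : veq v (col (cE w) k) ->
  (forall j, r j <-> vin (znum j) v) -> r = rl w k.
Proof.
move=> vk rv; apply/funext => j; apply/idP/idP => [/rv jv|/rlP jk].
  by apply/rlP; apply: vin_congr jv.
by apply/rv; apply: vin_congr jk; apply: veq_sym.
Qed.

Lemma RotP r : Rl (ot w) r <-> exists k, r = rl w k.
Proof.
split=> [[v /(Lset_ot cw)[k vk] rv]|[k ->]]; first by exists k; exact: rl_eq rv.
exists (col (cE w) k); last by move=> j; apply: rlP.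
by apply/(Lset_ot cw); exists k; apply: veq_refl.
Qed.

Lemma RphP a r : Rl (ph w a) r <-> exists2 k, cU w a k & r = rl w k.
Proof.
have e y : vin y (Lset (ph w a)) <-> vin y (Lset (col (cLt w) a)).
  by apply: vin_veq2 (veq_refl _) (Lset_veq (veq_sym (rep_veq _))).
split=> [[v /e/(Lset_phi cw)[k Uk vk] rv]|[k Uk ->]].
  by exists k => //; exact: rl_eq rv.
exists (col (cE w) k); last by move=> j; apply: rlP.
by apply/e; apply/(Lset_phi cw); exists k => //; apply: veq_refl.
Qed.

End code_reals.

Lemma Rl_mono a b r : vordinal b -> vin a b -> Rl a r -> Rl b r.
Proof.
move=> ob ab [v va rv]; exists v => //; apply: Lset_mono va => c ca.
exact: ob.1 ab ca.
Qed.

(** * Construction of codes from named levels *)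

Definition mkrel (r0 r1 r2 : nat -> nat -> Prop) : bits :=
  glue (fun i k => if unpickle k is Some (a, b) then
    `[< (nth r2 [:: r0; r1] i) a b >] else false).

Lemma mkrelE r0 r1 r2 i a b : rel i (mkrel r0 r1 r2) a b <-> nth r2 [:: r0; r1] i a b.
Proof. by rewrite /rel secE pickleK; split=> /asboolP. Qed.

Section make_code.
Context (al : vset) (oal : vordinal al) (g h : nat -> vset).

Let def b x := exists n (p : formula n.+1) (e : 'I_n -> nat),
  (forall i, vin (h (e i)) (Lset (g b))) /\
  defines (Lset (g b)) p (h \o e) (h x).

(* [g] names ordinals below [al] and [h] sets in L_al; the names form an
   elementary substructure of every named level. *)
Lemma make_code :
  (forall a, vin (g a) al) ->
  (forall x, exists b, def b x) ->
  (forall a x, vin (h x) (Lset (g a)) -> exists b, vin (g b) (g a) /\ def b x) ->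
  (forall b n (p : formula n.+1) (e : 'I_n -> nat),
     (forall i, vin (h (e i)) (Lset (g b))) ->
     exists x, defines (Lset (g b)) p (h \o e) (h x)) ->
  (forall b n (p : formula n.+1) (e : 'I_n -> nat),
     (forall i, vin (h (e i)) (Lset (g b))) ->
     (exists2 y, vin y (Lset (g b)) & vsat (Lset (g b)) p (env_cons y (h \o e))) ->
     exists2 x, vin (h x) (Lset (g b)) & vsat (Lset (g b)) p (env_cons (h x) (h \o e))) ->
  (forall x y, (forall z, vin (h z) (h x) <-> vin (h z) (h y)) -> veq (h x) (h y)) ->
  exists w, code w /\ (forall a b, cLt w a b <-> vin (g a) (g b)) /\
    (forall x y, cE w x y <-> vin (h x) (h y)).
Proof.
move=> gal kD kU kC kT kX.
have [w [wL [wU wE]]] : exists w, (forall a b, cLt w a b <-> vin (g a) (g b)) /\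
    (forall a x, cU w a x <-> vin (h x) (Lset (g a))) /\
    (forall x y, cE w x y <-> vin (h x) (h y)).
  exists (mkrel (fun a b => vin (g a) (g b)) (fun a x => vin (h x) (Lset (g a)))
    (fun x y => vin (h x) (h y))).
  by split; [|split] => *; apply: mkrelE.
have og a : vordinal (g a) by apply: vordinal_in (gal a).
have names b n (p : formula n) e : (forall i, cU w b (e i)) ->
    rsat (cU w b) (cE w) (cext w) p e <-> vsat (Lset (g b)) p (h \o e).
  apply: nsat => [x y|x y|x Ux|{}n {}p {}e Ue ex].
  - exact: wE.
  - split=> [xy|/veqP xy z]; last by rewrite !wE.
    by apply: kX => z; rewrite -!wE.
  - exact/wU.
  - have [i|x Ux px] := kT b n p e _ ex; first exact/wU.
    by exists x => //; apply/wU.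
have cdefE b n (p : formula n.+1) e x : (forall i, cU w b (e i)) ->
    defines (Lset (g b)) p (h \o e) (h x) -> cdefines w b p e x.
  move=> Ue dx y; rewrite wE dx wU; split=> -[yU py]; split=> //.
    rewrite names -?env_comp// => i; rewrite /env_cons; case: unlift => //=.
    exact/wU.
  move: py; rewrite names -?env_comp// => i; rewrite /env_cons; case: unlift => //=.
  exact/wU.
have cdefD b x : def b x -> cdef w b x.
  move=> [n [p [e [Ue dx]]]]; have Ue' i : cU w b (e i) by apply/wU.
  by exists n, p, e; split=> //; apply: cdefE.
exists w; split; last by [].
split; last first.
  suff: forall v, Acc vin v -> forall b, g b = v -> Acc (cLt w) b.
    by move=> H a; apply: H (vin_wf _) _ erefl.
  move=> v; elim=> {}v _ IH b bv; constructor=> c /wL; rewrite bv => cb.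
  exact: IH cb _ erefl.
split; first by move=> a b c /wL ab /wL bc; apply/wL; apply: (og c).1 bc ab.
split.
  move=> x y u xy /wL xu; apply/wL.
  have [gxy|gxy|gyx] := vordinal_trich (og x) (og y).
  - by have /vin_irr := (wL _ _).1 ((xy x).2 ((wL _ _).2 gxy)).
  - exact: vin_congl xu.
  - by have /vin_irr := (wL _ _).1 ((xy y).1 ((wL _ _).2 gyx)).
split.
  move=> x y u xy /wE xu; apply/wE; apply: vin_congl xu.
  by apply: kX => z; rewrite -!wE.
split.
  move=> a x; split=> [/wU/kU[b [ba bx]]|[b [/wL ba [n [p [e [Ue dx]]]]]]].
    by exists b; split; [exact/wL|exact: cdefD].
  have [|x' dx'] := kC b n p e; first by move=> i; apply/wU.
  have xx : veq (h x) (h x').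
    by apply: kX => z; rewrite -!wE (dx z) (cdefE _ _ _ _ _ Ue dx' z).
  apply/wU; apply/LsetP; exists (g b) => //; apply/DefP.
  exists n, p, (h \o e); split=> [i|y]; first by apply/wU.
  by rewrite -(dx' y); apply: vin_veq2 (veq_refl y) xx.
split; first by move=> x; have [b] := kD x; exists b; apply: cdefD.
move=> b n p e Ue; have [i|x dx] := kC b n p e; first exact/wU.
by exists x; apply: cdefE.
Qed.

End make_code.

(** When the enumerations exhaust [al] and L_al, every witness and every definable set has a name,
    so the elementarity and closure conditions of [make_code] hold at once. By induction the
    collapse of a name is then the ordinal it names. *)
Lemma full_code al (g h : nat -> vset) : vordinal al ->
  (forall b, vin b al <-> exists a, veq b (g a)) ->
  (forall v, vin v (Lset al) <-> exists x, veq v (h x)) ->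
  exists w, code w /\ ot w = rep al.
Proof.
move=> oal hg hh.
have gal a : vin (g a) al by apply/hg; exists a; apply: veq_refl.
have sub b v : vin v (Lset (g b)) -> exists x, veq v (h x).
  by move=> vb; apply/hh; apply: Lset_mono vb => c cb; apply: oal.1 (gal b) cb.
have mem v b : vin b al -> vin v (Def (Lset b)) ->
    exists a, veq b (g a) /\ exists n (p : formula n.+1) (e : 'I_n -> nat),
    (forall i, vin (h (e i)) (Lset (g a))) /\ defines (Lset (g a)) p (h \o e) v.
  move=> /hg[a ba] /(vin_congr (Def_veq (Lset_veq ba)))/DefP[n [p [e [eU dv]]]].
  have /choice[f ef] : forall i, exists x, veq (e i) (h x) by move=> i; apply: sub (eU i).
  exists a; split=> //; exists n, p, f; split=> [i|]; first exact: vin_congl (eU i).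
  by apply: defines_veq dv => //; apply: veq_refl.
have [x|a x|b n p e Ue|b n p e Ue [y yU py]|x y xy|w [cw [wL _]]] := @make_code al oal g h gal.
- have /hh/LsetP[b bal] : exists x', veq (h x) (h x') by exists x; apply: veq_refl.
  by move=> /(mem _ _ bal)[a [_ d]]; exists a.
- move=> /LsetP[b ba vb]; have [c [bc d]] := mem _ _ (oal.1 _ _ (gal a) ba) vb.
  by exists c; split=> //; apply: vin_congl ba.
- pose v := Vset (fun s : {c : carrier (Lset (g b)) |
    vsat (Lset (g b)) p (env_cons (elt c) (h \o e))} => elt (sval s)).
  have dv : defines (Lset (g b)) p (h \o e) v.
    move=> y; split=> [[[c pc] /= yc]|[[c yc] py]].
      split; first by exists c.
      by apply: vsat_veq pc; apply: env_rel => [|i]; [apply: veq_sym|apply: veq_refl].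
    have pc : vsat (Lset (g b)) p (env_cons (elt c) (h \o e)).
      by apply: vsat_veq py; apply: env_rel => // i; apply: veq_refl.
    by exists (exist _ c pc).
  have /hh[x vx] : vin v (Lset al).
    apply/LsetP; exists (g b) => //; apply/DefP; by exists n, p, (h \o e).
  exists x => y; rewrite -(dv y); apply: vin_veq2 (veq_refl y) _; exact: veq_sym.
- have [x yx] := sub b y yU; exists x; first exact: vin_congl yU.
  by apply: vsat_veq py; apply: env_rel => // i; apply: veq_refl.
- have tr : vtransitive (Lset al) := Lset_trans oal.
  have hx z : vin (h z) (Lset al) by apply/hh; exists z; apply: veq_refl.
  apply/veqP => v; split=> [vx|vy].
    have /hh[z vz] := tr _ _ (hx x) vx.
    by apply: vin_congl (veq_sym vz) _; apply/xy; apply: vin_congl vx.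
  have /hh[z vz] := tr _ _ (hx y) vy.
  by apply: vin_congl (veq_sym vz) _; apply/xy; apply: vin_congl vy.
exists w; split=> //; apply: eq_rep.
have ga a : veq (col (cLt w) a) (g a).
  elim: (cw.2 a) => {}a _ IH; apply/veqP => y; rewrite (colP cw.2).
  split=> [[b ba yb]|ya].
    by apply: vin_congl (veq_sym (veq_trans yb (IH b ba))) _; apply/wL.
  have /hg[b yb] := oal.1 _ _ (gal a) ya.
  have ba : cLt w b a by apply/wL; apply: vin_congl ya.
  by exists b => //; apply: veq_trans yb (veq_sym (IH b ba)).
apply/veqP => y; rewrite hg; split=> [[/= a ya]|[a ya]]; exists a => /=.
  exact: veq_trans (ga a).
exact: veq_trans (veq_sym (ga a)).
Qed.

(** * Countability of formulas, Skolem hulls and condensation *)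

Fixpoint fenc n (p : formula n) : GenTree.tree nat :=
  match p with
  | Fmem _ i j => GenTree.Node 0 [:: GenTree.Leaf (val i); GenTree.Leaf (val j)]
  | Feq _ i j => GenTree.Node 1 [:: GenTree.Leaf (val i); GenTree.Leaf (val j)]
  | Fnot _ p => GenTree.Node 2 [:: fenc p]
  | Fand _ p q => GenTree.Node 3 [:: fenc p; fenc q]
  | Fex _ p => GenTree.Node 4 [:: fenc p]
  end.

Fixpoint fdec (t : GenTree.tree nat) n : option (formula n) :=
  match t with
  | GenTree.Node 0 [:: GenTree.Leaf i; GenTree.Leaf j] =>
      if insub i is Some i' then omap (Fmem i') (insub j) else None
  | GenTree.Node 1 [:: GenTree.Leaf i; GenTree.Leaf j] =>
      if insub i is Some i' then omap (Feq i') (insub j) else None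
  | GenTree.Node 2 [:: t] => omap (@Fnot n) (fdec t n)
  | GenTree.Node 3 [:: t; t'] =>
      if fdec t n is Some p then omap (Fand p) (fdec t' n) else None
  | GenTree.Node 4 [:: t] => omap (@Fex n) (fdec t n.+1)
  | _ => None
  end.

Lemma fencK n (p : formula n) : fdec (fenc p) n = Some p.
Proof.
by elim: p => {n} [n i j|n i j|n p IH|n p IHp q IHq|n p IH] /=;
  rewrite ?valK ?IH ?IHp ?IHq.
Qed.

Lemma ctbl_formula n : ctbl (formula n).
Proof.
apply: (@ctbl_inj _ _ (@fenc n)); last exact: ctbl_count.
by move=> p q e; apply: Some_inj; rewrite -!fencK e.
Qed.

Lemma ctbl_sigformula : ctbl {n & formula n.+1}.
Proof.
apply: (@ctbl_inj _ (nat * GenTree.tree nat)%type (fun s => (tag s, fenc (tagged s)))).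
  move=> [n p] [m q] [] nm; case: _ / nm q => q /= e.
  by congr existT; apply: Some_inj; rewrite -!fencK e.
exact: ctbl_count.
Qed.

Lemma ctbl_env n : ctbl ('I_n -> nat).
Proof.
apply: (@ctbl_inj _ {ffun 'I_n -> nat} (fun e => [ffun i => e i])).
  by move=> e f /ffunP ef; apply/funext => i; have := ef i; rewrite !ffunE.
exact: ctbl_count.
Qed.

Lemma ctbl_option I : ctbl I -> ctbl (option I).
Proof.
move=> [f fi]; apply: (@ctbl_inj _ (option nat) (omap f)); last exact: ctbl_count.
by move=> [x|] [y|] //= [/fi ->].
Qed.

Lemma ctbl_prod I J : ctbl I -> ctbl J -> ctbl (I * J).
Proof.
move=> [f fi] [g gi]; apply: (@ctbl_inj _ (nat * nat)%type (fun s => (f s.1, g s.2))).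
  by move=> [x y] [x' y'] /= [/fi -> /gi ->].
exact: ctbl_count.
Qed.

Section hull.
Context (V K : Type) (cK : ctbl K) (Q : K -> seq V -> seq V -> Prop) (base : nat -> V).

(** The hull consists of the values of finite trees over the base. Operations return lists of
    variable length, so the label of a node pairs an operation with a position in its output;
    meaningless labels evaluate to [base 0]. *)
Lemma countable_hull : exists N : nat -> V, (forall k, exists j, N j = base k) /\
  forall k (s : seq nat), (exists t, Q k (map N s) t) ->
    exists u, Q k (map N s) (map N u).
Proof.
have [f fi] := cK.
have /choice[op opP] : forall ks : K * seq V, exists t, (exists t', Q ks.1 ks.2 t') ->
    Q ks.1 ks.2 t.
  move=> [k s] /=; have [[t Qt]|nQ] := pselect (exists t', Q k s t'); first by exists t.
  by exists [::] => /nQ.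
have /choice[dec decP] : forall o : nat, exists k : option K, forall k', f k' = o -> k = Some k'.
  move=> o; have [[k fk]|nk] := pselect (exists k, f k = o).
    by exists (Some k) => k'; rewrite -fk => /fi ->.
  by exists None => k' fk; case: nk; exists k'.
pose op' (n : nat) (s : seq V) : V :=
  if unpickle n is Some (o, i) then
    (if dec o is Some k then nth (base 0%N) (op (k, s)) i else base 0%N)
  else base 0%N.
pose fix ev (t : GenTree.tree nat) : V := match t with
  | GenTree.Leaf k => base k
  | GenTree.Node n ts => op' n (map ev ts) end.
pose un (j : nat) : GenTree.tree nat := odflt (GenTree.Leaf 0%N) (unpickle j).
have unK t : un (pickle t) = t by rewrite /un pickleK.
exists (fun j => ev (un j)); split=> [k|k s].
  by exists (pickle (GenTree.Leaf k : GenTree.tree nat)); rewrite unK.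
set s' := map _ s => ext; have Qt := opP (k, s') ext.
set t := op (k, s') in Qt *.
pose u := mkseq (fun i => pickle (GenTree.Node (pickle (f k, i)) (map un s))) (size t).
exists u; suff -> : [seq ev (un j) | j <- u] = t by [].
apply: (@eq_from_nth _ (base 0%N)); rewrite size_map size_mkseq// => i it.
rewrite (nth_map 0%N) ?size_mkseq// nth_mkseq// unK /= /op' pickleK.
by rewrite (decP _ k erefl) -map_comp.
Qed.

End hull.

Lemma map_enum_inj (T : Type) n (e e' : 'I_n -> T) :
  map e (enum 'I_n) = map e' (enum 'I_n) -> e = e'.
Proof. by move=> /eq_in_map ee; apply/funext => i; apply: ee; rewrite mem_enum. Qed.

Section condensation.
Context (al : vset) (oal : vordinal al) (v0 b0 : vset).
Context (v0L : vin v0 (Lset al)) (b0al : vin b0 al).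

(** Three kinds of functions: one separates two different sets; one finds, below a given ordinal, a
    level over which a set is definable, together with the parameters; one evaluates a formula over
    a level, [o] choosing between the set it defines and an element satisfying it. They yield the
    extensionality, rank, closure and elementarity hypotheses of [make_code]. *)
Definition skolem (k : option (option (bool * {n & formula n.+1}))) (s t : seq vset) :=
  match k with
  | None => exists x y z, [/\ s = [:: x; y], t = [:: z], vin z (Lset al) &
                              ~ (vin z x <-> vin z y)]
  | Some None => exists x a b n (p : formula n.+1) (e : 'I_n -> vset),
      [/\ s = [:: x; a], t = b :: map e (enum 'I_n), vin b a,
          forall i, vin (e i) (Lset b) & defines (Lset b) p e x]
  | Some (Some (o, existT n p)) => exists b (e : 'I_n -> vset) y,
      [/\ s = b :: map e (enum 'I_n), t = [:: y] &
          if o then defines (Lset b) p e y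
          else vin y (Lset b) /\ vsat (Lset b) p (env_cons y e)]
  end.

Lemma condense (base : nat -> vset) : (forall k, vin (base k) (Lset al)) ->
  exists w h, [/\ code w, forall x y, cE w x y <-> vin (h x) (h y) &
    forall k, exists x, h x = base k].
Proof.
move=> baseL.
(* [v0] and [b0] become default names, for hull elements outside L_al or outside [al]. The ordinal
   [al] is put in so that [def1], which looks below an ordinal of the hull, also covers L_al
   itself. *)
pose base' k := match k with 0 => v0 | 1 => b0 | 2 => al | k'.+3 => base k' end.
have [N [Nbase Ncl]] := countable_hull
  (ctbl_option (ctbl_option (ctbl_prod ctbl_bool ctbl_sigformula))) skolem base'.
have [k_al /= Nal] := Nbase 2%N; have [k_v /= Nv] := Nbase 0%N.
have [k_b /= Nb] := Nbase 1%N.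
pose g k := if pselect (vin (N k) al) then N k else b0.
pose h k := if pselect (vin (N k) (Lset al)) then N k else v0.
have gN k : vin (N k) al -> g k = N k by rewrite /g; case: pselect.
have hN k : vin (N k) (Lset al) -> h k = N k by rewrite /h; case: pselect.
have gE a : exists k, N k = g a.
  by rewrite /g; case: pselect => ? /=; [exists a|exists k_b].
have hE x : exists k, N k = h x.
  by rewrite /h; case: pselect => ? /=; [exists x|exists k_v].
have gal a : vin (g a) al by rewrite /g; case: pselect.
have hL x : vin (h x) (Lset al) by rewrite /h; case: pselect.
have sub b v : vin b al -> vin v (Lset b) -> vin v (Lset al).
  by move=> bal; apply: Lset_mono => c cb; apply: oal.1 bal cb.
have nseq n (e : 'I_n -> nat) : exists s : seq nat,
    map N s = map (h \o e) (enum 'I_n).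
  have /choice[f fe] : forall i, exists k, N k = h (e i) by move=> i; apply: hE.
  by exists (map f (enum 'I_n)); rewrite -map_comp; apply: eq_map => i /=.
have def1 m x : (forall b, vin b (N m) -> vin b al) -> vin (h x) (Lset (N m)) ->
    exists b, vin (g b) (N m) /\ exists n (p : formula n.+1) (e : 'I_n -> nat),
      (forall i, vin (h (e i)) (Lset (g b))) /\
      defines (Lset (g b)) p (h \o e) (h x).
  move=> mal /LsetP[b bm /DefP[n [p [e [eL dx]]]]].
  have [kx Nx] := hE x.
  have [|u /= [x' [a' [b' [n' [p' [e' [[? ?] eu b'm e'L dx']]]]]]]] := Ncl (Some None) [:: kx; m].
    by exists (b :: map e (enum 'I_n)) => /=; exists (N kx), (N m), b, n, p, e; rewrite Nx.
  subst x' a'; have bal := mal _ b'm.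
  case: u eu => [|k u] //= [] Nk eu; subst b'.
  have su : size u = n' by rewrite -(size_map N) eu size_map size_enum_ord.
  have eN (i : 'I_n') : h (nth 0%N u i) = e' i.
    have e'E : e' i = N (nth 0%N u i).
      rewrite -(nth_map _ v0) ?su// eu (nth_map i) ?size_enum_ord//.
      by rewrite nth_ord_enum.
    by rewrite hN -?e'E//; apply: sub bal _; apply: e'L.
  exists k; rewrite gN//; split=> //; exists n', p', (fun i => nth 0%N u i).
  split=> [i|]; first by rewrite eN; apply: e'L.
  rewrite -Nx (_ : _ \o _ = e')//; by apply/funext => i /=; rewrite eN.
have [x|a x xL|b n p e eL|b n p e eL [y yL py]|x y xy|w [cw [_ wE]]] := @make_code al oal g h gal.
- have [||b [_ d]] := def1 k_al x; rewrite ?Nal//.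
  by exists b.
- have [k Nk] := gE a; rewrite -Nk in xL *.
  by apply: def1 xL => b; apply: oal.1; rewrite Nk; apply: gal.
- have [k Nk] := gE b; have [s Ns] := nseq n e.
  pose M := Lset (g b).
  pose v := Vset (fun s : {c : carrier M | vsat M p (env_cons (elt c) (h \o e))} =>
    elt (sval s)).
  have dv : defines M p (h \o e) v.
    move=> y; split=> [[[c pc] /= yc]|[[c yc] py]].
      split; first by exists c.
      by apply: vsat_veq pc; apply: env_rel => [|i]; [apply: veq_sym|apply: veq_refl].
    have pc : vsat M p (env_cons (elt c) (h \o e)).
      by apply: vsat_veq py; apply: env_rel => // i; apply: veq_refl.
    by exists (exist _ c pc).
  have [|u /= [b' [e' [y [[<- es] eu dy]]]]] :=
      Ncl (Some (Some (true, existT _ n p))) (k :: s).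
    by exists [:: v] => /=; exists (g b), (h \o e), v; split=> //=; rewrite Nk Ns.
  case: u eu => [|j [|]] //= [] Nj; subst y.
  have ee : e' = h \o e := map_enum_inj (etrans (esym es) Ns).
  rewrite ee Nk in dy.
  exists j; rewrite hN//; apply/LsetP; exists (g b) => //; apply/DefP.
  by exists n, p, (h \o e).
- have [k Nk] := gE b; have [s Ns] := nseq n e.
  have [|u /= [b' [e' [y' [[<- es] eu [yL' py']]]]]] :=
      Ncl (Some (Some (false, existT _ n p))) (k :: s).
    by exists [:: y] => /=; exists (g b), (h \o e), y; split=> //=; rewrite Nk Ns.
  case: u eu => [|j [|]] //= [] Nj; subst y'.
  have ee : e' = h \o e := map_enum_inj (etrans (esym es) Ns).
  rewrite ee Nk in py'; rewrite Nk in yL'.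
  by exists j; rewrite hN//; apply: sub yL'.
- apply: contrapT => nxy; have [z nz] : exists z, ~ (vin z (h x) <-> vin z (h y)).
    by apply/existsNP => H; apply: nxy; apply/veqP.
  have zL : vin z (Lset al).
    have tr := Lset_trans oal; apply: contrapT => nzL; apply: nz.
    by split=> [/(tr _ _ (hL x))|/(tr _ _ (hL y))].
  have [kx Nx] := hE x; have [ky Ny] := hE y.
  have [|u /= [x' [y' [z' [[? ?] eu zL' nz']]]]] := Ncl None [:: kx; ky].
    by exists [:: z] => /=; exists (N kx), (N ky), z; rewrite Nx Ny.
  case: u eu => [|j [|]] //= [] Nj; subst x' y' z'.
  by apply: nz'; rewrite Nx Ny -(hN j).
exists w, h; split=> // k; have [j /= Nj] := Nbase k.+3.
by exists j; rewrite hN Nj//; apply: baseL.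
Qed.

End condensation.

Lemma real_in_code (VL : V_eq_L) (r : bits) : exists w, code w /\ Rl (ot w) r.
Proof.
pose v0 := Vset (fun j : {j | r j} => znum (sval j)).
(* One set collects the real and all the numerals. Some L_al contains them together, and the hull
   will contain them too, so that the collapse does not change the real. *)
pose s := Vset (fun k => if k is j.+1 then znum j else v0).
have [al oal sL] := VL s; have tr := Lset_trans oal.
have sel k : vin (if k is j.+1 then znum j else v0) (Lset al).
  by apply: tr sL _; apply: (@vin_elt s k).
have /LsetP[b0 b0al _] := sL.
have [w [h [cw wE hb]]] := condense oal (sel 0%N) b0al sel.
have [k0 hk0] := hb 0%N.
have isn j y : veq (h y) (znum j) -> isnum w j y.
  elim: j y => [|j IH] y /= yj.
    by move=> z /wE/(vin_congr yj)/vin_vempty.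
  split=> [|z /wE/(vin_congr yj)/vin_znumS]; last exact: IH.
  have [z hz] := hb j.+1; exists z; apply/wE; apply: vin_congr (veq_sym yj) _.
  by apply/vin_znumS; rewrite hz; apply: veq_refl.
have isn_inj i j y : isnum w i y -> isnum w j y -> i = j.
  elim: i j y => [|i IH] [|j] y //=.
  - by move=> h0 [[z /h0]].
  - by move=> [[z zy] _] /(_ _ zy).
  - by move=> [[z zy] /(_ _ zy) iz] [_ /(_ _ zy) jz]; congr S; apply: IH jz.
exists w; split=> //; apply/(RotP cw); exists k0; apply/funext => j.
apply/idP/idP => [rj|/rlE[y [yj /wE]]].
  apply/rlE; have [y hy] := hb j.+1; exists y; split; first by apply: isn; rewrite hy; apply: veq_refl.
  by apply/wE; rewrite hk0 hy; apply: (@vin_elt v0 (exist _ j rj)).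
rewrite hk0 => -[[i ri] /= /isn yi].
by rewrite (isn_inj _ _ _ yj yi).
Qed.

Lemma vin_ot w y : vin y (ot w) <-> exists a, veq y (ph w a).
Proof.
split=> [yw|[a ya]].
  have /otP[a ea] : olt (rep y) (ot w).
    by split; [apply: vin_congl yw; apply: rep_veq|apply: rep_id].
  by exists a; rewrite -ea; apply: rep_veq.
by apply: vin_congl (veq_sym ya) _; have [] := ph_ot w a.
Qed.

Lemma limit_code (W : nat -> bits) : (forall i, code (W i)) ->
  (forall i, olt (ot (W i)) (ot (W i.+1))) ->
  exists w, code w /\ forall b, olt b (ot w) <-> exists i, olt b (ot (W i)).
Proof.
move=> cW incW.
pose al := Vset (fun s : nat * nat => ph (W s.1) s.2).
have alP y : vin y al <-> exists i, vin y (ot (W i)).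
  split=> [[[i a] /= ya]|[i /vin_ot[a ya]]]; last by exists (i, a).
  by exists i; apply/vin_ot; exists a.
have oal : vordinal al.
  split=> [y z /alP[i yi] zy|y /alP[i yi]].
    by apply/alP; exists i; apply: (ot_ord (cW i)).1 yi zy.
  exact: (ot_ord (cW i)).2 yi.
(* A name in the new code is an index together with a name in the code of that index. *)
pose un k : nat * nat := odflt (0, 0)%N (unpickle k).
have unK i a : un (pickle (i, a)) = (i, a) by rewrite /un pickleK.
have [||w [cw ew]] := @full_code al (fun k => ph (W (un k).1) (un k).2)
  (fun k => col (cE (W (un k).1)) (un k).2) oal.
- move=> b; split=> [[[i a] /= ba]|[k bk]]; first by exists (pickle (i, a)); rewrite unK.
  by exists (un k).
- move=> v; split=> [/LsetP[b /alP[i bi] vb]|[k vk]].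
    have /(Lset_ot (cW i))[x vx] : vin v (Lset (ot (W i))) by apply/LsetP; exists b.
    by exists (pickle (i, x)); rewrite unK.
  have : vin v (Lset (ot (W (un k).1))) by apply/Lset_ot => //; exists (un k).2.
  by apply: Lset_mono => c cW'; apply/alP; exists (un k).1.
exists w; split=> // b; rewrite /olt ew; split=> [[bal rb]|[i [bi rb]]].
  have /alP[i bi] : vin b al by apply: vin_congr bal; apply: veq_sym; apply: rep_veq.
  by exists i.
split=> //; apply: vin_congr (rep_veq _) _; apply/alP; by exists i.
Qed.

(** Every number names an ordinal, so a code always codes a nonzero stage; the ordinal [b] below
    [ph w a] guarantees this and serves as default. *)
Lemma restrict_code w a b : code w -> olt b (ph w a) ->
  exists w', code w' /\ ot w' = ph w a.
Proof.
move=> cw ba; have [k0 bk] : exists k, b = ph w k.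
  apply/otP; split; last exact: ba.2.
  by apply: (ot_ord cw).1 _ ba.1; have [] := ph_ot w a.
move: ba; rewrite bk => /(cLtP cw) ka.
(* The formula [x = x] defines the level of [k0] over itself; this gives a default name in the level
   of [a]. *)
have [x0 dx0] : exists x, cdef w k0 x.
  have := cw.1.2.2.2.2.2 k0 0%N (Feq ord0 ord0) (fun i : 'I_0 => 0%N).
  case=> [[]//|x dx]; exists x, 0%N, (Feq ord0 ord0), (fun=> 0%N).
  by split=> // -[].
have Ux0 : cU w a x0 by apply/cw.1.2.2.2.1; exists k0.
have oa : vordinal (ph w a) by apply: vordinal_in (ot_ord cw) (ph_ot w a).1.
pose g k := if pselect (cLt w k a) then ph w k else ph w k0.
pose h k := if pselect (cU w a k) then col (cE w) k else col (cE w) x0.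
have e y : vin y (Lset (ph w a)) <-> vin y (Lset (col (cLt w) a)).
  by apply: vin_veq2 (veq_refl _) (Lset_veq (veq_sym (rep_veq _))).
have [||w' [cw' ew']] := @full_code (ph w a) g h oa.
- move=> c; split=> [ca|[k ck]].
    have /vin_ot[k ck] : vin c (ot w).
      by apply: (ot_ord cw).1 _ ca; have [] := ph_ot w a.
    exists k; rewrite /g; case: pselect => // nka; case: nka; apply/cLtP => //.
    by split; [apply: vin_congl ca|apply: rep_id].
  apply: vin_congl (veq_sym ck) _; rewrite /g.
  by case: pselect => [/(cLtP cw)[]//|?] /=; have [] := (cLtP cw _ _).1 ka.
- move=> v; rewrite e (Lset_phi cw); split=> [[x Ux vx]|[k]].
    by exists x; rewrite /h; case: pselect.
  by rewrite /h; case: pselect => [Uk|?] /= vk; [exists k|exists x0].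
by exists w'; split=> //; rewrite ew' /ph rep_id.
Qed.

(** * Complexity of the notion of a code *)

Ltac bm := repeat first [assumption | apply: Bm_id | apply: Bm_p1 | apply: Bm_p2
  | apply: Bm_sec | apply: Bm_pair | apply: Bm_cst].

Ltac delq := first [exact: ctbl_nat | exact: ctbl_count | exact: ctbl_formula
  | exact: ctbl_env | by []].

Lemma Del_rel i w a b : Bm w -> Del (fun e => rel i (w e) a b).
Proof. by move=> bw; apply: Del_bit; bm. Qed.

Lemma Del_rsat w b n (p : formula n) (u : 'I_n -> nat) : Bm w ->
  Del (fun e => rsat (cU (w e) b) (cE (w e)) (cext (w e)) p u).
Proof.
move=> bw; elim: p u => {n} [n i j|n i j|n p IH|n p IHp q IHq|n p IH] u /=.
- exact: Del_rel.
- by apply: Del_all => [|z]; [delq|apply: Del_iff; apply: Del_rel].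
- exact: DelN.
- exact: Del_and.
- apply: (@eq_Del (fun e => exists x, cU (w e) b x /\
      rsat (cU (w e) b) (cE (w e)) (cext (w e)) p (env_cons x u))).
    by move=> e; split=> -[x]; [case=> Ux px; exists x|exists x].
  by apply: Del_ex => [|x]; [delq|apply: Del_and => //; apply: Del_rel].
Qed.

Lemma Del_cdefines w b n (p : formula n.+1) (u : 'I_n -> nat) x : Bm w ->
  Del (fun e => cdefines (w e) b p u x).
Proof.
move=> bw; apply: Del_all => [|y]; first delq.
apply: Del_iff; first exact: Del_rel.
by apply: Del_and; [apply: Del_rel|apply: Del_rsat].
Qed.

Lemma Del_cU_all w b n (u : 'I_n -> nat) : Bm w ->
  Del (fun e => forall i, cU (w e) b (u i)).
Proof. by move=> bw; apply: Del_all => [|i]; [delq|apply: Del_rel]. Qed.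

Lemma Del_cdef w b x : Bm w -> Del (fun e => cdef (w e) b x).
Proof.
move=> bw; apply: Del_ex => [|n]; first delq.
apply: Del_ex => [|p]; first delq.
apply: Del_ex => [|u]; first delq.
by apply: Del_and; [apply: Del_cU_all|apply: Del_cdefines].
Qed.

Lemma Del_congruent i w : Bm w -> Del (fun e => congruent (rel i (w e))).
Proof.
move=> bw; do 3 (apply: Del_all => [|?]; first delq).
apply: Del_imp; last by apply: Del_imp; apply: Del_rel.
by apply: Del_all => [|?]; [delq|apply: Del_iff; apply: Del_rel].
Qed.

Lemma Del_Lcode w : Bm w -> Del (fun e => Lcode (w e)).
Proof.
move=> bw; apply: Del_and.
  do 3 (apply: Del_all => [|?]; first delq).
  by do 2 (apply: Del_imp; first exact: Del_rel); apply: Del_rel.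
apply: Del_and; first exact: Del_congruent.
apply: Del_and; first exact: Del_congruent.
apply: Del_and.
  do 2 (apply: Del_all => [|?]; first delq).
  apply: Del_iff; first exact: Del_rel.
  apply: Del_ex => [|b]; first delq.
  by apply: Del_and; [apply: Del_rel|apply: Del_cdef].
apply: Del_and.
  apply: Del_all => [|x]; first delq.
  by apply: Del_ex => [|b]; [delq|apply: Del_cdef].
apply: Del_all => [|b]; first delq.
apply: Del_all => [|n]; first delq.
apply: Del_all => [|p]; first delq.
apply: Del_all => [|u]; first delq.
apply: Del_imp; first exact: Del_cU_all.
by apply: Del_ex => [|x]; [delq|apply: Del_cdefines].
Qed.

Lemma Del_isnum w j y : Bm w -> Del (fun e => isnum (w e) j y).
Proof.
move=> bw; elim: j y => [|j IH] y /=.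
  by apply: Del_all => [|z]; [delq|apply: DelN; apply: Del_rel].
apply: Del_and; first by apply: Del_ex => [|z]; [delq|apply: Del_rel].
by apply: Del_all => [|z]; [delq|apply: Del_imp => //; apply: Del_rel].
Qed.

Lemma Bm_rl w k : Bm w -> Bm (fun e => rl (w e) k).
Proof.
move=> bw j; apply: (@eq_Del (fun e => exists y, isnum (w e) j y /\ cE (w e) y k)).
  by move=> e; rewrite rlE.
apply: Del_ex => [|y]; first delq.
by apply: Del_and; [apply: Del_isnum|apply: Del_rel].
Qed.

Lemma well_foundedPn (r : nat -> nat -> Prop) :
  ~ well_founded r <-> exists f : nat -> nat, forall i, r (f i.+1) (f i).
Proof.
split=> [/existsNP[a na]|[f fr] wr]; last first.
  suff: forall a, Acc r a -> forall i, f i = a -> False by move=> /(_ _ (wr (f 0%N)) 0%N erefl).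
  move=> a; elim=> {}a _ IH i fi; apply: (IH (f i.+1) _ i.+1 erefl).
  by rewrite -fi; apply: fr.
have /choice[s sP] : forall a, exists b, ~ Acc r a -> r b a /\ ~ Acc r b.
  move=> {na}a; have [aa|na] := pselect (Acc r a); first by exists a.
  have [b nb] : exists b, ~ (r b a -> Acc r b) by apply/existsNP => h; apply: na.
  by exists b => _; apply/not_implyP.
pose f i := iter i s a.
have nf i : ~ Acc r (f i) by elim: i => //= i /sP[].
by exists f => i; have [] := sP _ (nf i).
Qed.

Lemma Sig_illfounded w : Bm w -> Sig (fun e => ~ well_founded (cLt (w e))).
Proof.
move=> bw; apply: (@eq_Sig (fun e => exists u : bits,
   (forall i, exists j, u (pickle (i, j)) /\ forall j', u (pickle (i, j')) -> j' = j) /\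
   forall i j j' : nat, u (pickle (i, j)) -> u (pickle (i.+1, j')) -> cLt (w e) j' j)).
  move=> e; rewrite well_foundedPn; split=> [[u [tu ru]]|[f fr]].
    have /choice[f fu] : forall i : nat, exists j : nat, u (pickle (i, j)).
      by move=> i; have [j [uj _]] := tu i; exists j.
    by exists f => i; apply: ru (fu i) (fu i.+1).
  exists (fun k => if unpickle k is Some (i, j) then f i == j else false); split.
    by move=> i; exists (f i); rewrite pickleK eqxx; split=> // j'; rewrite pickleK => /eqP.
  by move=> i j j'; rewrite !pickleK => /eqP <- /eqP <-; apply: fr.
apply: (@Sig_exB (fun x u => (forall i, exists j, u (pickle (i, j)) /\
   forall j', u (pickle (i, j')) -> j' = j) /\
   forall i j j' : nat, u (pickle (i, j)) -> u (pickle (i.+1, j')) -> cLt x j' j)) => // x u bx bu.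
apply: Del_Sig; apply: Del_and.
  apply: Del_all => [|i]; first delq.
  apply: Del_ex => [|j]; first delq.
  apply: Del_and; first exact: Del_bit.
  by apply: Del_all => [|j']; [delq|apply: Del_imp; [apply: Del_bit|apply: Del_cst]].
do 3 (apply: Del_all => [|?]; first delq).
by do 2 (apply: Del_imp; first exact: Del_bit); apply: Del_rel.
Qed.

(** * Bookkeeping along a well-founded hierarchy *)

(* [hH a x b m y] stands for: some point of stage [a] carrying [x] is sent by the
   function coded by [x] to a point of stage [b] of the [m]-th piece carrying [y]. *)
Record hsys := HSys {
  hI : Type; hK : Type;
  hlt : hI -> hI -> Prop;
  hR : hI -> hK -> Prop;
  hH : hI -> hK -> hI -> nat -> hK -> Prop;
  hrf : hI -> Prop;
  hbs : hK -> nat -> Prop }.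

Section operators.
Context (S : hsys) (Ty : hI S -> nat -> Prop) (Inn : hI S -> hK S -> Prop).

Definition lev (a : hI S) := exists n, Ty a n.

(** The target may carry any real of stage [a]: whether that stage receives points at all depends on
    blocking, which is defined from [hits]. *)
Definition hits (b : hI S) x a := exists m y, hR a y /\ hH b x a m y.

(* Each pair [(b, x)] blocks at most one stage: the first one it hits. *)
Definition blocks (b : hI S) x a :=
  [/\ hlt b a, hR b x, Inn b x, hits b x a &
      forall c, hlt b c -> hlt c a -> ~ hits b x c].

(* [n] is the finite part of the order type of the set of levels below [a]. *)
Definition typ (a : hI S) n := match n with
  | 0 => forall b, hlt b a -> lev b -> exists c, [/\ hlt b c, hlt c a & lev c]
  | m.+1 => exists b, [/\ hlt b a, Ty b m & forall c, hlt b c -> hlt c a -> ~ lev c]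
  end.

Definition TyR (a : hI S) n := [/\ hrf a, ~ (exists b x, blocks b x a) & typ a n].

Definition avoids (a : hI S) x := forall b n y,
  hlt b a -> Ty b n -> hR b y -> Inn b y -> hbs x n -> ~ hH a x b n y.

Definition InR (a : hI S) x := [/\ exists n, TyR a n, hR a x & avoids a x].

End operators.

Definition solves (S : hsys) Ty Inn := forall a : hI S,
  (forall n, Ty a n <-> TyR Ty Inn a n) /\ (forall x, Inn a x <-> InR Ty Inn a x).

(** The same recursion is run on sets, on the names in a code, and on these names with a top stage
    added. A morphism maps the stages onto initial segments and preserves the data consulted by the
    operators. *)
Record hmorph (S S' : hsys) (q : hI S -> hI S') (t : hK S -> hK S') : Prop := HMorph {
  m_lt : forall b c, hlt b c <-> hlt (q b) (q c);
  m_on : forall a be, hlt be (q a) -> exists b, q b = be;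
  m_R : forall b k, hR b k <-> hR (q b) (t k);
  m_Ron : forall b x, hR (q b) x -> exists k, t k = x;
  m_H : forall b c k m k', hlt b c \/ hlt c b -> hR b k -> hR c k' ->
    hH b k c m k' <-> hH (q b) (t k) (q c) m (t k');
  m_bs : forall k n, hbs k n <-> hbs (t k) n }.

Section transfer.
Context (S S' : hsys) (q : hI S -> hI S') (t : hK S -> hK S') (M : hmorph q t).
Context (Ty : hI S -> nat -> Prop) (Inn : hI S -> hK S -> Prop).
Context (Ty' : hI S' -> nat -> Prop) (Inn' : hI S' -> hK S' -> Prop).
Context (a : hI S).
Hypothesis rfa : hrf a <-> hrf (q a).
Hypothesis tab : forall b, hlt b a -> (forall n, Ty b n <-> Ty' (q b) n) /\
  (forall k, hR b k -> Inn b k <-> Inn' (q b) (t k)).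

Let levE b : hlt b a -> lev Ty b <-> lev Ty' (q b).
Proof.
by move=> ba; split=> -[n Tn]; exists n; apply/(proj1 (tab ba)).
Qed.

Let hitsE b k c : hlt b c -> hR b k -> hits b k c <-> hits (q b) (t k) (q c).
Proof.
move=> bc bk; split=> [[m [k' [ck' h]]]|[m [x [cx h]]]].
  exists m, (t k'); split; first exact/(m_R M).
  by apply/(m_H M) => //; left.
have [k' e] := m_Ron M cx; exists m, k'; rewrite -e in cx h.
have ck' : hR c k' by apply/(m_R M).
by split=> //; apply/(m_H M) => //; left.
Qed.

Let onE be : hlt be (q a) -> exists2 b, q b = be & hlt b a.
Proof. by move=> h; have [b e] := m_on M h; exists b => //; apply/(m_lt M); rewrite e. Qed.

Lemma blocks_transfer : (exists b x, blocks Inn b x a) <-> (exists b x, blocks Inn' b x (q a)).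
Proof.
split=> [[b [k [ba bk ik hk nk]]]|[be [x [ba bx ix hx nx]]]].
  exists (q b), (t k); split.
  - exact/(m_lt M).
  - exact/(m_R M).
  - exact/(proj2 (tab ba)).
  - exact/hitsE.
  - move=> ga bg ga'; have [c e ca] := onE ga'; rewrite -e in bg ga' *.
    have bc : hlt b c by apply/(m_lt M).
    by move=> /(hitsE bc bk); apply: nk.
have [b e ba'] := onE ba; rewrite -e in ba bx ix hx nx.
have [k ek] := m_Ron M bx; rewrite -ek in bx ix hx nx.
have bk : hR b k by apply/(m_R M).
exists b, k; split=> //.
- exact/(proj2 (tab ba')).
- exact/(hitsE ba').
- move=> c bc ca /(hitsE bc bk); apply: nx; exact/(m_lt M).
Qed.

Lemma typ_transfer n : typ Ty a n <-> typ Ty' (q a) n.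
Proof.
case: n => [|n] /=; split.
- move=> H be bea lb; have [b e ba] := onE bea; rewrite -e in lb *.
  have /(H b ba)[c [bc ca lc]] : lev Ty b by apply/levE.
  by exists (q c); split; [apply/(m_lt M)|apply/(m_lt M)|apply/levE].
- move=> H b ba lb.
  have [||ga [bg gaa lg]] := H (q b); [exact/(m_lt M)|exact/levE|].
  have [c e ca] := onE gaa; rewrite -e in bg lg.
  by exists c; split=> //; [apply/(m_lt M)|apply/levE].
- move=> [b [ba Tb nb]]; exists (q b); split; [exact/(m_lt M)|exact/(proj1 (tab ba))|].
  move=> ga bg gaa; have [c e ca] := onE gaa; rewrite -e in bg *.
  by move=> /(levE ca); apply: nb => //; apply/(m_lt M).
- move=> [be [bea Tb nb]]; have [b e ba] := onE bea; rewrite -e in Tb nb.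
  exists b; split=> //; first exact/(proj1 (tab ba)).
  move=> c bc ca /(levE ca); apply: nb; exact/(m_lt M).
Qed.

Lemma TyR_transfer n : TyR Ty Inn a n <-> TyR Ty' Inn' (q a) n.
Proof. by split=> -[/rfa ? nb /typ_transfer ?]; split=> // /blocks_transfer. Qed.

Lemma avoids_transfer k : hR a k -> avoids Ty Inn a k <-> avoids Ty' Inn' (q a) (t k).
Proof.
move=> ak; split=> [H be n y bea Tb by_ iy bs h|H b n k' ba Tb bk' ik' bs h].
  have [b e ba] := onE bea; rewrite -e in Tb by_ iy h.
  have [k' ek] := m_Ron M by_; rewrite -ek in by_ iy h.
  have bk' : hR b k' by apply/(m_R M).
  apply: (H b n k' ba) => //; first exact/(proj1 (tab ba)).
  - exact/(proj2 (tab ba)).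
  - exact/(m_bs M).
  - by apply/(m_H M) => //; right.
apply: (H (q b) n (t k')).
- exact/(m_lt M).
- exact/(proj1 (tab ba)).
- exact/(m_R M).
- exact/(proj2 (tab ba)).
- exact/(m_bs M).
- by apply/(m_H M) => //; right.
Qed.

Lemma InR_transfer k : hR a k -> InR Ty Inn a k <-> InR Ty' Inn' (q a) (t k).
Proof.
move=> ak; split=> -[[n Tn] rk av]; split.
- by exists n; apply/TyR_transfer.
- exact/(m_R M).
- exact/avoids_transfer.
- by exists n; apply/TyR_transfer.
- by [].
- exact/avoids_transfer.
Qed.

End transfer.

(** The operators at [a] consult their arguments only below [a], so induction applies. From names to
    sets, this says that any correct table on a code has the true values. *)
Lemma solves_transfer (S S' : hsys) (q : hI S -> hI S') (t : hK S -> hK S') :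
  hmorph q t -> well_founded (@hlt S) -> (forall a : hI S, hrf a <-> hrf (q a)) ->
  forall Ty Inn Ty' Inn', solves Ty Inn -> solves Ty' Inn' ->
  forall a : hI S, (forall n, Ty a n <-> Ty' (q a) n) /\
    (forall k, hR a k -> Inn a k <-> Inn' (q a) (t k)).
Proof.
move=> M wf rf Ty Inn Ty' Inn' so so' a; elim: (wf a) => {}a _ IH; split=> [n|k ak].
  rewrite (so a).1 (so' (q a)).1; exact: (TyR_transfer M (rf a) IH).
rewrite (so a).2 (so' (q a)).2; exact: (InR_transfer M (rf a) IH ak).
Qed.

Lemma solves_ex (S : hsys) : well_founded (@hlt S) -> exists Ty Inn, @solves S Ty Inn.
Proof.
move=> wf.
(* Along the identity, the transfer lemmas express that the operators are local; this allows partial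
   tables during the well-founded recursion. *)
have M : @hmorph S S id id.
  by split=> // ? z _; exists z.
pose T := ((nat -> Prop) * (hK S -> Prop))%type.
pose lTy (a : hI S) (rec : forall b, hlt b a -> T) b n := exists h : hlt b a, (rec b h).1 n.
pose lIn (a : hI S) (rec : forall b, hlt b a -> T) b x := exists h : hlt b a, (rec b h).2 x.
pose F (a : hI S) (rec : forall b, hlt b a -> T) : T := (TyR (lTy a rec) (lIn a rec) a, InR (lTy a rec) (lIn a rec) a).
pose G := Fix wf (fun=> T) F.
have GE a : G a = F a (fun b _ => G b).
  rewrite /G Fix_eq// => x f g fg; congr F.
  by apply/functional_extensionality_dep => y; apply/functional_extensionality_dep.
have tab a b : hlt b a ->
    (forall n, lTy a (fun b _ => G b) b n <-> (G b).1 n) /\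
    (forall k, hR b k -> lIn a (fun b _ => G b) b k <-> (G b).2 k).
  by move=> ba; split=> [n|k _]; split=> [[]//|?]; exists ba.
exists (fun a => (G a).1), (fun a => (G a).2) => a; split=> [n|k]; rewrite {1}GE /=.
  exact: (TyR_transfer M (iff_refl _) (tab a)).
split=> h; have rk : hR a k by case: h.
  exact: (InR_transfer M (iff_refl _) (tab a) rk).1 h.
exact: (InR_transfer M (iff_refl _) (tab a) rk).2 h.
Qed.

(** * The coanalytic pieces *)

(* Comparing [code w] with [code w'] for unrelated [w] and [w'] would otherwise
   unfold the whole definition. *)
Opaque rel code.


Definition Ord a := vordinal a /\ rep a = a.

Lemma Ord_ot w : code w -> Ord (ot w).
Proof. by move=> cw; split; [apply: ot_ord|apply: rep_id]. Qed.

Lemma Ord_lt a b : Ord a -> olt b a -> Ord b.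
Proof. by move=> [oa _] [ba rb]; split=> //; apply: vordinal_in ba. Qed.

Lemma olt_trans a b c : Ord c -> olt a b -> olt b c -> olt a c.
Proof. by move=> [oc _] [ab ra] [bc rb]; split=> //; apply: oc.1 bc ab. Qed.

Lemma olt_irr a : ~ olt a a. Proof. by move=> [/vin_irr]. Qed.

Lemma Ord_trich a b : Ord a -> Ord b -> [\/ olt a b, a = b | olt b a].
Proof.
move=> [oa ra] [ob rb]; have [h|h|h] := vordinal_trich oa ob.
- exact: Or31.
- by apply: Or32; rewrite -ra -rb; apply: eq_rep.
- exact: Or33.
Qed.

Lemma Rl_lt a b r : Ord b -> olt a b -> Rl a r -> Rl b r.
Proof. by move=> [ob _] [ab _]; apply: Rl_mono. Qed.

Definition natb (m : nat) : bits := fun k => k == m.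

Lemma natb_inj : injective natb.
Proof. by move=> m n /(congr1 (fun f => f m)); rewrite /natb eqxx => /esym/eqP. Qed.

Definition tri (p : bits) (m : nat) (q : bits) := cpair p (cpair (natb m) q).

(** Column 0 of [x] is a tree for the graph of the function that [x] codes, and [v] a branch
    witnessing the value; column 1, read by [bsx], is the set of pieces aimed at. *)
Definition Fw x p m q v := branch (sec 0 x) (tri p m q) v.

Definition bsx (x : bits) (n : nat) : Prop := sec 1 x n.

Definition codeof a w := code w /\ ot w = a.

Definition Hw a x b m y w1 w2 v :=
  codeof a w1 /\ codeof b w2 /\ Fw x (cpair x w1) m (cpair y w2) v.

Definition Hx a x b m y := exists w1 w2 v, Hw a x b m y w1 w2 v.

Definition visx al a x b m y := exists w1 w2 v,
  [/\ Rl al w1, Rl al w2, Rl al v & Hw a x b m y w1 w2 v].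

(* Under reflection, the analytic relation [Hx] below [al] can be read off a code
   of [al] in a Borel way. *)
Definition rfx al := forall a b x m y, olt a al -> olt b al -> Rl a x -> Rl b y ->
  Hx a x b m y -> visx al a x b m y.

Definition XS : hsys := @HSys vset bits olt Rl Hx rfx bsx.

Lemma Xex : exists T : (vset -> nat -> Prop) * (vset -> bits -> Prop),
  @solves XS T.1 T.2.
Proof. by have [Ty [Inn h]] := @solves_ex XS olt_wf; exists (Ty, Inn). Qed.

Definition TyX := (projT1 (cid Xex)).1.
Definition InX := (projT1 (cid Xex)).2.
Definition levX (a : vset) := @lev XS TyX a.

Lemma XsolvesP : @solves XS TyX InX. Proof. exact: projT2 (cid Xex). Qed.

Lemma TyXE a n : TyX a n <-> @TyR XS TyX InX a n. Proof. exact: (XsolvesP a).1. Qed.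
Lemma InXE a x : InX a x <-> @InR XS TyX InX a x. Proof. exact: (XsolvesP a).2. Qed.

Opaque TyX InX.

Lemma InX_lev a x : InX a x -> levX a.
Proof. by move=> /InXE[[n Tn] _ _]; exists n; apply/TyXE. Qed.

Lemma InX_R a x : InX a x -> Rl a x. Proof. by move=> /InXE[]. Qed.

Definition piece n (p : bits) :=
  [/\ code (p2 p), TyX (ot (p2 p)) n & InX (ot (p2 p)) (p1 p)].

Lemma pieceE n x w : piece n (cpair x w) <-> [/\ code w, TyX (ot w) n & InX (ot w) x].
Proof. by rewrite /piece p1E p2E. Qed.

Lemma TyX_uniq a n m : Ord a -> TyX a n -> TyX a m -> n = m.
Proof.
elim: (olt_wf a) n m => {}a _ IH n m oa /TyXE[_ _ tn] /TyXE[_ _ tm].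
case: n m tn tm => [|n] [|m] //=.
- move=> h [b [ba Tb nb]]; have [|c [bc ca lc]] := h b ba; first by exists m.
  by case: (nb c).
- move=> [b [ba Tb nb]] h; have [|c [bc ca lc]] := h b ba; first by exists n.
  by case: (nb c).
- move=> [b [ba Tb nb]] [c [ca Tc nc]]; congr S.
  have [bc|bc|cb] := Ord_trich (Ord_lt oa ba) (Ord_lt oa ca).
  + by case: (nb c) => //; exists m.
  + by rewrite -bc in Tc; apply: IH ba _ _ (Ord_lt oa ba) Tb Tc.
  + by case: (nc b) => //; exists n.
Qed.

(** Either the levels below [a] have a last element, whose type plus one is the type of [a], or they
    have none and the type is 0; no further condition remains. *)
Lemma levX_intro a : rfx a -> ~ (exists b x, @blocks XS InX b x a) -> levX a.
Proof.
move=> ra na.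
have [[b [ba [n Tb] nb]]|nob] := pselect (exists b,
    [/\ olt b a, levX b & forall c, olt b c -> olt c a -> ~ levX c]).
  by exists n.+1; apply/TyXE; split=> //; exists b.
exists 0%N; apply/TyXE; split=> // b ba lb; apply: contrapT => nc; apply: nob.
by exists b; split=> // c bc ca lc; apply: nc; exists c.
Qed.

Lemma blocks_uniq b x a a' : Ord a -> Ord a' ->
  @blocks XS InX b x a -> @blocks XS InX b x a' -> a = a'.
Proof.
move=> oa oa' [ba _ _ ha na] [ba' _ _ ha' na'].
have [aa|//|aa] := Ord_trich oa oa'; first by case: (na' a).
by case: (na a').
Qed.

(** * Cofinality of every type and the diagonal argument *)

Section unbounded.
Hypothesis VL : V_eq_L.

(** A diagonal real differs from every real of the countably many coded levels. Under [V_eq_L] it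
    lies in some coded level, and comparability puts that level above all of them. *)
Lemma code_bound (I : Type) (W : I -> bits) : ctbl I -> (forall i, code (W i)) ->
  exists w, code w /\ forall i, olt (ot (W i)) (ot w).
Proof.
move=> [f fi] cW; have [w0 [cw0 _]] := real_in_code VL (fun=> false).
have /choice[V VP] : forall n, exists w, code w /\ forall i, f i = n -> w = W i.
  move=> n; have [[i fin]|ni] := pselect (exists i, f i = n).
    by exists (W i); split=> // j fj; congr W; apply: fi; rewrite fin fj.
  by exists w0; split=> // j fj; case: ni; exists j.
pose r : bits := fun j => if unpickle j is Some (i, k) then ~~ rl (V i) k j else false.
have [w [cw rw]] := real_in_code VL r.
have nr n : ~ Rl (ot (V n)) r.
  move=> /(RotP (VP n).1)[k rk].
  have := congr1 (fun g => g (pickle (n, k))) rk; rewrite /r pickleK.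
  by case: (rl _ _ _).
exists w; split=> // i; have [_ /(_ i erefl) <-] := VP (f i).
have [//|e|lt] := Ord_trich (Ord_ot (VP (f i)).1) (Ord_ot cw).
  by case: (nr (f i)); rewrite e.
by case: (nr (f i)); apply: Rl_lt lt rw; apply: Ord_ot; have [] := VP (f i).
Qed.

Lemma code_above2 w w' : code w -> code w' ->
  exists w2, [/\ code w2, olt (ot w) (ot w2) & olt (ot w') (ot w2)].
Proof.
move=> cw cw'; have [|[]//|w2 [c2 h]] := @code_bound bool (fun b => if b then w else w').
  exact: ctbl_bool.
by exists w2; split=> //; [apply: (h true)|apply: (h false)].
Qed.

(** Only countably many facts concern the names in [w], and each true one has three real witnesses,
    which lie in coded levels; [code_bound] gives a stage above all these levels. *)
Lemma reflect_step w : code w -> exists w', [/\ code w', olt (ot w) (ot w') &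
  forall a b x m y, olt a (ot w) -> olt b (ot w) -> Rl a x -> Rl b y ->
    Hx a x b m y -> visx (ot w') a x b m y].
Proof.
move=> cw.
pose fact (i : nat * nat * nat * nat * nat) w1 w2 v :=
  let: (a, k, b, m, k') := i in Hw (ph w a) (rl w k) (ph w b) m (rl w k') w1 w2 v.
have /choice[t tP] : forall i, exists t : nat -> bits, (forall j, code (t j)) /\
    ((exists w1 w2 v, fact i w1 w2 v) -> exists w1 w2 v,
      [/\ Rl (ot (t 0%N)) w1, Rl (ot (t 1%N)) w2, Rl (ot (t 2%N)) v & fact i w1 w2 v]).
  move=> i; have [[w1 [w2 [v h]]]|nh] := pselect (exists w1 w2 v, fact i w1 w2 v).
    have [c1 [cc1 R1]] := real_in_code VL w1.
    have [c2 [cc2 R2]] := real_in_code VL w2.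
    have [c3 [cc3 R3]] := real_in_code VL v.
    exists (fun j => match j with 0 => c1 | 1 => c2 | _ => c3 end).
    by split=> [[|[|j]]//|_]; exists w1, w2, v.
  by exists (fun=> w).
pose W (s : option (nat * nat * nat * nat * nat * nat)) :=
  if s is Some (i, j) then t i j else w.
have [||w' [cw' bw']] := @code_bound _ W.
- by apply: ctbl_option; do 5 (apply: ctbl_prod; last exact: ctbl_nat); exact: ctbl_nat.
-  by case=> [[i j]|]; [exact: (tP i).1|exact: cw].
exists w'; split=> //; first exact: (bw' None).
move=> a b x m y /otP[a' ->] /otP[b' ->] /(RphP cw)[k _ ->] /(RphP cw)[k' _ ->] h.
have [_ /(_ h)[w1 [w2 [v [R1 R2 R3 h']]]]] := tP (a', k, b', m, k').
have ow' := Ord_ot cw'.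
by exists w1, w2, v; split=> //; [move: R1|move: R2|move: R3]; apply: Rl_lt => //;
  [apply: (bw' (Some (_, 0%N)))|apply: (bw' (Some (_, 1%N)))|apply: (bw' (Some (_, 2%N)))].
Qed.

(** A fact about stages below the union of the [W i] already concerns stages below one [W i], and
    finds its witnesses at the next step. *)
Lemma reflect_unbounded w0 : code w0 ->
  exists w, [/\ code w, olt (ot w0) (ot w) & rfx (ot w)].
Proof.
move=> c0.
have /choice[g gP] : forall w, exists w', code w -> [/\ code w', olt (ot w) (ot w') &
  forall a b x m y, olt a (ot w) -> olt b (ot w) -> Rl a x -> Rl b y ->
    Hx a x b m y -> visx (ot w') a x b m y].
  move=> w; have [cw|] := pselect (code w); last by exists w.
  by have [w' ?] := reflect_step cw; exists w'.
pose W i := iter i g w0.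
have cW i : code (W i).
  by elim: i => [|i IH]; [exact: c0|case: (gP _ IH) => + _ _; exact].
have incW i : olt (ot (W i)) (ot (W i.+1)) by have [] := gP _ (cW i).
have [w [cw wP]] := limit_code cW incW; have ow := Ord_ot cw.
have Ww i : olt (ot (W i)) (ot w) by apply/wP; exists i.+1.
have monoW i k a : olt a (ot (W i)) -> olt a (ot (W (i + k)%N)).
  elim: k => [|k IH] h; first by rewrite addn0.
  by rewrite addnS; apply: olt_trans (IH h) (incW _); apply: Ord_ot.
exists w; split=> //; first exact: (Ww 0%N).
move=> a b x m y /wP[i ai] /wP[j bj] Rx Ry h.
have [_ _ /(_ a b x m y)[]//] := gP _ (cW (i + j)%N).
- exact: monoW.
- by rewrite addnC; apply: monoW.
move=> w1 [w2 [v [R1 R2 R3 h']]]; have lt : olt (ot (W (i + j).+1)) (ot w) := Ww _.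
by exists w1, w2, v; split=> //; apply: Rl_lt lt _.
Qed.

Lemma code_of_lt w a b : code w -> olt a (ot w) -> olt b a -> exists w', codeof a w'.
Proof.
move=> cw /otP[k ->] ba; have [w' [cw' ew']] := restrict_code cw ba.
by exists w'.
Qed.

(** If no level lay above [w0], every blocking pair would belong to a stage at or below [w0]. There
    are countably many such pairs and each blocks at most one stage, so a reflecting stage beyond
    all blocked ones would be a level. *)
Lemma level_unbounded w0 : code w0 ->
  exists w, [/\ code w, olt (ot w0) (ot w) & levX (ot w)].
Proof.
move=> c0; apply: contrapT => nw.
have nlev w : code w -> olt (ot w0) (ot w) -> ~ levX (ot w).
  by move=> cw lt lw; apply: nw; exists w.
have [w1 [c1 w01 _]] := code_above2 c0 c0; have o1 := Ord_ot c1.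
(* [c i] codes the stage blocked by the pair that [i] names in [w1], if that stage has a code;
   otherwise it is [w0]. *)
have /choice[c cP] : forall i : nat * nat, exists w, code w /\ ((exists w', code w' /\
    @blocks XS InX (ph w1 i.1) (rl w1 i.2) (ot w')) ->
    @blocks XS InX (ph w1 i.1) (rl w1 i.2) (ot w)).
  move=> i; have [[w' [cw' bw']]|nh] := pselect (exists w', code w' /\
    @blocks XS InX (ph w1 i.1) (rl w1 i.2) (ot w')); first by exists w'.
  by exists w0.
have [||w2 [c2 b2]] := @code_bound _ c; [exact: ctbl_count|by move=> i; have [] := cP i|].
have [w3 [c3 w13 w23]] := code_above2 c1 c2.
have [w [cw w3w rw]] := reflect_unbounded c3; have ow := Ord_ot cw.
have lt w' : olt (ot w') (ot w3) -> olt (ot w') (ot w) by move=> h; apply: olt_trans h w3w.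
have lt0 : olt (ot w0) (ot w) by apply: olt_trans w01 (lt _ w13).
apply: (nlev w cw lt0); apply: levX_intro => // -[b [x blk]].
have [/= bw Rx ix _ _] := blk; have ob := Ord_lt ow bw.
(* The blocking pair was put in, so its stage is a level and cannot lie above [w0]; it is therefore
   named in [w1]. *)
have b1 : olt b (ot w1).
  have [b0|->//|b0] := Ord_trich ob (Ord_ot c0); first exact: olt_trans b0 w01.
  have [w' [cw' ew']] := code_of_lt cw bw b0.
  by case: (nlev w'); rewrite // ew' //; apply: InX_lev ix.
move: b1 Rx blk => /otP[a ->] /(RphP c1)[k _ ->] blk.
have [cc /(_ (ex_intro _ w (conj cw blk))) blk'] := cP (a, k).
have e := blocks_uniq (Ord_ot cc) ow blk' blk.
have := lt _ w23; have := b2 (a, k); rewrite e => h h'.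
exact: (@olt_irr (ot w)) (olt_trans ow h h').
Qed.

Lemma next_level (W : nat -> bits) : (forall i, code (W i)) ->
  exists w, [/\ code w, levX (ot w), forall i, olt (ot (W i)) (ot w) &
    forall b, olt b (ot w) -> levX b -> ~ (forall i, olt (ot (W i)) b)].
Proof.
move=> cW; have [w0 [c0 b0]] := code_bound ctbl_nat cW.
have [w1 [c1 w01 l1]] := level_unbounded c0.
pose P a := [/\ exists w, codeof a w, levX a & forall i, olt (ot (W i)) a].
have : P (ot w1).
  split=> // [|i]; first by exists w1.
  by apply: olt_trans (b0 i) w01; apply: Ord_ot.
move: (ot w1) => a; elim: (olt_wf a) => {}a _ IH Pa.
have [[b [ba Pb]]|nb] := pselect (exists b, olt b a /\ P b); first exact: IH ba Pb.
move: Pa => [[w [cw ew]] la lW]; exists w; rewrite ew; split=> // b ba lb Wb.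
apply: nb; exists b; split=> //; split=> //; rewrite -ew in ba.
exact: code_of_lt cw ba (Wb 0%N).
Qed.

(** Type 0 occurs at the first level above an increasing sequence of levels, below which no level is
    last; the first level after one of type [n] has type [n.+1]. *)
Lemma type_unbounded n w0 : code w0 ->
  exists w, [/\ code w, olt (ot w0) (ot w) & TyX (ot w) n].
Proof.
elim: n w0 => [|n IH] w0 c0.
  have /choice[g gP] : forall w, exists w', code w ->
      [/\ code w', olt (ot w) (ot w') & levX (ot w')].
    move=> w; have [cw|] := pselect (code w); last by exists w.
    by have [w' ?] := level_unbounded cw; exists w'.
  pose W i := iter i g w0.
  have cW i : code (W i).
    by elim: i => [|i IH]; [exact: c0|case: (gP _ IH) => + _ _; exact].
  have [w [cw [m /TyXE[rw nb _]] Ww minw]] := next_level cW; have ow := Ord_ot cw.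
  exists w; split=> //; first exact: (Ww 0%N).
  apply/TyXE; split=> // b /= bw lb.
  have /existsNP[i nbi] := minw b bw lb.
  have [_ inc lW] := gP _ (cW i).
  exists (ot (W i.+1)); split; [|exact: (Ww i.+1)|exact: lW].
  have [h|->|h] := Ord_trich (Ord_lt ow bw) (Ord_ot (cW i)).
  - exact: olt_trans (Ord_ot (cW i.+1)) h inc.
  - exact: inc.
  - by case: nbi.
have [w1 [c1 w01 T1]] := IH w0 c0.
have [w [cw [m /TyXE[rw nb _]] /(_ 0%N) ww minw]] := next_level (fun=> c1).
exists w; split=> //; first by apply: olt_trans w01 ww; apply: Ord_ot.
apply/TyXE; split=> //; exists (ot w1); split=> // b wb bw lb.
by apply: (minw b).
Qed.

Lemma stage_ex n x : exists w, [/\ code w, TyX (ot w) n & Rl (ot w) x].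
Proof.
have [w0 [c0 R0]] := real_in_code VL x.
have [w [cw lt T]] := type_unbounded n c0; exists w; split=> //.
exact: Rl_lt (Ord_ot cw) lt R0.
Qed.

(** The last hypothesis on [G] gives a tree for its graph; this tree and [b] are combined in one
    real [x], placed at a stage of type [n] that contains it. The reduction then contradicts the
    rules of the recursion at that stage. *)
Lemma diagonal n (b : nat -> Prop) (G : bits -> nat -> bits -> Prop) :
  ~ b n ->
  (forall p m q m' q', G p m q -> G p m' q' -> m = m' /\ q = q') ->
  Sig (fun e => exists m, p1 (p2 e) = natb m /\ G (p1 e) m (p2 (p2 e))) ->
  ~ (forall p, piece n p <-> exists m q, [/\ b m, piece m q & G p m q]).
Proof.
move=> nbn Gf /Sig_branch[c cP] red.
have GE p m q : G p m q <-> exists v, branch c (tri p m q) v.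
  rewrite -cP /tri !p2E !p1E; split=> [h|[m' [/natb_inj -> //]]].
  by exists m.
pose x := glue (fun i => if i == 0%N then c else fun k => `[< b k >]).
have xb m : bsx x m <-> b m by rewrite /bsx secE; split=> /asboolP.
have xF p m q v : Fw x p m q v = branch c (tri p m q) v by rewrite /Fw secE.
have HG a d m y w1 w2 : codeof a w1 -> codeof d w2 ->
    G (cpair x w1) m (cpair y w2) -> Hx a x d m y.
  by move=> h1 h2 /GE[v hv]; exists w1, w2, v; split=> //; split=> //; rewrite xF.
have [w [cw Tw Rw]] := stage_ex n x; set al := ot w in Tw Rw; have ow := Ord_ot cw.
(* If [x] had been left out, it would hit an earlier point of the pieces in [b]. By [red] the source
   of that hit lies in the piece, so [x] was put in after all. *)
have [inx|] := pselect (InX al x); last first.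
  move=> nin; apply: nin; apply/InXE; split=> //; first by exists n; apply/TyXE.
  move=> d m y da Td Ry iy /xb bm [w1 [w2 [v [[c1 e1] [[c2 e2] hF]]]]].
  rewrite xF in hF.
  have /red/pieceE[_ _] : exists m q, [/\ b m, piece m q & G (cpair x w1) m q].
    exists m, (cpair y w2); split; [exact: bm| |by apply/GE; exists v].
    by apply/pieceE; rewrite e2; split; [exact: c2|exact: Td|exact: iy].
  rewrite e1 => /InXE[_ _ /(_ d m y da Td Ry iy)]; apply; first exact/xb.
  by exists w1, w2, v; split=> //; split=> //; rewrite xF.
have pin w1 : codeof al w1 -> piece n (cpair x w1).
  by move=> [c1 e1]; apply/pieceE; rewrite e1.
(* The value cannot stay at the stage [al], since a stage has one type and [n] is not in [b], nor
   fall below it, since [x] avoids earlier points. *)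
have out w1 m q : codeof al w1 -> G (cpair x w1) m q -> piece m q -> b m ->
    olt al (ot (p2 q)).
  move=> c1 Gq [cq Tq iq] bm; have oq := Ord_ot cq.
  have [//|e|lt] := Ord_trich ow oq.
    by rewrite -e in Tq; case: nbn; rewrite (TyX_uniq ow Tw Tq).
  have [_ _ /(_ _ _ _ lt Tq (InX_R iq) iq)] := (InXE _ _).1 inx.
  case; first exact/xb.
  by apply: (HG _ _ _ _ w1 (p2 q)) => //; rewrite cpairK.
have get w1 : codeof al w1 -> exists m q, [/\ b m, piece m q & G (cpair x w1) m q].
  by move=> h; apply/red; apply: pin.
(* The least stage hit above [al] is blocked by the pair of [al] and [x]. But [G] is functional, so
   the point hit there is the one given by [red], which belongs to a piece; its stage would be
   unblocked. *)
pose P d := olt al d /\ @hits XS al x d.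
have [d [[ald hd] mind]] : exists d, P d /\ forall d', olt d' d -> ~ P d'.
  have [m [q [bm mq Gq]]] := get w (conj cw erefl).
  have : P (ot (p2 q)).
    split; first exact: out Gq mq bm.
    exists m, (p1 q); split; first by have [_ _ /InX_R] := mq.
    have [cq _ _] := mq.
    by apply: (HG _ _ _ _ w (p2 q)) => //; rewrite cpairK.
  move: (ot (p2 q)) => d; elim: (olt_wf d) => {}d _ IH Pd.
  have [[d' [dd' Pd']]|nd] := pselect (exists d', olt d' d /\ P d').
    exact: IH dd' Pd'.
  by exists d; split=> // d' dd' Pd'; apply: nd; exists d'.
have [m [y [Ry [w1 [w2 [v [c1 [[c2 e2] hF]]]]]]]] := hd.
have Gq : G (cpair x w1) m (cpair y w2) by apply/GE; exists v; rewrite -xF.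
have [m' [q [bm mq Gq']]] := get w1 c1.
have [em eq] := Gf _ _ _ _ _ Gq Gq'; move: mq; rewrite -em -eq => /pieceE[_ + _].
rewrite e2 => /TyXE[_ nb _]; apply: nb; exists al, x; split=> // d' ald' dd' hd'.
by apply: (mind d' dd').
Qed.

End unbounded.

(** * Recognising stages by bisimulation *)

Definition bisim_at (r r' B : nat -> nat -> Prop) j b :=
  (forall j', r j' j -> exists b', r' b' b /\ B j' b') /\
  (forall b', r' b' b -> exists j', r j' j /\ B j' b').

Definition bisim_total (dom : nat -> Prop) (B : nat -> nat -> Prop) :=
  (forall j, exists b, dom b /\ B j b) /\ (forall b, dom b -> exists j, B j b).

Section bisimulation.
Context (r r' B : nat -> nat -> Prop) (wr' : well_founded r').
Hypothesis bisB : forall j b, B j b -> bisim_at r r' B j b.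

Lemma bisim_acc j b : B j b -> Acc r j.
Proof.
elim: (wr' b) j => {}b _ IH j /bisB[h _]; constructor => j' /h[b' [bb' jb']].
exact: IH bb' _ jb'.
Qed.

Lemma bisim_veq j b : well_founded r -> B j b -> veq (col r j) (col r' b).
Proof.
move=> wr; elim: (wr' b) j => {}b _ IH j /bisB[h1 h2].
apply/veqP => y; rewrite (colP wr) (colP wr'); split=> [[j' jj' yj]|[b' bb' yb]].
  have [b' [bb' jb']] := h1 _ jj'; exists b' => //.
  exact: veq_trans yj (IH _ bb' _ jb').
have [j' [jj' jb']] := h2 _ bb'; exists j' => //.
exact: veq_trans yb (veq_sym (IH _ bb' _ jb')).
Qed.

End bisimulation.

Lemma veq_bisim r r' : well_founded r -> well_founded r' ->
  forall j b, veq (col r j) (col r' b) ->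
  bisim_at r r' (fun j b => veq (col r j) (col r' b)) j b.
Proof.
move=> wr wr' j b /veqP e; split=> [j' jj'|b' bb'].
  have /e/(colP wr')[b' bb' h] : vin (col r j') (col r j).
    by apply/(colP wr); exists j' => //; apply: veq_refl.
  by exists b'.
have /e/(colP wr)[j' jj' h] : vin (col r' b') (col r' b).
  by apply/(colP wr'); exists b' => //; apply: veq_refl.
by exists j'; split=> //; apply: veq_sym.
Qed.

Lemma bisim_max r r' B : well_founded r -> well_founded r' ->
  (forall j b, B j b <-> bisim_at r r' B j b) ->
  forall j b, B j b <-> veq (col r j) (col r' b).
Proof.
move=> wr wr' eqB j b; split=> [|].
  by apply: bisim_veq => // ? ? /eqB.
elim: (wr' b) j => {}b _ IH j jb; apply/eqB.
have [h1 h2] := veq_bisim wr wr' jb; split=> [j' /h1[b' [bb' e]]|b' bb'].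
  by exists b'; split=> //; apply: IH.
by have [j' [jj' e]] := h2 _ bb'; exists j'; split=> //; apply: IH.
Qed.

(** The union of all bisimulations is a solution for arbitrary relations. This generality matters
    because it is applied to every real named in a code, well-founded or not. *)
Lemma bisim_solution r r' : exists B, forall j b, B j b <-> bisim_at r r' B j b.
Proof.
exists (fun j b => exists2 B : nat -> nat -> Prop,
  (forall j b, B j b -> bisim_at r r' B j b) & B j b) => j b; split.
  move=> [B bB /bB[h1 h2]]; split=> [j' /h1|b' /h2].
    by move=> [b' [bb' Bj]]; exists b'; split=> //; exists B.
  by move=> [j' [jj' Bj]]; exists j'; split=> //; exists B.
set G := (X in bisim_at r r' X) => -[h1 h2].
have GG j' b' : G j' b' -> bisim_at r r' G j' b'.
  move=> [B bB /bB[k1 k2]]; split=> [j'' /k1|b'' /k2].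
    by move=> [b'' [bb' Bj]]; exists b''; split=> //; exists B.
  by move=> [j'' [jj' Bj]]; exists j''; split=> //; exists B.
exists (fun j' b' => (j' = j /\ b' = b) \/ G j' b'); last by left.
move=> j' b' [[-> ->]|/GG[k1 k2]].
  split=> [j'' /h1|b'' /h2].
    by move=> [b'' [bb Gj]]; exists b''; split=> //; right.
  by move=> [j'' [jj Gj]]; exists j''; split=> //; right.
split=> [j'' /k1|b'' /k2].
  by move=> [b'' [bb Gj]]; exists b''; split=> //; right.
by move=> [j'' [jj Gj]]; exists j''; split=> //; right.
Qed.

(** [None] stands for the stage coded by [w], which has no name in [w]. *)
Definition dom w (a : option nat) b := if a is Some a' then cLt w b a' else True.
Definition qn w (a : option nat) := if a is Some a' then ph w a' else ot w.

Definition qv w (a : option nat) := if a is Some a' then col (cLt w) a' else Vset (col (cLt w)).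

Lemma qnE w a : qn w a = rep (qv w a). Proof. by case: a. Qed.

Lemma qvP w a y : code w -> vin y (qv w a) <-> exists2 b, dom w a b & veq y (col (cLt w) b).
Proof.
move=> /code_wf wf.
case: a => [a|] /=; first exact: colP.
by split=> [[b yb]|[b _ yb]]; exists b.
Qed.

(** Accessibility passes from [w] to [w'] along the bisimulation, so well-foundedness of [w'] comes
    for free. Relative to a code [w], the coanalytic condition of coding a given stage thus acquires
    an analytic form. *)
Lemma codeof_bisim w a w' (B : nat -> nat -> Prop) : code w -> Lcode w' ->
  (forall j b, B j b -> bisim_at (cLt w') (cLt w) B j b) ->
  bisim_total (dom w a) B -> codeof (qn w a) w'.
Proof.
move=> cw Lw' bB [t1 t2].
have wf := code_wf cw.
have wf' : well_founded (cLt w').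
  by move=> j; have [b [_ jb]] := t1 j; apply: bisim_acc jb.
split; first exact: codeI.
rewrite qnE; apply: eq_rep; apply/veqP => y; rewrite (qvP a y cw).
split=> [[/= j yj]|[b db yb]].
  have [b [db jb]] := t1 j; exists b => //; apply: veq_trans yj _.
  exact: bisim_veq jb.
have [j jb] := t2 b db; exists j => /=; apply: veq_trans yb _; apply: veq_sym.
exact: bisim_veq jb.
Qed.

Lemma bisim_codeof w a w' : code w -> codeof (qn w a) w' ->
  [/\ Lcode w', well_founded (cLt w') &
  bisim_total (dom w a) (fun j b => veq (col (cLt w') j) (col (cLt w) b))].
Proof.
move=> cw [cw']; have L' := code_Lcode cw'; have wf' := code_wf cw'.
rewrite qnE => /rep_inj/veqP e; split=> //; split=> [j|b db].
  have /e/(qvP a _ cw)[b db jb] : vin (col (cLt w') j) (Vset (col (cLt w'))).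
    exact: (@vin_elt (Vset (col (cLt w')))).
  by exists b.
have /e[/= j bj] : vin (col (cLt w) b) (qv w a).
  by apply/(qvP a _ cw); exists b => //; apply: veq_refl.
by exists j; apply: veq_sym.
Qed.

Lemma Del_bisim_at (r r' B : bits -> nat -> nat -> Prop) j b :
  (forall a c, Del (fun e => r e a c)) -> (forall a c, Del (fun e => r' e a c)) ->
  (forall a c, Del (fun e => B e a c)) ->
  Del (fun e => bisim_at (r e) (r' e) (B e) j b).
Proof.
move=> dr dr' dB; apply: Del_and; (apply: Del_all => [|x]; first delq);
  apply: Del_imp => //; (apply: Del_ex => [|y]; first delq); exact: Del_and.
Qed.

Lemma Del_dom w a b : Bm w -> Del (fun e => dom (w e) a b).
Proof. by move=> bw; case: a => [a|] /=; [apply: Del_rel|apply: Del_cst]. Qed.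

Lemma Del_bisim_total (w : bits -> bits) a (B : bits -> nat -> nat -> Prop) : Bm w ->
  (forall j b, Del (fun e => B e j b)) ->
  Del (fun e => bisim_total (dom (w e) a) (B e)).
Proof.
move=> bw dB; apply: Del_and.
  apply: Del_all => [|j]; first delq.
  apply: Del_ex => [|b]; first delq.
  by apply: Del_and => //; apply: Del_dom.
apply: Del_all => [|b]; first delq.
apply: Del_imp; first exact: Del_dom.
by apply: Del_ex => [|j]; first delq.
Qed.

Definition Cdw w a w' (B : nat -> nat -> Prop) :=
  Lcode w' /\ (forall j b, B j b -> bisim_at (cLt w') (cLt w) B j b) /\
  bisim_total (dom w a) B.

Lemma Cdw_codeof w a w' B : code w -> Cdw w a w' B -> codeof (qn w a) w'.
Proof. by move=> cw [L [bB tB]]; apply: codeof_bisim tB. Qed.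

Lemma codeof_Cdw w a w' : code w -> codeof (qn w a) w' -> exists B, Cdw w a w' (rel 0 B).
Proof.
move=> cw h; have [L' wf' tB] := bisim_codeof cw h.
have wf := code_wf cw.
set V := (fun j b => _) in tB.
exists (mkrel V V V).
have -> : rel 0 (mkrel V V V) = V.
  by apply/funext => j; apply/funext => b; apply/propext; rewrite mkrelE.
split; first exact: L'.
by split; [apply: veq_bisim|exact: tB].
Qed.

(** [Hx] with each [codeof] certified by a bisimulation. The five witnesses are columns of one real
    and their relation is bi-analytic, so [Hn] is analytic in [w]. *)
Definition Hn w a x b m y := exists z : bits,
  Cdw w a (sec 0 z) (rel 0 (sec 1 z)) /\ Cdw w b (sec 2 z) (rel 0 (sec 3 z)) /\
  Fw x (cpair x (sec 0 z)) m (cpair y (sec 2 z)) (sec 4 z).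

Lemma HnP w a x b m y : code w -> Hn w a x b m y <-> Hx (qn w a) x (qn w b) m y.
Proof.
move=> cw; split=> [[z [h1 [h2 h3]]]|[w1 [w2 [v [h1 [h2 h3]]]]]].
  exists (sec 0 z), (sec 2 z), (sec 4 z).
  by split; [exact: Cdw_codeof h1|split; [exact: Cdw_codeof h2|exact: h3]].
have [B1 hB1] := codeof_Cdw cw h1; have [B2 hB2] := codeof_Cdw cw h2.
exists (glue (fun i => nth v [:: w1; B1; w2; B2] i)); rewrite !secE /=.
by split; [exact: hB1|split; [exact: hB2|exact: h3]].
Qed.

Lemma Del_Cdw w a w' B : Bm w -> Bm w' -> Bm B ->
  Del (fun e => Cdw (w e) a (w' e) (rel 0 (B e))).
Proof.
move=> bw bw' bB; apply: Del_and; first exact: Del_Lcode.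
apply: Del_and; last by apply: Del_bisim_total => // j b; apply: Del_rel.
apply: Del_all => [|j]; first delq.
apply: Del_all => [|b]; first delq.
apply: Del_imp; first exact: Del_rel.
by apply: Del_bisim_at => *; apply: Del_rel.
Qed.

Lemma Bm_tri p m q : Bm p -> Bm q -> Bm (fun e => tri (p e) m (q e)).
Proof. by move=> bp bq; apply: Bm_pair => //; apply: Bm_pair => //; apply: Bm_cst. Qed.

Lemma Del_Fw x p m q v : Bm x -> Bm p -> Bm q -> Bm v ->
  Del (fun e => Fw (x e) (p e) m (q e) (v e)).
Proof. by move=> *; apply: Del_branch => //; [bm|apply: Bm_tri]. Qed.

Lemma Sig_Hn w a x b m y : Bm w -> Bm x -> Bm y ->
  Sig (fun e => Hn (w e) a (x e) b m (y e)).
Proof.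
move=> bw bx by_.
apply: (@Sig_exb (fun e z => Cdw (w e) a (sec 0 z) (rel 0 (sec 1 z)) /\
  Cdw (w e) b (sec 2 z) (rel 0 (sec 3 z)) /\
  Fw (x e) (cpair (x e) (sec 0 z)) m (cpair (y e) (sec 2 z)) (sec 4 z))).
have h f : Bm f -> Bm (fun e => f (p1 e)) by move=> bf; apply: Bm_comp bf (Bm_p1 Bm_id).
have := h _ bw; have := h _ bx; have := h _ by_ => ? ? ?.
apply: Del_Sig; apply: Del_and; first by apply: Del_Cdw; bm.
by apply: Del_and; [apply: Del_Cdw|apply: Del_Fw]; bm.
Qed.

(* [B i] compares the stages of the real named [i], read as a code, with those of
   [w]; it is determined by [w], so that codes among the reals named in [w] are
   recognised by a Borel condition on [w] and [B]. *)

Definition bis_ok w (B : nat -> nat -> Prop) := forall i j b,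
  B i (pickle (j, b)) <->
  bisim_at (cLt (rl w i)) (cLt w) (fun j b => B i (pickle (j, b))) j b.

Definition codeat w B i a :=
  Lcode (rl w i) /\ bisim_total (dom w (Some a)) (fun j b => B i (pickle (j, b))).

Lemma codeatP w B i a : code w -> bis_ok w B ->
  codeat w B i a <-> codeof (ph w a) (rl w i).
Proof.
move=> cw okB; split=> [[Lw tB]|h].
  by apply: (@codeof_bisim w (Some a)) tB => // j b /okB.
have [L' wf' [t1 t2]] := @bisim_codeof w (Some a) _ cw h.
have wf := code_wf cw.
have e := bisim_max wf' wf (okB i).
split; first exact: L'.
split=> [j|b db]; first by have [b [db jb]] := t1 j; exists b; split=> //; apply/e.
by have [j jb] := t2 b db; exists j; apply/e.
Qed.

Definition Vw w B a k b m k' i1 i2 i3 :=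
  codeat w B i1 a /\ codeat w B i2 b /\
  Fw (rl w k) (cpair (rl w k) (rl w i1)) m (cpair (rl w k') (rl w i2)) (rl w i3).

Definition VH w B a k b m k' := exists i1 i2 i3, Vw w B a k b m k' i1 i2 i3.

Lemma VwP w B a k b m k' i1 i2 i3 : code w -> bis_ok w B ->
  Vw w B a k b m k' i1 i2 i3 <->
  Hw (ph w a) (rl w k) (ph w b) m (rl w k') (rl w i1) (rl w i2) (rl w i3).
Proof. by move=> cw okB; rewrite /Vw !codeatP. Qed.

Lemma VHP w B a k b m k' : code w -> bis_ok w B ->
  VH w B a k b m k' <-> visx (ot w) (ph w a) (rl w k) (ph w b) m (rl w k').
Proof.
move=> cw okB; split=> [[i1 [i2 [i3 /(VwP _ _ _ _ _ _ _ _ cw okB) h]]]|].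
  by exists (rl w i1), (rl w i2), (rl w i3); split=> //; apply/(RotP cw); eexists.
move=> [w1 [w2 [v [/(RotP cw)[i1 ->] /(RotP cw)[i2 ->] /(RotP cw)[i3 ->] h]]]].
by exists i1, i2, i3; apply/VwP.
Qed.

(** * The recursion read off a code *)

Definition Rn w a k := exists k', cU w a k' /\ forall j, rl w k' j = rl w k j.

Lemma RnP w a k : code w -> Rn w a k <-> Rl (ph w a) (rl w k).
Proof.
move=> cw; rewrite (RphP cw); split=> [[k' [Uk e]]|[k' Uk e]].
  by exists k' => //; apply/funext => j; rewrite e.
by exists k'; split=> // j; rewrite e.
Qed.

Definition rfn w B a := forall a' b' k m k', cLt w a' a -> cLt w b' a ->
  Rn w a' k -> Rn w b' k' -> VH w B a' k b' m k' ->
  exists i1 i2 i3, Rn w a i1 /\ Rn w a i2 /\ Rn w a i3 /\ Vw w B a' k b' m k' i1 i2 i3.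

Definition NS w B : hsys := @HSys nat nat (cLt w) (Rn w) (VH w B) (rfn w B)
  (fun k n => bsx (rl w k) n).

Definition tlt w (b c : option nat) : Prop :=
  match b, c with
  | Some b', Some c' => cLt w b' c'
  | Some _, None => True
  | _, _ => False
  end.

Definition tR w (a : option nat) k : Prop := if a is Some a' then Rn w a' k else True.

(** Between named stages the relation is read off the table; as soon as the top stage takes part,
    its codes may lie outside L_al and the analytic form is kept. *)
Definition tH w B (a : option nat) k (b : option nat) m k' : Prop :=
  match a, b with
  | Some a', Some b' => VH w B a' k b' m k'
  | _, _ => Hn w a (rl w k) b m (rl w k')
  end.

Definition trf w B := forall a b k m k', Rn w a k -> Rn w b k' ->
  Hn w (Some a) (rl w k) (Some b) m (rl w k') -> VH w B a k b m k'.

Definition OS w B : hsys := @HSys (option nat) nat (tlt w) (tR w) (tH w B)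
  (fun=> trf w B) (fun k n => bsx (rl w k) n).

Definition ext_top (D : nat -> nat -> Prop) (a : option nat) n : Prop :=
  if a is Some a' then D a' n else False.

(** Column 0 of [Y] is the table of bisimulations, columns 1 and 2 tabulate types and membership
    below the top. *)
Definition corr w Y := bis_ok w (rel 0 Y) /\
  @solves (NS w (rel 0 Y)) (rel 1 Y) (rel 2 Y).

Definition top_ok n k w Y :=
  @TyR (OS w (rel 0 Y)) (ext_top (rel 1 Y)) (ext_top (rel 2 Y)) None n /\
  @avoids (OS w (rel 0 Y)) (ext_top (rel 1 Y)) (ext_top (rel 2 Y)) None k.

Section correctness.
Context (w : bits) (cw : code w) (B : nat -> nat -> Prop) (okB : bis_ok w B).
Let ow := Ord_ot cw.

(** Placed before reflection is assumed: this is the test by which a code detects whether its own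
    stage reflects, and only then may [VH] be identified with [Hx]. *)
Lemma trfP : trf w B <-> rfx (ot w).
Proof.
split=> [h a b x m y /otP[a' ->] /otP[b' ->]|h a b k m k' Ra Rb /(HnP _ _ _ _ _ cw) H].
  move=> Rx Ry H; have /(RphP cw)[k _ ek] := Rx; have /(RphP cw)[k' _ ek'] := Ry.
  rewrite ek ek' in Rx Ry H *; apply/(VHP a' k b' m k' cw okB).
  by apply: h; [apply/RnP|apply/RnP|apply/HnP].
apply/(VHP _ _ _ _ _ cw okB); apply: h => //; [exact: ph_ot|exact: ph_ot|exact/RnP|exact/RnP].
Qed.

Hypothesis rw : rfx (ot w).

Lemma VH_Hx a k b m k' : Rn w a k -> Rn w b k' ->
  VH w B a k b m k' <-> Hx (ph w a) (rl w k) (ph w b) m (rl w k').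
Proof.
move=> Ra Rb; rewrite (VHP _ _ _ _ _ cw okB); split=> [[w1 [w2 [v [_ _ _ h]]]]|h].
  by exists w1, w2, v.
by apply: rw => //; [exact: ph_ot|exact: ph_ot|exact/RnP|exact/RnP].
Qed.

Let ph_on a be : olt be (ph w a) -> exists b, ph w b = be.
Proof.
move=> h; have /otP[b ->] : olt be (ot w) by apply: olt_trans h (ph_ot w a).
by exists b.
Qed.

Lemma NS_morph : @hmorph (NS w B) XS (ph w) (rl w).
Proof.
split=> /=.
- by move=> b c; apply: cLtP.
- exact: ph_on.
- by move=> b k; apply: RnP.
- by move=> b x /(RphP cw)[k _ ->]; exists k.
- by move=> b c k m k' _; apply: VH_Hx.
- by [].
Qed.

Lemma rfnP a : rfn w B a <-> rfx (ph w a).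
Proof.
split=> [h a0 b0 x m y aa ba Rx Ry H|h a' b' k m k' /(cLtP cw) aa /(cLtP cw) ba Rk Rk'].
  have [a' ea] := ph_on aa; have [b' eb] := ph_on ba; subst a0 b0.
  have /(RphP cw)[k _ ek] := Rx; have /(RphP cw)[k' _ ek'] := Ry.
  rewrite ek ek' in Rx Ry H *.
  have Rk : Rn w a' k by apply/RnP.
  have Rk' : Rn w b' k' by apply/RnP.
  have [||i1 [i2 [i3 [R1 [R2 [R3 hV]]]]]] := h a' b' k m k' _ _ Rk Rk' ((VH_Hx m Rk Rk').2 H).
  - exact/cLtP.
  - exact/cLtP.
  exists (rl w i1), (rl w i2), (rl w i3).
  by split; [exact/RnP|exact/RnP|exact/RnP|exact/(VwP _ _ _ _ _ _ _ _ cw okB)].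
move=> /(VH_Hx m Rk Rk')/(h _ _ _ _ _ aa ba ((RnP _ _ cw).1 Rk) ((RnP _ _ cw).1 Rk')).
move=> [w1 [w2 [v [R1 R2 R3 hV]]]].
have /(RphP cw)[i1 _ e1] := R1; have /(RphP cw)[i2 _ e2] := R2.
have /(RphP cw)[i3 _ e3] := R3; rewrite e1 e2 e3 in R1 R2 R3 hV.
exists i1, i2, i3; do 3 (split; first exact/RnP).
exact/(VwP _ _ _ _ _ _ _ _ cw okB).
Qed.

Lemma OS_morph : @hmorph (OS w B) XS (qn w) (rl w).
Proof.
split=> /=.
- case=> [b|] [c|] /=.
  + exact: cLtP.
  + by split=> // _; apply: ph_ot.
  + by split=> // h; case: (@olt_irr (ot w)); apply: olt_trans h (ph_ot w c).
  + by split=> // /olt_irr.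
- case=> [a|] be /=; first by move=> /ph_on[b <-]; exists (Some b).
  by move=> /otP[b ->]; exists (Some b).
- case=> [b|] k /=; first exact: RnP.
  by split=> // _; apply/(RotP cw); exists k.
- case=> [b|] x /=; first by move=> /(RphP cw)[k _ ->]; exists k.
  by move=> /(RotP cw)[k ->]; exists k.
- case=> [b|] [c|] k m k' _ /= Rk Rk'; last 3 first.
  + exact: (HnP (Some b)).
  + exact: (HnP None _ (Some c)).
  + exact: (HnP None _ None).
  exact: VH_Hx.
- by [].
Qed.

End correctness.

Lemma corr_ex w : exists Y, corr w Y \/ ~ code w.
Proof.
have [cw|ncw] := pselect (code w); last by exists w; right.
have wf := code_wf cw.
have /choice[B0 B0P] := fun i => bisim_solution (cLt (rl w i)) (cLt w).
pose B i k := if unpickle k is Some (j, b) then B0 i j b else False.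
have BE i : (fun j b => B i (pickle (j, b))) = B0 i.
  by apply/funext => j; apply/funext => b; rewrite /B pickleK.
have [Ty [Inn so]] := @solves_ex (NS w B) wf.
exists (mkrel B Ty Inn); left.
have relE i : rel i (mkrel B Ty Inn) = nth Inn [:: B; Ty] i.
  by apply/funext => a; apply/funext => b; apply/propext; rewrite mkrelE.
split; last by rewrite !relE.
move=> i j b; rewrite relE /= BE -B0P.
by rewrite -(BE i).
Qed.

(** Every code has a correct table, and on a reflecting stage each correct table has the true
    values. Since [top_ok] includes reflection, asking it of all correct tables amounts to asking it
    of one, and gives the coanalytic form. *)
Lemma pieceP n p : piece n p <-> code (p2 p) /\ exists k,
  (forall j, rl (p2 p) k j = p1 p j) /\ forall Y, corr (p2 p) Y -> top_ok n k (p2 p) Y.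
Proof.
set w := p2 p; set x := p1 p.
have main k Y : code w -> rfx (ot w) -> corr w Y ->
    (@TyR (OS w (rel 0 Y)) (ext_top (rel 1 Y)) (ext_top (rel 2 Y)) None n <-> TyX (ot w) n) /\
    (@avoids (OS w (rel 0 Y)) (ext_top (rel 1 Y)) (ext_top (rel 2 Y)) None k <->
     @avoids XS TyX InX (ot w) (rl w k)).
  move=> cw rw [okB so].
  have wf := code_wf cw.
  have tab := solves_transfer (NS_morph cw okB rw) wf (rfnP cw okB rw) so XsolvesP.
  have tab' (b : option nat) : tlt w b None ->
      (forall n, ext_top (rel 1 Y) b n <-> TyX (qn w b) n) /\
      (forall k, tR w b k -> ext_top (rel 2 Y) b k <-> InX (qn w b) (rl w k)).
    by case: b => [b|//] _; apply: tab.
  have OM := OS_morph cw okB rw; split.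
    rewrite TyXE.
    exact: (@TyR_transfer (OS w (rel 0 Y)) XS _ _ OM _ _ TyX InX None (trfP cw okB) tab').
  exact: (@avoids_transfer (OS w (rel 0 Y)) XS _ _ OM _ _ TyX InX None tab').
split=> [[cw Tw iw]|[cw [k [kx H]]]].
  split=> //; have /(RotP cw)[k ek] := InX_R iw.
  exists k; split=> [j|Y cY]; first by rewrite -ek.
  have [rw _ _] := (TyXE _ _).1 Tw.
  have [h1 h2] := main k Y cw rw cY; split; first exact/h1.
  by apply/h2; rewrite -ek; have [] := (InXE _ _).1 iw.
have [Y [cY|//]] := corr_ex w.
have [T av] := H Y cY.
have rw : rfx (ot w) by case: T => rf _ _; apply: (trfP cw cY.1).1 rf.
have [h1 h2] := main k Y cw rw cY.
have xk : x = rl w k by apply/funext => j; rewrite kx.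
have Tw : TyX (ot w) n by apply/h1.
split=> //; apply/InXE; split; first by exists n; apply/TyXE.
  by apply/(RotP cw); exists k.
by have -> : p1 p = rl w k := xk; apply/h2.
Qed.

(** * Complexity of the pieces *)

Lemma Del_and3 A B D : Del A -> Del B -> Del D -> Del (fun x => [/\ A x, B x & D x]).
Proof.
move=> a b d; apply: eq_Del (Del_and a (Del_and b d)) => x.
by split=> [[? []]|[]].
Qed.

Lemma Del_and5 A B D E F : Del A -> Del B -> Del D -> Del E -> Del F ->
  Del (fun x => [/\ A x, B x, D x, E x & F x]).
Proof.
move=> a b d e f.
apply: eq_Del (Del_and a (Del_and b (Del_and d (Del_and e f)))) => x.
by split=> [[? [? [? []]]]|[]].
Qed.

Lemma Sig_and5 A B D E F : Sig A -> Sig B -> Sig D -> Sig E -> Sig F ->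
  Sig (fun x => [/\ A x, B x, D x, E x & F x]).
Proof.
move=> a b d e f.
apply: eq_Sig (Sig_and a (Sig_and b (Sig_and d (Sig_and e f)))) => x.
by split=> [[? [? [? []]]]|[]].
Qed.

Section Del_operators.
Context (lt R : bits -> nat -> nat -> Prop) (H : bits -> nat -> nat -> nat -> nat -> nat -> Prop).
Context (rf : bits -> nat -> Prop) (bs Ty Inn : bits -> nat -> nat -> Prop).
Hypotheses (dlt : forall a b, Del (fun e => lt e a b)) (dR : forall a b, Del (fun e => R e a b))
  (dH : forall a k b m k', Del (fun e => H e a k b m k')) (drf : forall a, Del (fun e => rf e a))
  (dbs : forall a b, Del (fun e => bs e a b)) (dTy : forall a b, Del (fun e => Ty e a b))
  (dInn : forall a b, Del (fun e => Inn e a b)).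
Let S e := @HSys nat nat (lt e) (R e) (H e) (rf e) (bs e).

Lemma Del_hits b x a : Del (fun e => @hits (S e) b x a).
Proof.
apply: Del_ex => [|m]; first delq.
by apply: Del_ex => [|y]; [delq|apply: Del_and; [exact: dR|exact: dH]].
Qed.

Lemma Del_lev a : Del (fun e => @lev (S e) (Ty e) a).
Proof. by apply: Del_ex => [|n]; [delq|exact: dTy]. Qed.

Lemma Del_TyR a n : Del (fun e => @TyR (S e) (Ty e) (Inn e) a n).
Proof.
apply: Del_and3; first exact: drf.
  apply: DelN; apply: Del_ex => [|b]; first delq.
  apply: Del_ex => [|x]; first delq.
  apply: Del_and5; [exact: dlt|exact: dR|exact: dInn|exact: Del_hits|].
  apply: Del_all => [|c]; first delq.
  do 2 (apply: Del_imp; first exact: dlt).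
  by apply: DelN; apply: Del_hits.
case: n => [|n] /=.
  apply: Del_all => [|b]; first delq.
  apply: Del_imp; first exact: dlt.
  apply: Del_imp; first exact: Del_lev.
  apply: Del_ex => [|c]; first delq.
  by apply: Del_and3; [exact: dlt|exact: dlt|exact: Del_lev].
apply: Del_ex => [|b]; first delq.
apply: Del_and3; [exact: dlt|exact: dTy|].
apply: Del_all => [|c]; first delq.
do 2 (apply: Del_imp; first exact: dlt).
by apply: DelN; apply: Del_lev.
Qed.

Lemma Del_solves : Del (fun e => @solves (S e) (Ty e) (Inn e)).
Proof.
apply: Del_all => [|a]; first delq.
apply: Del_and.
  by apply: Del_all => [|n]; [delq|apply: Del_iff; [exact: dTy|exact: Del_TyR]].
apply: Del_all => [|x]; first delq.
apply: Del_iff; first exact: dInn.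
apply: Del_and3; [|exact: dR|].
  by apply: Del_ex => [|n]; [delq|exact: Del_TyR].
apply: Del_all => [|b]; first delq.
apply: Del_all => [|n]; first delq.
apply: Del_all => [|y]; first delq.
apply: Del_imp; first exact: dlt.
apply: Del_imp; first exact: dTy.
apply: Del_imp; first exact: dR.
apply: Del_imp; first exact: dInn.
apply: Del_imp; first exact: dbs.
by apply: DelN; exact: dH.
Qed.

End Del_operators.

Section tables.
Context (w Y : bits -> bits) (bw : Bm w) (bY : Bm Y).

Lemma Del_bis_ok : Del (fun e => bis_ok (w e) (rel 0 (Y e))).
Proof.
do 3 (apply: Del_all => [|?]; first delq).
apply: Del_iff; first exact: Del_rel.
by apply: Del_bisim_at => *; apply: Del_rel => //; apply: Bm_rl.
Qed.

Lemma Del_codeat i a : Del (fun e => codeat (w e) (rel 0 (Y e)) i a).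
Proof.
apply: Del_and; first by apply: Del_Lcode; apply: Bm_rl.
by apply: Del_bisim_total => // *; apply: Del_rel.
Qed.

Lemma Del_Vw a k b m k' i1 i2 i3 :
  Del (fun e => Vw (w e) (rel 0 (Y e)) a k b m k' i1 i2 i3).
Proof.
apply: Del_and; first exact: Del_codeat.
apply: Del_and; first exact: Del_codeat.
by apply: Del_Fw; repeat apply: Bm_pair; apply: Bm_rl.
Qed.

Lemma Del_VH a k b m k' : Del (fun e => VH (w e) (rel 0 (Y e)) a k b m k').
Proof. do 3 (apply: Del_ex => [|?]; first delq); exact: Del_Vw. Qed.

Lemma Del_Rn a k : Del (fun e => Rn (w e) a k).
Proof.
apply: Del_ex => [|k']; first delq.
apply: Del_and; first exact: Del_rel.
apply: Del_all => [|j]; first delq.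
apply: (@eq_Del (fun e => rl (w e) k' j <-> rl (w e) k j)).
  by move=> e; split=> [h|->//]; apply/idP/idP => /h.
by apply: Del_iff; apply: Bm_rl.
Qed.

Lemma Del_rfn a : Del (fun e => rfn (w e) (rel 0 (Y e)) a).
Proof.
do 5 (apply: Del_all => [|?]; first delq).
do 2 (apply: Del_imp; first exact: Del_rel).
do 2 (apply: Del_imp; first exact: Del_Rn).
apply: Del_imp; first exact: Del_VH.
do 3 (apply: Del_ex => [|?]; first delq).
by do 3 (apply: Del_and; first exact: Del_Rn); apply: Del_Vw.
Qed.

Lemma Del_bs k n : Del (fun e => bsx (rl (w e) k) n).
Proof. exact: (Bm_sec 1 (Bm_rl k bw) n). Qed.

Lemma Del_corr : Del (fun e => corr (w e) (Y e)).
Proof.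
apply: Del_and; first exact: Del_bis_ok.
apply: (@Del_solves (fun e => cLt (w e)) (fun e => Rn (w e))
  (fun e => VH (w e) (rel 0 (Y e))) (fun e => rfn (w e) (rel 0 (Y e)))
  (fun e k n => bsx (rl (w e) k) n) (fun e => rel 1 (Y e)) (fun e => rel 2 (Y e))) => *.
- exact: Del_rel.
- exact: Del_Rn.
- exact: Del_VH.
- exact: Del_rfn.
- exact: Del_bs.
- exact: Del_rel.
- exact: Del_rel.
Qed.

Lemma Del_tlt b c : Del (fun e => tlt (w e) b c).
Proof. by case: b c => [b|] [c|] /=; [exact: Del_rel|..]; apply: Del_cst. Qed.

Lemma Del_tR b k : Del (fun e => tR (w e) b k).
Proof. by case: b => [b|] /=; [exact: Del_Rn|apply: Del_cst]. Qed.

Lemma Del_ext_top i b n : Del (fun e => ext_top (rel i (Y e)) b n).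
Proof. by case: b => [b|] /=; [exact: Del_rel|apply: Del_cst]. Qed.

Lemma Sig_tH a k b m k' : Sig (fun e => tH (w e) (rel 0 (Y e)) a k b m k').
Proof.
by case: a b => [a|] [b|] /=; [apply: Del_Sig; exact: Del_VH|..];
  apply: Sig_Hn => //; apply: Bm_rl.
Qed.

Let O e := OS (w e) (rel 0 (Y e)).

Lemma Sig_ntrf : Sig (fun e => ~ trf (w e) (rel 0 (Y e))).
Proof.
apply: (@eq_Sig (fun e => exists a b k m k', Rn (w e) a k /\ Rn (w e) b k' /\
  Hn (w e) (Some a) (rl (w e) k) (Some b) m (rl (w e) k') /\
  ~ VH (w e) (rel 0 (Y e)) a k b m k')).
  move=> e; split=> [[a [b [k [m [k' [Ra [Rb [h nV]]]]]]]] t|nt].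
    by apply: nV; apply: t.
  apply: contrapT => nex; apply: nt => a b k m k' Ra Rb h.
  by apply: contrapT => nV; apply: nex; exists a, b, k, m, k'.
do 5 (apply: Sig_ex => [|?]; first delq).
do 2 (apply: Sig_and; first by apply: Del_Sig; exact: Del_Rn).
apply: Sig_and; first by apply: Sig_Hn => //; apply: Bm_rl.
by apply: Del_SigN; apply: Del_VH.
Qed.

(** The analytic relation at the top stage occurs positively, in [hits]. The clause that no earlier
    stage is hit concerns named stages only, where the relation is read off the table and may be
    negated. *)
Lemma Sig_blocked : Sig (fun e => exists b x,
  @blocks (O e) (ext_top (rel 2 (Y e))) b x None).
Proof.
apply: Sig_ex => [|b]; first delq.
apply: Sig_ex => [|x]; first delq.
case: b => [b|]; last first.
  by apply: eq_Sig (Sig_cst False) => e; split=> // -[].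
apply: Sig_and5.
- exact: Sig_cst.
- by apply: Del_Sig; exact: Del_Rn.
- by apply: Del_Sig; exact: Del_rel.
- apply: Sig_ex => [|m]; first delq.
  apply: Sig_ex => [|y]; first delq.
  by apply: Sig_and; [exact: Sig_cst|exact: (Sig_tH (Some b) x None m y)].
- apply: Sig_all => [|c]; first delq.
  case: c => [c|]; last by apply: eq_Sig (Sig_cst True) => e; split=> // _ _ [].
  apply: Del_Sig; apply: Del_imp; first exact: (Del_tlt (Some b) (Some c)).
  apply: Del_imp; first exact: (Del_tlt (Some c) None).
  apply: DelN; apply: Del_ex => [|m]; first delq.
  apply: Del_ex => [|y]; first delq.
  by apply: Del_and; [exact: Del_Rn|exact: Del_VH].
Qed.

Lemma Del_ntyp n : Del (fun e => @typ (O e) (ext_top (rel 1 (Y e))) None n).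
Proof.
have dl b : Del (fun e => @lev (O e) (ext_top (rel 1 (Y e))) b).
  by apply: Del_ex => [|m]; [delq|exact: Del_ext_top].
case: n => [|n] /=.
  apply: Del_all => [|b]; first delq.
  apply: Del_imp; first exact: Del_tlt.
  apply: Del_imp; first exact: dl.
  apply: Del_ex => [|c]; first delq.
  by apply: Del_and3; [exact: Del_tlt|exact: Del_tlt|exact: dl].
apply: Del_ex => [|b]; first delq.
apply: Del_and3; [exact: Del_tlt|exact: Del_ext_top|].
apply: Del_all => [|c]; first delq.
do 2 (apply: Del_imp; first exact: Del_tlt).
exact: DelN.
Qed.

Lemma Sig_navoids k : Sig (fun e => ~ @avoids (O e) (ext_top (rel 1 (Y e)))
  (ext_top (rel 2 (Y e))) None k).
Proof.
apply: (@eq_Sig (fun e => exists b n y, tlt (w e) b None /\ ext_top (rel 1 (Y e)) b n /\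
  tR (w e) b y /\ ext_top (rel 2 (Y e)) b y /\ bsx (rl (w e) k) n /\
  tH (w e) (rel 0 (Y e)) None k b n y)).
  move=> e; split=> [[b [n [y [h1 [h2 [h3 [h4 [h5 h6]]]]]]]] av|nav].
    exact: (av b n y h1 h2 h3 h4 h5 h6).
  apply: contrapT => nex; apply: nav => b n y h1 h2 h3 h4 h5 h6; apply: nex.
  by exists b, n, y; do 5 (split; first by []).
do 3 (apply: Sig_ex => [|?]; first delq).
apply: Sig_and; first by apply: Del_Sig; exact: Del_tlt.
apply: Sig_and; first by apply: Del_Sig; exact: Del_ext_top.
apply: Sig_and; first by apply: Del_Sig; exact: Del_tR.
apply: Sig_and; first by apply: Del_Sig; exact: Del_ext_top.
apply: Sig_and; first by apply: Del_Sig; exact: Del_bs.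
exact: Sig_tH.
Qed.

Lemma Sig_ntop n k : Sig (fun e => ~ top_ok n k (w e) (Y e)).
Proof.
apply: (@eq_Sig (fun e => (~ trf (w e) (rel 0 (Y e)) \/
  (exists b x, @blocks (O e) (ext_top (rel 2 (Y e))) b x None) \/
  ~ @typ (O e) (ext_top (rel 1 (Y e))) None n) \/
  ~ @avoids (O e) (ext_top (rel 1 (Y e))) (ext_top (rel 2 (Y e))) None k)).
  move=> e; split=> [[[nt|[bl|nty]]|nav] [[t nb ty] av]//|h].
  apply: contrapT => /not_orP[/not_orP[t /not_orP[nb ty]] av]; apply: h; split.
    by split; [exact: contrapT t|exact: nb|exact: contrapT ty].
  exact: contrapT av.
apply: Sig_or; last exact: Sig_navoids.
apply: Sig_or; first exact: Sig_ntrf.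
by apply: Sig_or; [exact: Sig_blocked|apply: Del_SigN; exact: Del_ntyp].
Qed.

End tables.

Lemma Sig_npiece n : Sig (fun p => ~ piece n p).
Proof.
apply: (@eq_Sig (fun p => (~ Lcode (p2 p) \/ ~ well_founded (cLt (p2 p))) \/ forall k,
  ~ (forall j, rl (p2 p) k j = p1 p j) \/
  exists Y, corr (p2 p) Y /\ ~ top_ok n k (p2 p) Y)).
  move=> p; rewrite pieceP; split=> [h [cw [k [kx H]]]|nh].
    case: h => [[/(_ (code_Lcode cw))|/(_ (code_wf cw))]//|].
    by move=> /(_ k)[//|[Y [cY nt]]]; apply: nt; apply: H.
  have [Lw|] := pselect (Lcode (p2 p)); last by left; left.
  have [wf|] := pselect (well_founded (cLt (p2 p))); last by left; right.
  right=> k; have [kx|] := pselect (forall j, rl (p2 p) k j = p1 p j); last by left.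
  right; apply: contrapT => nY; apply: nh; split; first exact: codeI.
  exists k; split=> // Y cY; apply: contrapT => nt; apply: nY; by exists Y.
have b2 : Bm p2 := Bm_p2 Bm_id; have b1 : Bm p1 := Bm_p1 Bm_id.
apply: Sig_or.
  apply: Sig_or; first by apply: Del_SigN; exact: Del_Lcode.
  exact: Sig_illfounded.
apply: Sig_all => [|k]; first delq.
apply: Sig_or.
  apply: Del_SigN; apply: Del_all => [|j]; first delq.
  apply: (@eq_Del (fun p => rl (p2 p) k j <-> p1 p j)).
    by move=> e; split=> [h|->//]; apply/idP/idP => /h.
  by apply: Del_iff; [apply: Bm_rl|apply: b1].
apply: (@Sig_exB (fun v Y => corr v Y /\ ~ top_ok n k v Y)) => // g h bg bh.
by apply: Sig_and; [apply: Del_Sig; exact: Del_corr|exact: Sig_ntop].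
Qed.

(** * Cantor schemes of balls *)

Import Order.TTheory GRing.Theory Num.Theory.

Section cantor_schemes.
Local Open Scope ring_scope.

Lemma small_inv (R : realType) (e : R) : 0 < e -> exists k : nat, k.+1%:R^-1 < e.
Proof.
move=> e0; exists (Num.bound e^-1); rewrite invf_plt ?posrE ?ltr0n//.
by apply: lt_trans (archi_boundP _) _; rewrite ?invr_ge0 ?ltW// ltr_nat.
Qed.

Section ultrametric.
Context (R : realType) (X : metricType R).
Hypothesis um : ultrametric X.

Definition bl (x : X) (r : R) : set X := [set y | mdist x y < r].

Lemma bl_self x r : 0 < r -> bl x r x.
Proof. by move=> r0; rewrite /bl /= mdistxx. Qed.

Lemma bl_sym x y r : bl x r y -> bl y r x.
Proof. by rewrite /bl /= metric_sym. Qed.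

Lemma bl_trans x y z r : bl x r y -> bl y r z -> bl x r z.
Proof.
by rewrite /bl /= => xy yz; apply: le_lt_trans (um x y z) _; rewrite gt_max xy.
Qed.

Lemma blW x r r' : r <= r' -> bl x r `<=` bl x r'.
Proof. by move=> rr y; rewrite /bl /= => h; apply: lt_le_trans rr. Qed.

Lemma nbhs_bl x r : 0 < r -> nbhs x (bl x r).
Proof.
move=> r0; have := nbhsx_ballx x r r0.
by rewrite metric_structure.ballEmdist.
Qed.

Lemma nbhs_sub_bl x (A : set X) : nbhs x A -> exists2 r, 0 < r & bl x r `<=` A.
Proof.
by rewrite -nbhs_ballE => -[r /= r0]; rewrite metric_structure.ballEmdist; exists r.
Qed.

Lemma open_bl x r : open (bl x r).
Proof.
rewrite openE => y xy /=; have [r0|] := ltP 0 r; last first.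
  by move=> r0; have := le_lt_trans (mdist_ge0 x y) xy; rewrite ltNge r0.
by apply: filterS (nbhs_bl y r0) => z; apply: bl_trans.
Qed.

Lemma nbhs_blC x r y : 0 < r -> ~ bl x r y -> nbhs y (~` bl x r).
Proof.
move=> r0 nxy; apply: filterS (nbhs_bl y r0) => z yz xz; apply: nxy.
exact: bl_trans xz (bl_sym yz).
Qed.

(** In an ultrametric, points of one ball are nearer to each other than any of them is to an outside
    point, so moving inside the ball does not increase the distance to the outside. *)
Lemma bl_move c r x x' z : bl c r x -> bl c r x' -> ~ bl c r z ->
  mdist x' z <= mdist x z.
Proof.
move=> cx cx' ncz; have rz : r <= mdist x z.
  by rewrite leNgt; apply/negP => xz; apply: ncz; apply: bl_trans cx xz.
apply: le_trans (um x' x z) _; rewrite ge_max lexx andbT.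
by apply: le_trans rz; apply: ltW; apply: bl_trans (bl_sym cx') cx.
Qed.

Lemma countable_sub (A B : set X) : A `<=` B -> countable B -> countable A.
Proof. by move=> /subset_card_le; apply: sub_countable. Qed.

Section splitting.
Hypothesis sepX : separable X.

(** If nothing split, then for each small radius all points of the ball with an uncountable
    neighbourhood of that radius would lie in a single one, and the remaining points would be
    countably many. Those single balls shrink to at most one point, so the whole ball would be
    countable. *)
Lemma bl_split x r e : 0 < e -> 0 < r -> ~ countable (bl x r) ->
  exists x0 x1 r', [/\ 0 < r', r' < e & r' <= r] /\
    [/\ bl x r x0, bl x r x1, ~ countable (bl x0 r'), ~ countable (bl x1 r') &
        ~ bl x0 r' x1].
Proof.
move=> e0 r0 big; set S := bl x r in big *; have [D cD dD] := sepX.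
have near d y : 0 < d -> d <= r -> S y -> exists2 z, (D `&` S) z & bl z d y.
  move=> d0 dr Sy; have [|z [yz Dz]] := dD (bl y d) _ (open_bl y d).
    by exists y; apply: bl_self.
  exists z; last exact: bl_sym.
  by split=> //; apply: bl_trans Sy _; apply: blW dr _ yz.
have cDS : countable (D `&` S) by apply: countable_sub cD => ? [].
apply: contrapT => nsplit.
(* The radii [dl k] tend to 0 and stay at most [m], hence at most [r] and strictly below [e]. *)
pose m := Num.min r (e / 2).
have m0 : 0 < m by rewrite lt_min r0 divr_gt0.
have mr : m <= r by rewrite ge_min lexx.
have me : m < e by rewrite gt_min ltr_pdivrMr// ltr_pMr// ltr1n orbT.
pose dl k := m * k.+1%:R^-1.
have dl0 k : 0 < dl k by rewrite mulr_gt0// invr_gt0 ltr0n.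
have dlm k : dl k <= m.
  by rewrite ger_pMr// invf_le1 ?ltr0n// ler1n.
have uniq k x0 x1 : S x0 -> S x1 -> ~ countable (bl x0 (dl k)) ->
    ~ countable (bl x1 (dl k)) -> bl x0 (dl k) x1.
  move=> S0 S1 b0 b1; apply: contrapT => n01; apply: nsplit.
  exists x0, x1, (dl k); split=> //; split=> //; last exact: le_trans (dlm k) mr.
  exact: le_lt_trans (dlm k) me.
have dlr k : dl k <= r := le_trans (dlm k) mr.
have /choice[c cP] : forall k, exists c, S c /\ ~ countable (bl c (dl k)).
  move=> k; apply: contrapT => nc; apply: big.
  apply: (@countable_sub _ (\bigcup_(d in D `&` S) bl d (dl k))).
    by move=> y Sy; have [z Dz zy] := near (dl k) y (dl0 k) (dlr k) Sy; exists z.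
  apply: bigcup_countable => // d [Dd Sd]; apply: contrapT => nd; apply: nc.
  by exists d.
pose T k := S `\` bl (c k) (dl k).
have cT k : countable (T k).
  apply: (@countable_sub _ (\bigcup_(d in [set d | (D `&` S) d /\ countable (bl d (dl k))])
    bl d (dl k))); last first.
    by apply: bigcup_countable => [|d []//]; apply: countable_sub cDS => d [].
  move=> y [Sy ny]; have [z [Dz Sz] zy] := near (dl k) y (dl0 k) (dlr k) Sy.
  exists z => //; split=> //; apply: contrapT => bz; apply: ny.
  have [Sc bc] := cP k; apply: bl_trans zy; exact: uniq.
have core y z : (forall k, bl (c k) (dl k) y) -> (forall k, bl (c k) (dl k) z) -> y = z.
  move=> hy hz; apply: mdist_positivity; apply/eqP; rewrite eq_le mdist_ge0 andbT.
  rewrite leNgt; apply/negP => yz.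
  have [k] := small_inv (divr_gt0 yz m0); rewrite ltr_pdivlMr// mulrC -/(dl k) => kyz.
  have := bl_trans (bl_sym (hy k)) (hz k); rewrite /bl /= ltNge => /negP; apply.
  exact: ltW.
apply: big.
have [[y0 hy0]|ny0] := pselect (exists y, forall k, bl (c k) (dl k) y); last first.
  apply: (@countable_sub _ (\bigcup_k T k)); last by apply: bigcup_countable.
  move=> y Sy; apply: contrapT => ny; apply: ny0; exists y => k; apply: contrapT => nk.
  by apply: ny; exists k.
pose T' k := if k is Some k' then T k' else [set y0].
apply: (@countable_sub _ (\bigcup_k T' k)).
  move=> y Sy; have [hy|/existsNP[k nk]] := pselect (forall k, bl (c k) (dl k) y).
    by exists None => //=; apply: core.
  by exists (Some k).
apply: bigcup_countable => [|[k|] _ /=]; [exact: countableP|exact: cT|exact: countable1].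
Qed.

Hypothesis compX : metric_complete X.
Hypothesis uncX : ~ countable [set: X].

(** The two children of a node have the same radius and the second centre lies outside the first
    ball, so they are disjoint. The last clause, a neighbourhood base at [e y], gives control of
    preimages of open sets. *)
Lemma cantor_scheme : exists (U : seq bool -> set X) (e : bits -> X),
  [/\ forall s, exists x r, 0 < r /\ U s = bl x r,
      forall s b, U (rcons s b) `<=` U s,
      forall s x, U (rcons s true) x -> U (rcons s false) x -> False,
      forall y k, U (mkseq y k) (e y) &
      forall y x, (forall k, U (mkseq y k) x) ->
        x = e y /\ forall O, nbhs x O -> exists k, U (mkseq y k) `<=` O].
Proof.
have [x0 r0P] : exists x, ~ countable (bl x 1).
  apply: contrapT => nx; apply: uncX; have [D cD dD] := sepX.
  apply: (@countable_sub _ (\bigcup_(d in D) bl d 1)) => [y _|].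
    have [|z [yz Dz]] := dD (bl y 1) _ (open_bl y 1); first by exists y; apply: bl_self.
    by exists z => //; apply: bl_sym.
  apply: bigcup_countable => // d _; apply: contrapT => nd; apply: nx; by exists d.
pose ok (p : X * R) := 0 < p.2 /\ ~ countable (bl p.1 p.2).
have /choice[ch chP] : forall q : nat * (X * R), exists t : X * X * R, ok q.2 ->
    [/\ 0 < t.2, t.2 < q.1.+1%:R^-1 & t.2 <= q.2.2] /\
    [/\ bl q.2.1 q.2.2 t.1.1, bl q.2.1 q.2.2 t.1.2, ~ countable (bl t.1.1 t.2),
        ~ countable (bl t.1.2 t.2) & ~ bl t.1.1 t.2 t.1.2].
  move=> [k [x r]] /=; have [[/= r0 big]|] := pselect (ok (x, r)); last first.
    by exists (x, x, r).
  have k0 : 0 < k.+1%:R^-1 :> R by rewrite invr_gt0 ltr0n.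
  by have [x1 [x2 [r' h]]] := bl_split k0 r0 big; exists (x1, x2, r').
pose child b (k : nat) p : X * R :=
  let t := ch (k, p) in (if b then t.1.1 else t.1.2, t.2).
(* The recursion peels off the head, whereas the scheme extends sequences at the end; [U] therefore
   applies [nd] to the reversed sequence. *)
pose fix nd (s : seq bool) : X * R :=
  if s is b :: s' then child b (size s') (nd s') else (x0, 1).
have okc b k p : ok p -> ok (child b k p).
  by move=> /(chP (k, p))[[? _ _] [_ _ ? ? _]]; case: b.
have okn s : ok (nd s) by elim: s => [|b s IH] //=; apply: okc.
pose U s := bl (nd (rev s)).1 (nd (rev s)).2.
have Us s b : U (rcons s b) `<=` U s.
  rewrite /U rev_rcons /= => y; rewrite size_rev.
  have [[_ _ rr] [h1 h2 _ _ _]] := chP (size s, nd (rev s)) (okn _).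
  move=> hy; have : bl (nd (rev s)).1 (nd (rev s)).2 (child b (size s) (nd (rev s))).1.
    by case: (b).
  by move=> h; apply: bl_trans h _; apply: blW rr _ hy.
have Ur s y z : U s y -> U s z -> s != [::] -> mdist y z < (size s)%:R^-1.
  case/lastP: s => [//|s b]; rewrite /U rev_rcons /= size_rev size_rcons => hy hz _.
  have [[_ rk _] _] := chP (size s, nd (rev s)) (okn _).
  exact: lt_trans (bl_trans (bl_sym hy) hz) rk.
have Udec y k l : (k <= l)%N -> U (mkseq y l) `<=` U (mkseq y k).
  move=> /subnK <-; elim: (l - k)%N => [//|m IH].
  rewrite addSn mkseqS; exact: subset_trans (Us _ _) IH.
have center s : U s (nd (rev s)).1 by apply: bl_self; have [] := okn (rev s).
have close y k x z : U (mkseq y k.+1) x -> U (mkseq y k.+1) z -> mdist x z < k.+1%:R^-1.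
  by move=> h1 h2; have := Ur _ _ _ h1 h2; rewrite size_mkseq; apply; rewrite -size_eq0 size_mkseq.
have /choice[e eP] : forall y, exists x, forall k, U (mkseq y k) x.
  move=> y; pose u k := (nd (rev (mkseq y k))).1.
  have uU k l : (k <= l)%N -> U (mkseq y k) (u l) by move=> kl; apply: Udec kl _ _; apply: center.
  have /compX[x ux] : cauchy (u @ \oo).
    move=> E; rewrite -entourage_ballE => -[ep /= ep0 epE].
    have [k kep] := small_inv ep0.
    exists (u @` [set n | (k < n)%N], u @` [set n | (k < n)%N]) => /=.
      by split; exists k.+1 => // n /= kn; exists n.
    move=> [a b] /= [[n kn <-] [l kl <-]]; apply: epE => /=.
    rewrite metric_structure.ballEmdist /=; apply: lt_trans kep.
    by apply: (close y k); apply: uU.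
  exists x => k; have [rk _] := okn (rev (mkseq y k)).
  have /ux[N _ hN] := nbhs_bl x rk.
  have h : bl x (nd (rev (mkseq y k))).2 (u (maxn N k)) by apply: (hN (maxn N k)); rewrite /= leq_maxl.
  by apply: bl_trans (bl_sym h); apply: (uU k); rewrite leq_maxr.
exists U, e; split=> //.
- by move=> s; exists (nd (rev s)).1, (nd (rev s)).2; split=> //; have [] := okn (rev s).
- move=> s x; rewrite /U !rev_rcons /= size_rev => h1 h2.
  have [_ [_ _ _ _ n12]] := chP (size s, nd (rev s)) (okn _).
  by apply: n12; apply: bl_trans h1 (bl_sym h2).
move=> y x hx; split.
  apply: mdist_positivity; apply/eqP; rewrite eq_le mdist_ge0 andbT.
  rewrite leNgt; apply/negP => /small_inv[k]; apply/negP; rewrite -leNgt.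
  by apply: ltW; apply: (close y k).
move=> O /nbhs_sub_bl[r r0 rO]; have [k kr] := small_inv r0.
exists k.+1 => z hz; apply: rO; apply: lt_trans kr; exact: (close y k).
Qed.

End splitting.
End ultrametric.

End cantor_schemes.

(** * The pieces inside the metric space *)

Lemma nbhs_agree (v : baire) m : nbhs v [set v' : baire | agree m v v'].
Proof.
elim: m => [|m IH]; first by apply: filterS filterT => v' _ i; rewrite ltn0.
have : nbhs v [set v' : baire | v' m = v m].
  apply: (@proj_continuous nat (fun=> nat) m v [set n | n = v m]).
  by apply: open_nbhs_nbhs; split=> //; apply: discrete_open.
apply: filterS2 IH => v' h hm i; rewrite ltnS leq_eqVlt => /orP[/eqP ->|//].
  by rewrite hm.
exact: h.
Qed.

Section scheme.
Context (R : realType) (X : metricType R) (um : ultrametric X).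
Context (U : seq bool -> set X) (e : bits -> X).
Hypotheses (Ubl : forall s, exists x r, (0 < r)%R /\ U s = bl x r)
  (Us : forall s b, U (rcons s b) `<=` U s)
  (Ud : forall s x, U (rcons s true) x -> U (rcons s false) x -> False)
  (Ue : forall y k, U (mkseq y k) (e y))
  (Ux : forall y x, (forall k, U (mkseq y k) x) ->
        x = e y /\ forall O, nbhs x O -> exists k, U (mkseq y k) `<=` O).

Lemma nbhs_U s x : U s x -> nbhs x (U s).
Proof.
have [c [r [r0 ->]]] := Ubl s => cx.
by apply: open_nbhs_nbhs; split=> //; apply: open_bl.
Qed.

Lemma nbhs_UC s x : ~ U s x -> nbhs x (~` U s).
Proof. by have [c [r [r0 ->]]] := Ubl s; apply: nbhs_blC. Qed.

Lemma U_same s t x : size s = size t -> U s x -> U t x -> s = t.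
Proof.
elim/last_ind: s t => [|s b IH] t; first by case: t.
case/lastP: t => [|t c]; rewrite ?size_rcons// => -[st] sx tx.
have ? := IH t st (Us sx) (Us tx); subst t; congr rcons.
by case: b c sx tx => -[] // sx tx; [case: (Ud sx tx)|case: (Ud tx sx)].
Qed.

Lemma U_prefix s y : U s (e y) -> mkseq y (size s) = s.
Proof. by move=> h; apply: U_same (Ue y _) h; rewrite size_mkseq. Qed.

Lemma U_branch x : (forall k, exists2 s, size s = k & U s x) -> exists y, x = e y.
Proof.
move=> h; have /choice[s sP] : forall k, exists s, size s = k /\ U s x.
  by move=> k; have [s] := h k; exists s.
pose y j := nth false (s j.+1) j.
suff ys k : mkseq y k = s k by exists y; apply: (@proj1 _ _ (Ux _)) => k; rewrite ys; case: (sP k).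
elim: k => [|k IH]; first by have [/size0nil ->] := sP 0%N.
rewrite mkseqS IH; have [ss sx] := sP k.+1; move: ss sx (erefl (y k)); rewrite {2}/y.
case/lastP: (s k.+1) => [//|t b]; rewrite size_rcons => -[st] tx ->.
have [sk kx] := sP k; have -> := U_same (etrans sk (esym st)) kx (Us tx).
by rewrite nth_rcons st ltnn eqxx.
Qed.

Lemma e_inj : injective e.
Proof.
move=> y z yz; apply/funext => k; have := Ue y k.+1; rewrite yz => /U_prefix.
rewrite size_mkseq => /(congr1 (fun s => nth false s k)).
by rewrite !nth_mkseq.
Qed.

(** A point misses the image if it lies on no branch of the scheme, or if it is [e y] for some [y]
    outside [A]. Nodes are clopen, which makes both conditions closed in the point and the
    witness. *)
Lemma coanalytic_image (A : bits -> Prop) : Sig (fun y => ~ A y) ->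
  coanalytic X (e @` A).
Proof.
move=> [M cM AM].
(* [v 0] selects the case. In the first, [v 1] is a length no node of which contains the point; in
   the second, the odd places give [y] and the positive even ones the witness for [M]. *)
pose yv (v : nat -> nat) : bits := fun j => v j.*2.+1 != 0%N.
pose uv (v : nat -> nat) j := v j.*2.+2.
pose D (x : X) (v : nat -> nat) := if v 0%N == 0%N then forall s, size s = v 1%N -> ~ U s x
  else x = e (yv v) /\ M (yv v) (uv v).
exists [set z | D z.1 z.2]; last first.
  apply/seteqP; split=> [x nAx|x [[x' v] /= h <-{x}]].
    have [[y xy]|nbr] := pselect (exists y, x = e y).
      have /AM[u Mu] : ~ A y by move=> Ay; apply: nAx; exists y.
      pose v k := if k is k'.+1 then (if odd k' then u k'./2 else (y k'./2 : nat)) else 1%N.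
      exists (x, v) => //; rewrite /D /=.
      have -> : yv v = y.
        by apply/funext => j; rewrite /yv /v odd_double doubleK; case: (y j).
      have -> // : uv v = u.
      by apply/funext => j; rewrite /uv /v /= odd_double /= uphalf_double.
    have /existsNP[k nk] : ~ forall k, exists2 s, size s = k & U s x by move=> /U_branch.
    exists (x, fun i => if i == 0%N then 0%N else k) => //; rewrite /D /= => s sk sx.
    by apply: nk; exists s.
  move=> [y Ay yx]; move: h; rewrite /D /=; case: ifP => _.
    move=> /(_ (mkseq y (v 1%N)) (size_mkseq _ _)); apply; rewrite -yx; exact: Ue.
  rewrite -yx => -[/e_inj yy Mv]; move: Ay; rewrite yy.
  by apply/AM; exists (uv v).
rewrite -[X in closed X]setCK closedC openE => -[x v] /= nD; rewrite /interior /=.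
have nb A' B' : nbhs x A' -> nbhs (v : baire) B' ->
    (forall x' v', A' x' -> B' v' -> ~ D x' v') ->
    nbhs ((x, v) : X * baire) (~` [set z | D z.1 z.2]).
  by move=> hA hB h; exists (A', B') => //= -[x' v'] /= [? ?]; apply: h.
move: nD; rewrite /D /=; case: ifP => v0.
  move=> /existsNP[s /not_implyP[sv /contrapT sx]].
  apply: nb (nbhs_U sx) (nbhs_agree v 2) _ => x' v' sx' vv'; rewrite /D.
  by rewrite -(vv' 0%N)// v0 -(vv' 1%N)// => /(_ s sv).
have [xe nM|nxe _] := pselect (x = e (yv v)).
  have {}nM : ~ M (yv v) (uv v) by move=> h; apply: nM.
  have [m hm] := cM _ _ nM.
  apply: nb filterT (nbhs_agree v m.*2.+3) _ => x' v' _ vv'; rewrite /D.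
  rewrite -(vv' 0%N)// v0 => -[_]; apply: hm => i im;
    have h : (i.*2.+2 <= m.*2)%N by rewrite -doubleS leq_double.
    by rewrite /yv vv'//; apply: leq_trans h _; rewrite -addn3 leq_addr.
  by rewrite /uv vv'// ltnS; apply: leq_trans h _; rewrite -addn2 leq_addr.
have /existsNP[k nk] : ~ forall k, U (mkseq (yv v) k) x by move=> /Ux[].
apply: nb (nbhs_UC nk) (nbhs_agree v k.*2.+1) _ => x' v' nk' vv'; rewrite /D.
rewrite -(vv' 0%N)// v0 => -[xe' _]; apply: nk'; rewrite xe'.
rewrite (_ : mkseq (yv v) k = mkseq (yv v') k)//; apply/eq_in_map => i.
by rewrite mem_iota => /= ik; rewrite /yv vv'// ltnS ltn_double.
Qed.

Lemma Del_prefix g k s : Bm g -> Del (fun p => mkseq (g p) k = s).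
Proof.
move=> bg; apply: (@eq_Del (fun p => size s = k /\
    forall i, (i < k)%N -> g p i = nth false s i)).
  move=> p; split=> [[sk h]|<-]; last first.
    by rewrite size_mkseq; split=> // i ik; rewrite nth_mkseq.
  apply: (@eq_from_nth _ false); rewrite size_mkseq// => i ik.
  by rewrite nth_mkseq// h.
apply: Del_and; first exact: Del_cst.
apply: Del_all => [|i]; first delq.
by apply: Del_imp; [exact: Del_cst|exact: Del_eqb].
Qed.

(** For open sets, nodes form a neighbourhood base along each branch, so membership of [e y] amounts
    to some prefix of [y] having its node inside; the other cases are the closure properties of
    [Del]. *)
Lemma Del_borel B : borel B -> forall g, Bm g -> Del (fun p => B (e (g p))).
Proof.
move: B; apply: smallest_sub => [|O oO g bg].
  split=> [g bg|A dA g bg|A dA g bg].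
  - exact: Del_cst.
  - by apply: eq_Del (DelN (dA g bg)) => p; split=> [|[]].
  - apply: (@eq_Del (fun p => exists k, A k (e (g p)))).
      by move=> p; split=> [[k Ak]|[k _ Ak]]; exists k.
    by apply: Del_ex => [|k]; [delq|apply: dA].
apply: (@eq_Del (fun p => exists s, mkseq (g p) (size s) = s /\ U s `<=` O)).
  move=> p; split=> [[s [ps sO]]|Op].
    by apply: sO; rewrite -ps; apply: Ue.
  have [_ /(_ O)[|k kO]] := Ux (Ue (g p)); first by apply: open_nbhs_nbhs; split.
  by exists (mkseq (g p) k); rewrite size_mkseq.
apply: Del_ex => [|s]; first delq.
by apply: Del_and; [exact: Del_prefix|exact: Del_cst].
Qed.

(* The [n]-th piece is copied below the node [0^n 1] of the scheme. *)

Definition node n := rcons (nseq n false) true.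

Definition tag n (p : bits) : bits :=
  fun i => if (i < n)%N then false else if i == n then true else p (i - n.+1)%N.

Definition untag n (y : bits) : bits := fun i => y (n.+1 + i)%N.

Lemma tagK n p : untag n (tag n p) = p.
Proof.
apply/funext => i; rewrite /untag /tag addSn ltnNge leqW ?leq_addr//=.
by rewrite gtn_eqF ?ltnS ?leq_addr// -addSn addKn.
Qed.

Lemma untagK n y : mkseq y n.+1 = node n -> tag n (untag n y) = y.
Proof.
move=> yn; have yi i : (i < n.+1)%N -> y i = nth false (node n) i.
  by move=> ik; rewrite -yn nth_mkseq.
apply/funext => i; rewrite /tag /untag; case: ifP => [ik|/negbT].
  by rewrite (yi i (leqW ik)) /node nth_rcons size_nseq ik nth_nseq if_same.
rewrite -leqNgt => ni; case: eqP => [->|/eqP nei].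
  by rewrite yi// /node nth_rcons size_nseq ltnn eqxx.
by congr y; rewrite subnKC// ltn_neqAle eq_sym nei.
Qed.

Lemma mkseq_tag n p : mkseq (tag n p) n.+1 = node n.
Proof.
apply: (@eq_from_nth _ false); rewrite size_mkseq ?size_rcons ?size_nseq// => i.
rewrite ltnS => ik; rewrite nth_mkseq// /tag /node nth_rcons size_nseq.
by rewrite nth_nseq if_same; case: ltngtP ik.
Qed.

Lemma node_tag n p : U (node n) (e (tag n p)).
Proof. by rewrite -(mkseq_tag n p); apply: Ue. Qed.

Lemma node_nseq n k x : U (node (n + k)) x -> U (nseq n false) x.
Proof.
rewrite /node => /Us; elim: k => [|k IH]; first by rewrite addn0.
by rewrite addnS -[_.+1]addn1 nseqD cats1 => /Us.
Qed.

Lemma node_disj n m x : U (node n) x -> U (node m) x -> n = m.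
Proof.
wlog : n m / (n <= m)%N.
  by move=> H nx mx; case: (leqP n m) => [|/ltnW] h; [|apply/esym]; apply: H.
rewrite leq_eqVlt => /orP[/eqP//|nm] nx mx; exfalso.
have : U (nseq n.+1 false) x by apply: (@node_nseq _ (m - n.+1)); rewrite subnKC.
by rewrite -addn1 nseqD cats1; apply: Ud nx.
Qed.

Lemma tag_inj n m p q : tag n p = tag m q -> n = m /\ p = q.
Proof.
move=> h; have nm : n = m.
  by apply: node_disj (node_tag n p) _; rewrite h; apply: node_tag.
by subst m; split=> //; rewrite -(tagK n p) h tagK.
Qed.

Lemma Bm_tag n g : Bm g -> Bm (fun x => tag n (g x)).
Proof.
move=> bg k; rewrite /tag; case: (_ < _)%N; first exact: Del_cst.
by case: (_ == _); [exact: Del_cst|exact: bg].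
Qed.

Definition Psi (a : set nat) : set X :=
  e @` [set y | exists n p, [/\ a n, piece n p & y = tag n p]].

Lemma Psi_tag a n p : Psi a (e (tag n p)) <-> a n /\ piece n p.
Proof.
split=> [[y [m [q [am mq ->]]] /e_inj/tag_inj[<- <-]]//|[an np]].
by exists (tag n p) => //; exists n, p.
Qed.

Lemma Psi_coanalytic a : coanalytic X (Psi a).
Proof.
apply: coanalytic_image.
apply: (@eq_Sig (fun y => forall n, ~ a n \/ mkseq y n.+1 <> node n \/ ~ piece n (untag n y))).
  move=> y; split=> [h [n [p [an np yE]]]|ny n].
    have [//|[]] := h n; first by rewrite yE mkseq_tag.
    by rewrite yE tagK.
  have [an|] := pselect (a n); last by left.
  have [yn|] := pselect (mkseq y n.+1 = node n); last by right; left.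
  right; right=> np; apply: ny; exists n, (untag n y); split=> //.
  by rewrite untagK.
apply: Sig_all => [|n]; first delq.
apply: Sig_or; first exact: Sig_cst.
apply: Sig_or; first by apply: Del_SigN; apply: Del_prefix; apply: Bm_id.
by apply: (Sig_comp (Sig_npiece n)); apply: (Bm_sub (fun i => n.+1 + i)%N Bm_id).
Qed.

(** The constant sequence [true] makes [cLt] reflexive, hence ill-founded. It provides in each node
    a point outside every [Psi a], onto which the node can be collapsed. *)
Lemma ones_npiece n : ~ piece n (fun=> true).
Proof.
move=> [/code_wf wf _ _]; apply: (well_foundedPn _).2 wf.
by exists (fun=> 0%N) => i; apply: rel_ones.
Qed.

(** The map collapses the nodes with index in [b] but not in [a] to points outside [Psi b], and
    fixes everything else. For two points not in a common collapsed node, they are moved one after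
    the other, each time by [bl_move]. *)
Lemma Psi_Lip a b : a `<=` b -> reduces (Lip1 X) (Psi a) (Psi b).
Proof.
move=> ab; pose bad n x := [/\ b n, ~ a n & U (node n) x].
pose o n := e (tag n (fun=> true)).
have /choice[h hP] : forall x, exists z, (forall n, bad n x -> z = o n) /\
    ((forall n, ~ bad n x) -> z = x).
  move=> x; have [[n bn]|nb] := pselect (exists n, bad n x).
    exists (o n); split=> [m bm|/(_ n)//].
    by rewrite (@node_disj n m x)//; [case: bn|case: bm].
  by exists x; split=> // n bn; case: nb; exists n.
have on n : U (node n) (o n) by apply: node_tag.
exists h.
  have move1 x z : (forall n, bad n x -> ~ U (node n) z) -> (mdist (h x) z <= mdist x z)%R.
    move=> xz; have [[n bn]|nb] := pselect (exists n, bad n x); last first.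
      by rewrite (hP x).2// => n bn; apply: nb; exists n.
    rewrite ((hP x).1 n bn); have nz := xz n bn; have [_ _ nx] := bn; have := on n.
    have [c [r [_ E]]] := Ubl (node n); rewrite E in nx nz * => ox.
    exact: bl_move nx ox nz.
  move=> x z; have [[n [bx nz]]|nxz] := pselect (exists n, bad n x /\ U (node n) z).
    have bz : bad n z by case: bx.
    by rewrite ((hP x).1 n bx) ((hP z).1 n bz) mdistxx mdist_ge0.
  have zx n : bad n z -> ~ U (node n) x.
    by move=> [bn an nz] nx; apply: nxz; exists n.
  have xhz n : bad n x -> ~ U (node n) (h z).
    move=> bx nhz; have nz : ~ U (node n) z by move=> nz; apply: nxz; exists n.
    have [[m bm]|nb] := pselect (exists m, bad m z); last first.
      by apply: nz; rewrite -(hP z).2// => m bm; apply: nb; exists m.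
    rewrite ((hP z).1 m bm) in nhz; apply: nz.
    by rewrite (node_disj nhz (on m)); case: bm.
  apply: le_trans (move1 x (h z) xhz) _.
  by rewrite metric_sym [leRHS]metric_sym; apply: move1.
apply/seteqP; split=> x /=.
  move=> [y [n [p [an np yE]]] yx]; rewrite (hP x).2.
    by rewrite -yx yE; apply/Psi_tag; split=> //; apply: ab.
  move=> m [bm nam]; rewrite -yx yE => /(node_disj (node_tag n p)) nm.
  by apply: nam; rewrite -nm.
have [[n bn]|nb] := pselect (exists n, bad n x).
  by rewrite ((hP x).1 n bn) => /Psi_tag[_ /ones_npiece].
have nb' n : ~ bad n x by move=> bn; apply: nb; exists n.
rewrite (hP x).2// => -[y [n [p [bn np yE]]] yx].
exists y => //; exists n, p; split=> //; apply: contrapT => nan; apply: (nb' n).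
by split=> //; rewrite -yx yE; apply: node_tag.
Qed.

Lemma Psi_Bor (VL : V_eq_L) a b : reduces (Bor X) (Psi a) (Psi b) -> a `<=` b.
Proof.
move=> [f bf fE] n an; apply: contrapT => nbn.
have fP x : Psi a x <-> Psi b (f x) by rewrite fE.
pose G p m q := f (e (tag n p)) = e (tag m q).
have Gf p m q m' q' : G p m q -> G p m' q' -> m = m' /\ q = q'.
  by move=> h h'; apply: tag_inj; apply: e_inj; rewrite -h.
apply: (diagonal VL nbn Gf); last first.
  move=> p; have -> : piece n p <-> Psi b (f (e (tag n p))).
    by rewrite -fP Psi_tag; split=> [|[]].
  split=> [[_ [m [q [bm mq ->]]] fq]|[m [q [bm mq Gq]]]].
    by exists m, q.
  by rewrite Gq; apply/Psi_tag.
apply: Sig_ex => [|m]; first delq.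
apply: Del_Sig; apply: Del_and.
  apply: (@eq_Del (fun u => forall k, p1 (p2 u) k = natb m k)).
    by move=> u; split=> [h|-> //]; apply/funext.
  by apply: Del_all => [|k]; [delq|apply: Del_eqb; bm].
(* A point equals [e y] when it lies in the nodes of all prefixes of [y]; preimages of nodes under
   [f] are Borel, so the graph of the reduction is bi-analytic. *)
apply: (@eq_Del (fun u => forall s, mkseq (tag m (p2 (p2 u))) (size s) = s ->
    (f @^-1` U s) (e (tag n (p1 u))))).
  move=> u; rewrite /G; split=> [h|h s <-]; last by rewrite /= h; apply: Ue.
  apply: (proj1 (Ux _)) => k; apply: (h (mkseq _ k)).
  by rewrite size_mkseq.
apply: Del_all => [|s]; first delq.
apply: Del_imp; first by apply: Del_prefix; apply: Bm_tag; bm.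
apply: Del_borel; last by apply: Bm_tag; bm.
apply: bf; apply: sub_gen_smallest; have [c [r [_ ->]]] := Ubl s.
exact: open_bl.
Qed.

End scheme.

Theorem theorem6p10 (VL : V_eq_L) (R : realType) (X : metricType R)
    (polX : ultrametric_polish X) (uncountX : ~ countable [set: X]) :
  (exists psi : set nat -> set X,
    [/\ forall a : set nat, coanalytic X (psi a),
        forall a b : set nat, a `<=` b -> reduces (Lip1 X) (psi a) (psi b) &
        forall a b : set nat, reduces (Bor X) (psi a) (psi b) -> a `<=` b]) /\
  (forall F : set (X -> X), reducibility F ->
     Lip1 X `<=` F -> F `<=` Bor X ->
     embeds_into (fun a b : set nat => a `<=` b)
       (hierarchy F (coanalytic X)) (degree_le F) /\
     very_bad (hierarchy F (coanalytic X)) (degree_le F)).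
Proof.
have [psi [psiC psiL psiB]] : exists psi : set nat -> set X,
    [/\ forall a : set nat, coanalytic X (psi a),
        forall a b : set nat, a `<=` b -> reduces (Lip1 X) (psi a) (psi b) &
        forall a b : set nat, reduces (Bor X) (psi a) (psi b) -> a `<=` b].
  have [um comp sep] := polX.
  have [U [e [Ubl Us Ud Ue Ux]]] := cantor_scheme um sep comp uncountX.
  exists (Psi e); split=> [a|a b|a b].
  - exact: (Psi_coanalytic um Ubl Us Ud Ue Ux).
  - exact: (Psi_Lip um Ubl Us Ud Ue).
  - exact: (Psi_Bor um Ubl Us Ud Ue Ux VL).
split; first by exists psi.
move=> F [Fid Fcomp] LF FB.
have redF a b : reduces F (psi a) (psi b) <-> a `<=` b.
  split=> [[f Ff fE]|/psiL[f Lf fE]]; last by exists f => //; apply: LF.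
  by apply: psiB; exists f => //; apply: FB.
have red_id A : reduces F A A by exists id.
have red_trans A B D : reduces F A B -> reduces F B D -> reduces F A D.
  move=> [f Ff ->] [g Fg ->]; exists (g \o f) => //; exact: Fcomp.
pose phi a := degree F (coanalytic X) (psi a).
have phiH a : hierarchy F (coanalytic X) (phi a) by exists (psi a).
have phiP a b : a `<=` b <-> degree_le F (phi a) (phi b).
  rewrite -redF; split=> [ab|[A [B [[_ aA Aa] [_ bB Bb] AB]]]].
    by exists (psi a), (psi b); split.
  exact: red_trans aA (red_trans _ _ _ AB Bb).
have phi_inj : injective phi.
  move=> a b ab; have h c d : phi c = phi d -> c `<=` d.
    by move=> cd; apply/phiP; rewrite -cd; apply/phiP.
  by apply/seteqP; split; apply: h.
split; first by exists phi.
split.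
  exists (range (fun n : nat => phi [set n])); split.
  - by move=> _ [n _ <-].
  - have ci : {in [set: nat] &, injective (fun n => phi [set n])}.
      by move=> n m _ _ /phi_inj/seteqP[/(_ n erefl)].
    by rewrite (eq_finite_set (inj_card_eq ci)); apply: infinite_nat.
  - move=> _ _ [n _ <-] [m _ <-] nm /phiP h; apply: nm.
    by have -> : n = m := h n erefl.
exists (fun n => phi [set k | (n <= k)%N]) => n; split=> //.
  by apply/phiP => k /=; apply: ltnW.
move=> /phiP/(_ n (leqnn n)) /=; by rewrite ltnn.
Qed.
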